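(* Let $c_d\ge2$. There exist absolute constants $c_0,c_1,C>0$ such that the following holds. Suppose $p>\frac{c_0\kappa^5\log n}{n}$ and $d=c_d np$. Then with probability at least $1-O(n^{-5})$: (1) the spectral estimate satisfies $\frac{\|\pi-\pi^*\|_\infty}{\|\pi^*\|_\infty}\le C\kappa\sqrt{\frac{\log n}{npL}}$; (2) if moreover $\frac{n^2pL}{2}\ge c_1\frac{\kappa^2 n\log n}{\Delta_K^2}$, then the spectral method recovers the top-$K$ set exactly, i.e. the $K$ largest entries of $\pi$ are strictly larger than all other entries and occur exactly at indices $\{1,\dots,K\}$.
   Context: Bradley–Terry–Luce (BTL) setup. There are $n$ items with unknown preference scores $w_1^*\ge w_2^*\ge\cdots\ge w_n^*>0$, all lying in $[w_{\min},w_{\max}]$ with $w_{\min}>0$; set $\theta_i^*=\log w_i^*$ and $\kappa=w_{\max}/w_{\min}$. A comparison graph $\mathcal G=(\{1,\dots,n\},\mathcal E)$ is drawn from the Erdős–Rényi model $\mathcal G_{n,p}$ (each unordered pair is an edge independently with probability $p$). For each edge $(i,j)\in\mathcal E$ one observes $L$ comparisons $y_{i,j}^{(l)}$, $l=1,\dots,L$, where $y_{i,j}^{(l)}=1$ with probability $y^*_{i,j}:=\frac{w_j^*}{w_i^*+w_j^*}$ and $0$ otherwise, with the convention $y_{j,i}^{(l)}=1-y_{i,j}^{(l)}$; all comparisons are mutually independent and independent of $\mathcal G$. Let $y_{i,j}=\frac1L\sum_{l=1}^L y_{i,j}^{(l)}$. Separation: $\Delta_K=\frac{w_K^*-w_{K+1}^*}{w_{\max}}$.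 Spectral method: for $d>0$ define $P$ by $P_{i,j}=\frac1d y_{i,j}$ if $(i,j)\in\mathcal E$, $P_{i,i}=1-\frac1d\sum_{k:(i,k)\in\mathcal E}y_{i,k}$, and $P_{i,j}=0$ otherwise; $\pi$ is the stationary distribution of $P$ (leading left eigenvector normalized to sum to $1$), and the method outputs the $K$ items with the largest entries of $\pi$. The normalized score vector is $\pi^*=\frac{1}{\sum_i w_i^*}(w_1^*,\dots,w_n^* )^\top$. *)

(* Defs.v *)
From Stdlib Require Import Reals Lra Lia List Arith.
From Stdlib Require Import Classical ClassicalEpsilon.
Import ListNotations.
Open Scope R_scope.

(** Items are indexed 0, ..., n-1 (item i of the paper is index i-1). *)

Definition fsum (n : nat) (f : nat -> R) : R :=
  fold_right Rplus 0 (map f (seq 0 n)).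

Definition linf (n : nat) (f : nat -> R) : R :=
  fold_right Rmax 0 (map (fun i => Rabs (f i)) (seq 0 n)).

Definition pairs (n : nat) : list (nat * nat) :=
  flat_map (fun i => map (fun j => (i, j)) (seq (S i) (n - S i))) (seq 0 n).

(** Sample space: one entry per pair (in the order of [pairs n]):
    (edge indicator, list of the L comparison bits y_{i,j}^{(l)}, i<j). *)
Definition Omega := list (bool * list bool).

Fixpoint bitlists (k : nat) : list (list bool) :=
  match k with
  | O => [[]]
  | S k => flat_map (fun b => map (cons b) (bitlists k)) [true; false]
  end.

Definition entries (L : nat) : list (bool * list bool) :=
  flat_map (fun e => map (fun ys => (e, ys)) (bitlists L)) [true; false].

Fixpoint outcomes (m L : nat) : list Omega :=
  match m with
  | O => [[]]
  | S m => flat_map (fun x => map (cons x) (outcomes m L)) (entries L)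
  end.

Definition ystar (w : nat -> R) (i j : nat) : R := w j / (w i + w j).

Definition entry_weight (p : R) (w : nat -> R) (i j : nat)
  (x : bool * list bool) : R :=
  (if fst x then p else 1 - p) *
  fold_right Rmult 1
    (map (fun y : bool => if y then ystar w i j else 1 - ystar w i j) (snd x)).

(** Probability of an outcome: independent Erdos-Renyi edges and independent
    Bernoulli(y*_{i,j}) comparisons. *)
Definition weight (n : nat) (p : R) (w : nat -> R) (om : Omega) : R :=
  fold_right Rmult 1
    (map (fun q => entry_weight p w (fst (fst q)) (snd (fst q)) (snd q))
       (combine (pairs n) om)).

Definition prob (n L : nat) (p : R) (w : nat -> R) (E : Omega -> Prop) : R :=
  fold_right Rplus 0
    (map (fun om => if excluded_middle_informative (E om) then weight n p w om else 0)
       (outcomes (length (pairs n)) L)).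

Fixpoint lookup_pair (i j : nat) (l : list ((nat * nat) * (bool * list bool)))
  : option (bool * list bool) :=
  match l with
  | [] => None
  | ((a, b), v) :: t => if (Nat.eqb a i && Nat.eqb b j)%bool then Some v
                        else lookup_pair i j t
  end.

Definition obs (n : nat) (om : Omega) (i j : nat) : option (bool * list bool) :=
  lookup_pair i j (combine (pairs n) om).

Definition edge (n : nat) (om : Omega) (i j : nat) : bool :=
  if Nat.ltb i j then
    match obs n om i j with Some x => fst x | None => false end
  else if Nat.ltb j i then
    match obs n om j i with Some x => fst x | None => false end
  else false.

Definition frac_true (L : nat) (ys : list bool) : R :=
  INR (length (filter (fun b : bool => b) ys)) / INR L.

(** y_{i,j} = (1/L) sum_l y_{i,j}^{(l)}, with y_{j,i}^{(l)} = 1 - y_{i,j}^{(l)}. *)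
Definition ybar (n L : nat) (om : Omega) (i j : nat) : R :=
  if Nat.ltb i j then
    match obs n om i j with Some x => frac_true L (snd x) | None => 0 end
  else if Nat.ltb j i then
    match obs n om j i with Some x => 1 - frac_true L (snd x) | None => 0 end
  else 0.

Definition Pmat (n L : nat) (d : R) (om : Omega) (i j : nat) : R :=
  if Nat.eqb i j then
    1 - / d * fsum n (fun k => if edge n om i k then ybar n L om i k else 0)
  else if edge n om i j then / d * ybar n L om i j else 0.

Definition stationary (n : nat) (P : nat -> nat -> R) (pi : nat -> R) : Prop :=
  fsum n pi = 1 /\
  forall j, (j < n)%nat -> fsum n (fun i => pi i * P i j) = pi j.

Definition pistar (n : nat) (w : nat -> R) (i : nat) : R := w i / fsum n w.

(** Separation Delta_K = (w*_K - w*_{K+1}) / w_max  (1-indexed in the paper). *)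
Definition DeltaK (w : nat -> R) (wmax : R) (K : nat) : R :=
  (w (K - 1)%nat - w K) / wmax.

(** Top-K recovery: the entries at paper indices 1..K (our 0..K-1) are
    strictly larger than all other entries. *)
Definition topK_recovered (n K : nat) (pi : nat -> R) : Prop :=
  forall i j, (i < K)%nat -> (K <= j)%nat -> (j < n)%nat -> pi j < pi i.

(* Main.v *)
Require Import Defs.
From Stdlib Require Import Reals Lra Lia List Arith.
From Stdlib Require Import Classical ClassicalEpsilon FunctionalExtensionality Permutation.
Import ListNotations.
Open Scope R_scope.

(** Write [pi i = w i * x i] and let [k i j] be [y_ij] on edges and [0] elsewhere; then
    [pi] is stationary iff [M x = 0], where
    [(M f) j = sum_i (w j * f j * k j i - w i * f i * k i j)], and [M 1] is pure noise.
    Because [k i j + k j i] is the adjacency matrix [A],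
      [<f, M f> = 1/2 sum_ij w i * k i j * (f i - f j)^2 + 1/2 sum_j (M 1) j * (f j)^2],
    so the spectral gap of the random graph alone makes [M] invertible on mean-zero vectors,
    with [|f| <= O(kappa / (n p)) |M f|], without any operator-norm bound on the noise. The
    gap follows from Cheeger's inequality and a union bound over vertex subsets.

    This gives the l2 error of [x - 1], where a variance-sensitive (Bernstein) bound on [M 1]
    is what keeps the factor [kappa] optimal. For the entrywise bound at a vertex [v], one compares
    [x] with the solution of the system in which [v] is deleted: it is independent of the
    comparisons of [v], so its weighted sum over the neighbours of [v] concentrates, and
    it is l2-close to [x] by the same stability estimate. *)

(** On an edge the noise [w i * y_ij - w j * y_ji] has mean zero and variance exactly
    [w i * w j / L]. Over the neighbours of [v] this adds up to about [p * W * w v / L], with [W]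
    the total weight, and summing once more over [v] produces [W] again. Replacing the weights by 1
    could enlarge the result by a factor kappa^2.

    The entrywise argument is circular: the residual of the deleted system at [v] involves the size
    of its solution, which is only known through the error that is being bounded. Each return picks
    up a small factor kappa * rho, where rho = sqrt (log n / (n p)) is the relative fluctuation of a
    degree, and the loop closes by absorption once kappa^2 * rho is small; hence a power kappa^4 in
    the lower bound on n p.

    [stationary] imposes no sign, so every normalised left eigenvector has to be covered, and
    existence is part of the claim. Both come from [M] without Perron-Frobenius: its columns sum to
    zero, which yields a kernel vector, and the stability estimate forbids nonzero kernel vectors of
    sum zero. *)

(** * Finite sums and products over lists and index ranges *)

Definition lsum {A : Type} (l : list A) (f : A -> R) : R :=
  fold_right Rplus 0 (map f l).

Definition lprod {A : Type} (l : list A) (f : A -> R) : R :=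
  fold_right Rmult 1 (map f l).

Lemma lsum_cons {A} (a : A) l f : lsum (a :: l) f = f a + lsum l f.
Proof. reflexivity. Qed.

Lemma lprod_cons {A} (a : A) l f : lprod (a :: l) f = f a * lprod l f.
Proof. reflexivity. Qed.

Lemma lsum_app {A} (l l' : list A) f : lsum (l ++ l') f = lsum l f + lsum l' f.
Proof. induction l; simpl; unfold lsum in *; simpl; [lra | rewrite IHl; lra]. Qed.

Lemma lsum_ext {A} (l : list A) f g :
  (forall x, In x l -> f x = g x) -> lsum l f = lsum l g.
Proof.
induction l as [|a l IH]; intros H; [reflexivity|].
rewrite !lsum_cons, H, IH; simpl; auto. intros; apply H; simpl; auto.
Qed.

Lemma lsum_map {A B} (h : A -> B) (l : list A) f :
  lsum (map h l) f = lsum l (fun x => f (h x)).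
Proof. unfold lsum. now rewrite map_map. Qed.

Lemma lsum_plus {A} (l : list A) f g :
  lsum l (fun x => f x + g x) = lsum l f + lsum l g.
Proof. induction l; [unfold lsum; simpl; lra|]. rewrite !lsum_cons, IHl; lra. Qed.

Lemma lsum_minus {A} (l : list A) f g :
  lsum l (fun x => f x - g x) = lsum l f - lsum l g.
Proof. induction l; [unfold lsum; simpl; lra|]. rewrite !lsum_cons, IHl; lra. Qed.

Lemma lsum_scal {A} (l : list A) c f :
  lsum l (fun x => c * f x) = c * lsum l f.
Proof. induction l; [unfold lsum; simpl; lra|]. rewrite !lsum_cons, IHl; lra. Qed.

Lemma lsum_scal_r {A} (l : list A) c f :
  lsum l (fun x => f x * c) = lsum l f * c.
Proof. induction l; [unfold lsum; simpl; lra|]. rewrite !lsum_cons, IHl; lra. Qed.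

Lemma lsum_const {A} (l : list A) c : lsum l (fun _ => c) = INR (length l) * c.
Proof.
induction l; [unfold lsum; simpl; lra|].
rewrite lsum_cons, IHl. cbn [length]. rewrite S_INR. lra.
Qed.

Lemma lsum_0 {A} (l : list A) f : (forall x, In x l -> f x = 0) -> lsum l f = 0.
Proof. intros H. rewrite (lsum_ext _ f (fun _ => 0) H), lsum_const. lra. Qed.

Lemma lsum_le {A} (l : list A) f g :
  (forall x, In x l -> f x <= g x) -> lsum l f <= lsum l g.
Proof.
induction l as [|a l IH]; intros H; [unfold lsum; simpl; lra|].
rewrite !lsum_cons. apply Rplus_le_compat; [apply H; simpl; auto|].
apply IH. intros; apply H; simpl; auto.
Qed.

Lemma lsum_nonneg {A} (l : list A) f :
  (forall x, In x l -> 0 <= f x) -> 0 <= lsum l f.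
Proof.
intros H. replace 0 with (lsum l (fun _ => 0)) by (rewrite lsum_const; lra).
now apply lsum_le.
Qed.

Lemma lsum_term_le {A} (l : list A) f a :
  (forall x, In x l -> 0 <= f x) -> In a l -> f a <= lsum l f.
Proof.
induction l as [|b l IH]; intros H Ha; [easy|]. rewrite lsum_cons.
assert (Hb : 0 <= f b) by (apply H; simpl; auto).
assert (Hl : 0 <= lsum l f) by (apply lsum_nonneg; intros; apply H; simpl; auto).
destruct Ha as [->|Ha]; [lra|].
assert (f a <= lsum l f) by (apply IH; auto; intros; apply H; simpl; auto). lra.
Qed.

Lemma lsum_perm {A} (l l' : list A) f : Permutation l l' -> lsum l f = lsum l' f.
Proof.
induction 1; auto; rewrite ?lsum_cons; try lra.
Qed.

Lemma lsum_swap {A B} (l : list A) (l' : list B) f :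
  lsum l (fun x => lsum l' (fun y => f x y)) = lsum l' (fun y => lsum l (fun x => f x y)).
Proof.
induction l; [rewrite (lsum_0 l'); auto|].
rewrite lsum_cons, IHl, <- lsum_plus. apply lsum_ext; intros; now rewrite lsum_cons.
Qed.

Lemma lsum_flat_map {A B} (h : A -> list B) (l : list A) f :
  lsum (flat_map h l) f = lsum l (fun x => lsum (h x) f).
Proof. induction l; [reflexivity|]. simpl. now rewrite lsum_app, IHl, lsum_cons. Qed.

Lemma lsum_cauchy {A} (l : list A) f g :
  (lsum l (fun x => f x * g x)) ^ 2 <= lsum l (fun x => f x ^ 2) * lsum l (fun x => g x ^ 2).
Proof.
induction l as [|x l IH]; [unfold lsum; simpl; lra|]. rewrite !lsum_cons.
assert (HF : 0 <= lsum l (fun x => f x ^ 2)) by (apply lsum_nonneg; intros; nra).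
assert (HG : 0 <= lsum l (fun x => g x ^ 2)) by (apply lsum_nonneg; intros; nra).
revert IH HF HG. generalize (lsum l (fun x => f x ^ 2)) (lsum l (fun x => g x ^ 2))
  (lsum l (fun x => f x * g x)) (f x) (g x). clear.
intros F G S a b H HF HG.
assert (2 * (a * b * S) <= a ^ 2 * G + b ^ 2 * F).
{ apply Rle_trans with (Rabs (2 * (a * b * S))); [apply Rle_abs|].
  assert (0 <= a ^ 2 * G + b ^ 2 * F) by nra.
  rewrite <- (Rabs_right (a ^ 2 * G + b ^ 2 * F)) by lra.
  apply Rsqr_le_abs_0. unfold Rsqr.
  assert (0 <= (a ^ 2 * G - b ^ 2 * F) ^ 2) by apply pow2_ge_0.
  assert ((a*b)^2 * S ^ 2 <= (a*b)^2 * (F * G)).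
  { apply Rmult_le_compat_l; auto. apply pow2_ge_0. }
  nra. }
nra.
Qed.

Lemma exp_lsum {A} (l : list A) f : exp (lsum l f) = lprod l (fun x => exp (f x)).
Proof.
induction l; [apply exp_0|]. now rewrite lsum_cons, lprod_cons, exp_plus, IHl.
Qed.

Lemma lprod_nonneg {A} (l : list A) f :
  (forall x, In x l -> 0 <= f x) -> 0 <= lprod l f.
Proof.
induction l as [|a l IH]; intros H; [unfold lprod; simpl; lra|].
rewrite lprod_cons. apply Rmult_le_pos; [|apply IH; intros]; apply H; simpl; auto.
Qed.

Lemma lprod_le {A} (l : list A) f g :
  (forall x, In x l -> 0 <= f x <= g x) -> lprod l f <= lprod l g.
Proof.
induction l as [|a l IH]; intros H; [unfold lprod; simpl; lra|].
rewrite !lprod_cons. apply Rmult_le_compat.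
- apply H; simpl; auto.
- apply lprod_nonneg. intros; apply H; simpl; auto.
- apply H; simpl; auto.
- apply IH. intros; apply H; simpl; auto.
Qed.

Lemma in_seq0 n i : In i (seq 0 n) <-> (i < n)%nat.
Proof. rewrite in_seq. lia. Qed.

Lemma fsum_lsum n f : fsum n f = lsum (seq 0 n) f.
Proof. reflexivity. Qed.

Lemma fsum_S n f : fsum (S n) f = fsum n f + f n.
Proof. rewrite !fsum_lsum, seq_S, lsum_app. unfold lsum; simpl; lra. Qed.

Lemma fsum_ext n f g : (forall i, (i < n)%nat -> f i = g i) -> fsum n f = fsum n g.
Proof. intros H; apply lsum_ext; intros x Hx; apply H; now apply in_seq0. Qed.

Lemma fsum_plus n f g : fsum n (fun i => f i + g i) = fsum n f + fsum n g.
Proof. apply lsum_plus. Qed.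

Lemma fsum_minus n f g : fsum n (fun i => f i - g i) = fsum n f - fsum n g.
Proof. apply lsum_minus. Qed.

Lemma fsum_scal n c f : fsum n (fun i => c * f i) = c * fsum n f.
Proof. apply lsum_scal. Qed.

Lemma fsum_scal_r n c f : fsum n (fun i => f i * c) = fsum n f * c.
Proof. apply lsum_scal_r. Qed.

Lemma fsum_const n c : fsum n (fun _ => c) = INR n * c.
Proof. rewrite fsum_lsum, lsum_const, length_seq. reflexivity. Qed.

Lemma fsum_0 n f : (forall i, (i < n)%nat -> f i = 0) -> fsum n f = 0.
Proof. intros H; apply lsum_0; intros x Hx; apply H; now apply in_seq0. Qed.

Lemma fsum_le n f g : (forall i, (i < n)%nat -> f i <= g i) -> fsum n f <= fsum n g.
Proof. intros H; apply lsum_le; intros x Hx; apply H; now apply in_seq0. Qed.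

Lemma fsum_nonneg n f : (forall i, (i < n)%nat -> 0 <= f i) -> 0 <= fsum n f.
Proof. intros H; apply lsum_nonneg; intros x Hx; apply H; now apply in_seq0. Qed.

Lemma fsum_term_le n f i :
  (forall i, (i < n)%nat -> 0 <= f i) -> (i < n)%nat -> f i <= fsum n f.
Proof.
intros H Hi; apply (lsum_term_le (seq 0 n)); [|now apply in_seq0].
intros x Hx; apply H; now apply in_seq0.
Qed.

Lemma fsum_swap n m f :
  fsum n (fun i => fsum m (fun j => f i j)) = fsum m (fun j => fsum n (fun i => f i j)).
Proof. apply lsum_swap. Qed.

Lemma fsum_cauchy n f g :
  (fsum n (fun i => f i * g i)) ^ 2 <= fsum n (fun i => f i ^ 2) * fsum n (fun i => g i ^ 2).
Proof. apply lsum_cauchy. Qed.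

Lemma fsum_delta n v c :
  (v < n)%nat -> fsum n (fun i => if Nat.eqb i v then c else 0) = c.
Proof.
induction n as [|n IH]; intros H; [lia|]. rewrite fsum_S.
destruct (Nat.eq_dec v n) as [->|Hv].
- rewrite Nat.eqb_refl, fsum_0; [lra|]. intros i Hi.
  destruct (Nat.eqb_spec i n); [lia|reflexivity].
- rewrite IH by lia. destruct (Nat.eqb_spec n v); [lia|lra].
Qed.

Lemma fsum_split n v f :
  (v < n)%nat -> fsum n f = f v + fsum n (fun i => if Nat.eqb i v then 0 else f i).
Proof.
intros H. rewrite <- (fsum_delta n v (f v) H) at 1. rewrite <- fsum_plus.
apply fsum_ext. intros i _. destruct (Nat.eqb_spec i v); subst; lra.
Qed.

(** * Nonzero solutions of singular linear systems *)

(** Gaussian elimination, one equation at a time: if equation [e] has a nonzero coefficient, its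
    unknown is solved for and substituted into the remaining equations; otherwise [e] holds for
    every vector and is dropped. *)
Lemma underdetermined_kernel (c : nat -> nat -> R) (eqs l : list nat) :
  NoDup l -> (length eqs < length l)%nat ->
  exists x : nat -> R, (exists i, In i l /\ x i <> 0) /\
    forall j, In j eqs -> lsum l (fun i => c j i * x i) = 0.
Proof.
revert l c. induction eqs as [|e eqs IH]; intros l c Hl Hlen.
{ destruct l as [|i l]; [simpl in Hlen; lia|].
  exists (fun _ => 1). split; [exists i; simpl; split; auto; lra|easy]. }
destruct (classic (exists i0, In i0 l /\ c e i0 <> 0)) as [(i0 & Hi0 & Hc)|Hz].
- destruct (in_split _ _ Hi0) as (l1 & l2 & ->).
  assert (HP : Permutation (l1 ++ i0 :: l2) (i0 :: l1 ++ l2))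
    by (apply Permutation_sym, Permutation_middle).
  assert (Hnd := Permutation_NoDup HP Hl). inversion Hnd as [|? ? Hni Hnd' ]; subst.
  assert (Hlen' : (length eqs < length (l1 ++ l2))%nat).
  { rewrite length_app in *. simpl in Hlen. lia. }
  destruct (IH (l1 ++ l2) (fun j i => c j i - c e i / c e i0 * c j i0) Hnd' Hlen')
    as (y & (i1 & Hi1 & Hy1) & Hy).
  set (l' := l1 ++ l2) in *.
  set (x := fun i => if Nat.eqb i i0 then - lsum l' (fun i => c e i * y i) / c e i0 else y i).
  assert (Hx : forall j, lsum l' (fun i => c j i * x i) = lsum l' (fun i => c j i * y i)).
  { intros j; apply lsum_ext; intros i Hi; unfold x.
    destruct (Nat.eqb_spec i i0); [subst; easy|reflexivity]. }
  exists x. split.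
  + exists i1. split.
    * apply (Permutation_in _ (Permutation_sym HP)). now right.
    * unfold x. destruct (Nat.eqb_spec i1 i0); [subst; easy|assumption].
  + intros j Hj. rewrite (lsum_perm _ _ _ HP), lsum_cons, Hx.
    unfold x at 1. rewrite Nat.eqb_refl.
    destruct Hj as [<-|Hj]; [field; assumption|].
    specialize (Hy j Hj).
    rewrite (lsum_ext _ _ (fun i => c j i * y i - (c j i0 / c e i0) * (c e i * y i))) in Hy
      by (intros; field; assumption).
    rewrite lsum_minus, lsum_scal in Hy.
    replace (c j i0 * (- lsum l' (fun i => c e i * y i) / c e i0))
      with (- (c j i0 / c e i0 * lsum l' (fun i => c e i * y i))) by (field; assumption).
    lra.
- destruct (IH l c Hl) as (x & Hx & Hy); [simpl in Hlen; lia|].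
  exists x. split; [assumption|]. intros j [<-|Hj]; [|auto].
  apply lsum_0. intros i Hi.
  destruct (Req_dec (c e i) 0) as [->|Hc]; [lra|]. exfalso; apply Hz; eauto.
Qed.

(** The left null vector makes equation [j0] a combination of the others. Dropping it leaves fewer
    equations than unknowns, and a solution of the rest satisfies equation [j0] as well. *)
Lemma singular_kernel (n : nat) (c : nat -> nat -> R) (u : nat -> R) (j0 : nat) :
  (j0 < n)%nat -> u j0 <> 0 ->
  (forall i, (i < n)%nat -> fsum n (fun j => u j * c j i) = 0) ->
  exists x : nat -> R, (exists i, (i < n)%nat /\ x i <> 0) /\
    forall j, (j < n)%nat -> fsum n (fun i => c j i * x i) = 0.
Proof.
intros Hj0 Hu Hnull.
destruct (in_split j0 (seq 0 n)) as (l1 & l2 & Hs); [now apply in_seq0|].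
destruct (underdetermined_kernel c (l1 ++ l2) (seq 0 n)) as (x & (i & Hi & Hxi) & Hx).
- apply seq_NoDup.
- rewrite Hs, !length_app. simpl. lia.
- exists x. split; [exists i; split; auto; now apply in_seq0|].
  assert (Hother : forall j, (j < n)%nat -> j <> j0 -> fsum n (fun i => c j i * x i) = 0).
  { intros j Hj Hjj. apply Hx. apply in_seq0 in Hj. rewrite Hs in Hj.
    apply in_app_or in Hj. apply in_or_app. simpl in Hj. intuition congruence. }
  intros j Hj. destruct (Nat.eq_dec j j0) as [->|Hjj]; [|auto].
  assert (H0 : fsum n (fun j => u j * fsum n (fun i => c j i * x i)) = 0).
  { rewrite (fsum_ext n _ (fun j => fsum n (fun i => u j * c j i * x i))).
    2:{ intros; rewrite <- fsum_scal; apply fsum_ext; intros; ring. }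
    rewrite fsum_swap. apply fsum_0. intros k Hk.
    rewrite fsum_scal_r, Hnull by assumption. ring. }
  rewrite (fsum_split n j0 _ Hj0) in H0.
  rewrite (fsum_0 n (fun k => if Nat.eqb k j0 then 0 else _)) in H0.
  + rewrite Rplus_0_r in H0. apply Rmult_integral in H0. tauto.
  + intros k Hk. destruct (Nat.eqb_spec k j0); [reflexivity|].
    rewrite Hother by assumption. ring.
Qed.

Definition dsum (n : nat) (g : nat -> nat -> R) : R :=
  fsum n (fun i => fsum n (fun j => g i j)).

Lemma dsum_ext n f g :
  (forall i j, (i < n)%nat -> (j < n)%nat -> f i j = g i j) -> dsum n f = dsum n g.
Proof. intros H; apply fsum_ext; intros; apply fsum_ext; auto. Qed.

Lemma dsum_le n f g :
  (forall i j, (i < n)%nat -> (j < n)%nat -> f i j <= g i j) -> dsum n f <= dsum n g.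
Proof. intros H; apply fsum_le; intros; apply fsum_le; auto. Qed.

Lemma dsum_plus n f g : dsum n (fun i j => f i j + g i j) = dsum n f + dsum n g.
Proof. unfold dsum. rewrite <- fsum_plus. apply fsum_ext; intros; apply fsum_plus. Qed.

Lemma dsum_minus n f g : dsum n (fun i j => f i j - g i j) = dsum n f - dsum n g.
Proof. unfold dsum. rewrite <- fsum_minus. apply fsum_ext; intros; apply fsum_minus. Qed.

Lemma dsum_scal n c f : dsum n (fun i j => c * f i j) = c * dsum n f.
Proof. unfold dsum. rewrite <- fsum_scal. apply fsum_ext; intros; apply fsum_scal. Qed.

Lemma dsum_swap n f : dsum n f = dsum n (fun i j => f j i).
Proof. apply fsum_swap. Qed.

(** * Cheeger's inequality *)

Definition b2r (b : bool) : R := if b then 1 else 0.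

Definition gtb (x y : R) : bool := if Rlt_dec y x then true else false.

Lemma gtb_true x y : gtb x y = true <-> y < x.
Proof. unfold gtb; destruct (Rlt_dec y x); intuition congruence. Qed.

Lemma gtb_false x y : gtb x y = false <-> x <= y.
Proof. unfold gtb; destruct (Rlt_dec y x); intuition (try congruence; lra). Qed.

Definition card (n : nat) (chi : nat -> bool) : nat := length (filter chi (seq 0 n)).

Lemma card_fsum n chi : INR (card n chi) = fsum n (fun i => b2r (chi i)).
Proof.
unfold card. rewrite fsum_lsum. induction (seq 0 n) as [|a l IH]; [reflexivity|].
rewrite lsum_cons, <- IH. simpl filter. destruct (chi a); cbn [length b2r];
  rewrite ?S_INR; lra.
Qed.

Lemma card_le n chi psi :
  (forall i, (i < n)%nat -> chi i = true -> psi i = true) -> (card n chi <= card n psi)%nat.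
Proof.
intros H. apply INR_le. rewrite !card_fsum. apply fsum_le. intros i Hi.
specialize (H i Hi). destruct (chi i), (psi i); simpl; try lra.
Qed.

Lemma card_lt n chi psi i0 :
  (forall i, (i < n)%nat -> chi i = true -> psi i = true) ->
  (i0 < n)%nat -> chi i0 = false -> psi i0 = true -> (card n chi < card n psi)%nat.
Proof.
intros H Hi0 Hc Hp. apply INR_lt. rewrite !card_fsum.
rewrite (fsum_split n i0 _ Hi0), (fsum_split n i0 (fun i => b2r (psi i)) Hi0).
rewrite Hc, Hp. simpl b2r.
assert (fsum n (fun i => if Nat.eqb i i0 then 0 else b2r (chi i)) <=
        fsum n (fun i => if Nat.eqb i i0 then 0 else b2r (psi i))); [|lra].
apply fsum_le. intros i Hi. destruct (Nat.eqb i i0); [lra|].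
specialize (H i Hi). destruct (chi i), (psi i); simpl; try lra.
Qed.

Lemma list_argmin {A} (l : list A) (f : A -> R) :
  l <> [] -> exists a, In a l /\ forall x, In x l -> f a <= f x.
Proof.
induction l as [|b l IH]; [easy|]. intros _. destruct l as [|c l].
- exists b. split; [now left|]. intros x [<-|[]]; lra.
- destruct IH as (a & Ha & Hm); [easy|].
  destruct (Rle_dec (f a) (f b)).
  + exists a. split; [now right|]. intros x [<-|Hx]; auto.
  + exists b. split; [now left|]. intros x [<-|Hx]; [lra|]. specialize (Hm x Hx). lra.
Qed.

Lemma card_argmin n chi (f : nat -> R) :
  (0 < card n chi)%nat -> exists a, (a < n)%nat /\ chi a = true /\
    forall i, (i < n)%nat -> chi i = true -> f a <= f i.
Proof.
intros H. destruct (list_argmin (filter chi (seq 0 n)) f) as (a & Ha & Hm).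
- intros E. unfold card in H. rewrite E in H. simpl in H. lia.
- apply filter_In in Ha. destruct Ha as [Ha Hc]. exists a.
  split; [now apply in_seq0|]. split; auto. intros i Hi Hci. apply Hm.
  apply filter_In. split; auto. now apply in_seq0.
Qed.

Lemma card_pos n chi i : (i < n)%nat -> chi i = true -> (0 < card n chi)%nat.
Proof.
intros Hi Hc. apply INR_lt. rewrite card_fsum. simpl INR.
apply Rlt_le_trans with (b2r (chi i)); [rewrite Hc; simpl; lra|].
apply (fsum_term_le n (fun i => b2r (chi i))); auto.
intros j _. destruct (chi j); simpl; lra.
Qed.

(** The median is taken to be the smallest value of [f] with at most half of the entries strictly
    above it. *)
Lemma median_exists n (f : nat -> R) : (1 <= n)%nat ->
  exists m, (2 * card n (fun i => gtb (f i) m) <= n)%nat /\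
            (2 * card n (fun i => gtb m (f i)) <= n)%nat.
Proof.
intros Hn.
set (good := fun a => Nat.leb (2 * card n (fun i => gtb (f i) (f a))) n).
destruct (card_argmin n (fun _ => true) (fun i => - f i)) as (M & HM & _ & HMm).
{ apply (card_pos n _ 0); auto. }
assert (HMg : good M = true).
{ apply Nat.leb_le. replace (card n (fun i => gtb (f i) (f M))) with 0%nat; [lia|].
  destruct (card n (fun i => gtb (f i) (f M))) eqn:E; [reflexivity|].
  destruct (card_argmin n (fun i => gtb (f i) (f M)) f) as (a & Ha & Hga & _); [lia|].
  apply gtb_true in Hga. specialize (HMm a Ha eq_refl). lra. }
destruct (card_argmin n good f) as (a & Ha & Hga & Hmin); [eapply card_pos; eauto|].
exists (f a). split; [now apply Nat.leb_le|].
destruct (le_lt_dec (2 * card n (fun i => gtb (f a) (f i))) n) as [|Hlt]; [assumption|].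
exfalso.
(* [f b] is the largest value strictly below [f a]. Entries above [f b] are disjoint from those
   below [f a], which are more than half, so [f b] qualifies too and contradicts the minimality of
   [f a]. *)
destruct (card_argmin n (fun i => gtb (f a) (f i)) (fun i => - f i)) as (b & Hb & Hgb & Hbm);
  [lia|].
apply gtb_true in Hgb.
assert (Hsum : (card n (fun i => gtb (f i) (f b)) + card n (fun i => gtb (f a) (f i)) <= n)%nat).
{ apply INR_le. rewrite plus_INR, !card_fsum, <- fsum_plus.
  replace (INR n) with (fsum n (fun _ => 1)) by (rewrite fsum_const; lra).
  apply fsum_le. intros i Hi.
  destruct (gtb (f i) (f b)) eqn:E1, (gtb (f a) (f i)) eqn:E2; simpl; try lra.
  apply gtb_true in E1. specialize (Hbm i Hi E2). lra. }
assert (Hgb' : good b = true) by (apply Nat.leb_le; lia).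
specialize (Hmin b Hb Hgb'). lra.
Qed.

(** Each cut edge is counted in both directions. For a set of size m the mean over the random graph
    is [2 * p * m * (n - m)], at least [n * p * m], so the value [n * p / 2] later given to [h] asks
    for half of that. *)
Definition cut_bound (n : nat) (A : nat -> nat -> R) (h : R) : Prop :=
  forall chi : nat -> bool, (2 * card n chi <= n)%nat ->
    h * INR (card n chi) <= dsum n (fun i j => A i j * Rabs (b2r (chi i) - b2r (chi j))).

(* Discrete co-area formula: peel off the smallest positive level of [f]. *)
Lemma cut_bound_coarea n A h (f : nat -> R) :
  cut_bound n A h -> (forall i, (i < n)%nat -> 0 <= f i) ->
  (2 * card n (fun i => gtb (f i) 0) <= n)%nat ->
  h * fsum n f <= dsum n (fun i j => A i j * Rabs (f i - f j)).
Proof.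
intros Hcut. remember (card n (fun i => gtb (f i) 0)) as k eqn:Hk.
revert f Hk. induction k as [k IH] using (well_founded_induction lt_wf).
intros f Hk Hf Hsup. destruct (Nat.eq_dec k 0) as [->|Hk0].
- assert (Hf0 : forall i, (i < n)%nat -> f i = 0).
  { intros i Hi. destruct (gtb (f i) 0) eqn:E.
    - assert (Hp := card_pos n (fun i => gtb (f i) 0) i Hi E). lia.
    - apply gtb_false in E. specialize (Hf i Hi). lra. }
  rewrite (fsum_0 n f Hf0).
  unfold dsum. rewrite fsum_0; [lra|]. intros i Hi. apply fsum_0. intros j Hj.
  rewrite !Hf0 by assumption. rewrite Rminus_0_r, Rabs_R0. ring.
- destruct (card_argmin n (fun i => gtb (f i) 0) f) as (a & Ha & Hga & Hmin); [lia|].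
  apply gtb_true in Hga.
  set (chi := fun i => gtb (f i) 0) in *.
  set (g := fun i => f i - f a * b2r (chi i)).
  assert (Hchi : forall i, (i < n)%nat -> (chi i = true /\ f a <= f i) \/ (chi i = false /\ f i = 0)).
  { intros i Hi. destruct (chi i) eqn:E; [left; auto|right]. split; auto.
    apply gtb_false in E. specialize (Hf i Hi). lra. }
  assert (Hg : forall i, (i < n)%nat -> 0 <= g i).
  { intros i Hi. unfold g. destruct (Hchi i Hi) as [[-> H]|[-> H]]; simpl; lra. }
  assert (Hlt : (card n (fun i => gtb (g i) 0) < k)%nat).
  { rewrite Hk. apply (card_lt n _ _ a); auto.
    - intros i Hi Hgi. apply gtb_true in Hgi. unfold g in Hgi.
      destruct (Hchi i Hi) as [[E H]|[E H]]; [assumption|].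
      rewrite E in Hgi. simpl in Hgi. lra.
    - apply gtb_false. unfold g. destruct (Hchi a Ha) as [[-> H]|[-> H]]; simpl; lra.
    - now apply gtb_true. }
  assert (H1 := IH _ Hlt g eq_refl Hg ltac:(lia)).
  assert (H2 := Hcut chi ltac:(lia)).
  apply Rle_trans with (h * fsum n g + f a * (h * INR (card n chi))).
  + rewrite card_fsum. replace (fsum n f) with (fsum n g + f a * fsum n (fun i => b2r (chi i))); [lra|].
    rewrite <- fsum_scal, <- fsum_plus. apply fsum_ext. intros; unfold g; ring.
  + apply Rle_trans with
      (dsum n (fun i j => A i j * Rabs (g i - g j)) +
       f a * dsum n (fun i j => A i j * Rabs (b2r (chi i) - b2r (chi j)))); [nra|].
    rewrite <- dsum_scal, <- dsum_plus. apply Req_le, dsum_ext. intros i j Hi Hj.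
    replace (f a * (A i j * Rabs (b2r (chi i) - b2r (chi j))))
      with (A i j * (f a * Rabs (b2r (chi i) - b2r (chi j)))) by ring.
    rewrite <- Rmult_plus_distr_l. f_equal. unfold g.
    destruct (Hchi i Hi) as [[-> H]|[-> H]], (Hchi j Hj) as [[-> H']|[-> H']]; simpl;
      unfold Rabs; repeat destruct Rcase_abs; lra.
Qed.

(** The co-area bound is applied to [f ^ 2], and [|f i ^ 2 - f j ^ 2|] is split by the
    arithmetic-geometric inequality. The weights 8 and 1/32 make the [(f i + f j) ^ 2] part at most
    [r / 4] times the squared norm, half of what the cuts provide. *)
Lemma cheeger_half n A r (f : nat -> R) :
  (forall i j, 0 <= A i j) -> (forall i j, A i j = A j i) ->
  (forall i, (i < n)%nat -> fsum n (A i) <= 2 * r) ->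
  cut_bound n A (r / 2) -> (forall i, (i < n)%nat -> 0 <= f i) ->
  (2 * card n (fun i => gtb (f i) 0) <= n)%nat ->
  r / 32 * fsum n (fun i => f i ^ 2) <= dsum n (fun i j => A i j * (f i - f j) ^ 2).
Proof.
intros HA Hsym Hdeg Hcut Hf Hsup.
assert (H1 : r / 2 * fsum n (fun i => f i ^ 2) <=
             dsum n (fun i j => A i j * Rabs (f i ^ 2 - f j ^ 2))).
{ apply (cut_bound_coarea n A (r / 2) (fun i => f i ^ 2)); auto.
  - intros; apply pow2_ge_0.
  - eapply Nat.le_trans; [|exact Hsup]. apply Nat.mul_le_mono_l, card_le.
    intros i Hi H. apply gtb_true in H. apply gtb_true. specialize (Hf i Hi).
    destruct (Req_dec (f i) 0) as [E|]; [rewrite E in H; simpl in H; lra|lra]. }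
assert (H2 : dsum n (fun i j => A i j * Rabs (f i ^ 2 - f j ^ 2)) <=
             8 * dsum n (fun i j => A i j * (f i - f j) ^ 2)
             + 1 / 32 * dsum n (fun i j => A i j * (f i + f j) ^ 2)).
{ rewrite <- !dsum_scal, <- dsum_plus. apply dsum_le. intros i j Hi Hj.
  replace (8 * (A i j * (f i - f j) ^ 2) + 1 / 32 * (A i j * (f i + f j) ^ 2))
    with (A i j * (8 * (f i - f j) ^ 2 + 1 / 32 * (f i + f j) ^ 2)) by ring.
  apply Rmult_le_compat_l; auto.
  assert (0 <= (16 * (f i - f j) - (f i + f j)) ^ 2) by apply pow2_ge_0.
  assert (0 <= (16 * (f i - f j) + (f i + f j)) ^ 2) by apply pow2_ge_0.
  unfold Rabs; destruct Rcase_abs; nra. }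
assert (H3 : dsum n (fun i j => A i j * (f i + f j) ^ 2) <= 8 * r * fsum n (fun i => f i ^ 2)).
{ apply Rle_trans with (dsum n (fun i j => 2 * (A i j * f i ^ 2) + 2 * (A i j * f j ^ 2))).
  - apply dsum_le. intros i j _ _. specialize (HA i j).
    assert (0 <= (f i - f j) ^ 2) by apply pow2_ge_0. nra.
  - rewrite dsum_plus, !dsum_scal.
    rewrite (dsum_swap n (fun i j => A i j * f j ^ 2)).
    rewrite (dsum_ext n (fun i j => A j i * f i ^ 2) (fun i j => A i j * f i ^ 2))
      by (intros; now rewrite Hsym).
    assert (dsum n (fun i j => A i j * f i ^ 2) <= 2 * r * fsum n (fun i => f i ^ 2)); [|lra].
    unfold dsum. rewrite <- fsum_scal. apply fsum_le. intros i Hi.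
    rewrite fsum_scal_r. apply Rmult_le_compat_r; [apply pow2_ge_0|auto]. }
lra.
Qed.

(** For symmetric [A] the right-hand side is twice the quadratic form of the graph Laplacian, so [g]
    is a lower bound for twice its second eigenvalue. *)
Definition gap (n : nat) (A : nat -> nat -> R) (g : R) : Prop :=
  forall f, fsum n f = 0 ->
    g * fsum n (fun i => f i ^ 2) <= dsum n (fun i j => A i j * (f i - f j) ^ 2).

(** After subtracting a median, the positive and negative parts are each supported on at most half
    of the vertices. Their energies add up to at most the energy of [f], and shifting a mean-zero
    [f] cannot decrease its norm. *)
Lemma cheeger n A r : (1 <= n)%nat -> 0 <= r ->
  (forall i j, 0 <= A i j) -> (forall i j, A i j = A j i) ->
  (forall i, (i < n)%nat -> fsum n (A i) <= 2 * r) ->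
  cut_bound n A (r / 2) -> gap n A (r / 32).
Proof.
intros Hn Hr HA Hsym Hdeg Hcut f Hf0.
destruct (median_exists n f Hn) as (m & Hm1 & Hm2).
set (gp := fun i => Rmax (f i - m) 0). set (gm := fun i => Rmax (m - f i) 0).
assert (Hp : r / 32 * fsum n (fun i => gp i ^ 2) <= dsum n (fun i j => A i j * (gp i - gp j) ^ 2)).
{ apply cheeger_half; auto; [intros; apply Rmax_r|].
  eapply Nat.le_trans; [|exact Hm1]. apply Nat.mul_le_mono_l, card_le.
  intros i _ H. apply gtb_true in H. apply gtb_true. unfold gp, Rmax in H.
  destruct Rle_dec; lra. }
assert (Hq : r / 32 * fsum n (fun i => gm i ^ 2) <= dsum n (fun i j => A i j * (gm i - gm j) ^ 2)).
{ apply cheeger_half; auto; [intros; apply Rmax_r|].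
  eapply Nat.le_trans; [|exact Hm2]. apply Nat.mul_le_mono_l, card_le.
  intros i _ H. apply gtb_true in H. apply gtb_true. unfold gm, Rmax in H.
  destruct Rle_dec; lra. }
assert (H1 : dsum n (fun i j => A i j * (gp i - gp j) ^ 2) + dsum n (fun i j => A i j * (gm i - gm j) ^ 2)
             <= dsum n (fun i j => A i j * (f i - f j) ^ 2)).
{ rewrite <- dsum_plus. apply dsum_le. intros i j _ _.
  rewrite <- Rmult_plus_distr_l. apply Rmult_le_compat_l; auto.
  unfold gp, gm, Rmax; repeat destruct Rle_dec; nra. }
assert (H2 : fsum n (fun i => f i ^ 2) <= fsum n (fun i => gp i ^ 2) + fsum n (fun i => gm i ^ 2)).
{ rewrite <- fsum_plus.
  apply Rle_trans with (fsum n (fun i => (f i ^ 2 - (2 * m) * f i) + m ^ 2)).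
  - rewrite fsum_plus, fsum_minus, fsum_scal, fsum_const, Hf0.
    assert (0 <= INR n * m ^ 2) by (apply Rmult_le_pos; [apply pos_INR|apply pow2_ge_0]). lra.
  - apply fsum_le. intros i _. unfold gp, gm, Rmax; repeat destruct Rle_dec; nra. }
nra.
Qed.

(** * The balance operator and its leave-one-out analysis *)

Definition Mop (n : nat) (w : nat -> R) (k : nat -> nat -> R) (f : nat -> R) (j : nat) : R :=
  fsum n (fun i => w j * f j * k j i - w i * f i * k i j).

Lemma Mop_minus n w k f g j :
  Mop n w k (fun i => f i - g i) j = Mop n w k f j - Mop n w k g j.
Proof. unfold Mop. rewrite <- fsum_minus. apply fsum_ext; intros; ring. Qed.

Lemma Mop_quadratic n w k f :
  fsum n (fun j => f j * Mop n w k f j) =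
  / 2 * dsum n (fun i j => w i * k i j * (f i - f j) ^ 2)
  + / 2 * fsum n (fun j => f j ^ 2 * Mop n w k (fun _ => 1) j).
Proof.
rewrite (fsum_ext n (fun j => f j * Mop n w k f j)
  (fun j => fsum n (fun i => w j * f j ^ 2 * k j i - w i * f i * f j * k i j)))
  by (intros; unfold Mop; rewrite <- fsum_scal; apply fsum_ext; intros; ring).
rewrite (fsum_ext n (fun j => f j ^ 2 * Mop n w k (fun _ => 1) j)
  (fun j => fsum n (fun i => w j * f j ^ 2 * k j i - w i * f j ^ 2 * k i j)))
  by (intros; unfold Mop; rewrite <- fsum_scal; apply fsum_ext; intros; ring).
fold (dsum n (fun j i => w j * f j ^ 2 * k j i - w i * f i * f j * k i j)).
fold (dsum n (fun j i => w j * f j ^ 2 * k j i - w i * f j ^ 2 * k i j)).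
rewrite !dsum_minus.
rewrite (dsum_swap n (fun j i => w i * f i * f j * k i j)).
rewrite (dsum_swap n (fun j i => w i * f j ^ 2 * k i j)).
rewrite <- !dsum_minus, <- !dsum_scal, <- dsum_plus.
apply dsum_ext; intros; field.
Qed.

Lemma linf_ub n f i : (i < n)%nat -> Rabs (f i) <= linf n f.
Proof.
intros Hi. apply in_seq0 in Hi. unfold linf. induction (seq 0 n) as [|a l IH]; [easy|].
simpl. destruct Hi as [->|Hi]; [apply Rmax_l|].
eapply Rle_trans; [now apply IH|apply Rmax_r].
Qed.

Lemma linf_nonneg n f : 0 <= linf n f.
Proof.
unfold linf. induction (seq 0 n); simpl; [lra|].
eapply Rle_trans; [exact IHl|apply Rmax_r].
Qed.

Lemma linf_le n f c : 0 <= c -> (forall i, (i < n)%nat -> Rabs (f i) <= c) -> linf n f <= c.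
Proof.
intros Hc H.
assert (H' : forall i, In i (seq 0 n) -> Rabs (f i) <= c)
  by (intros i Hi; apply H; now apply in_seq0).
clear H. unfold linf. induction (seq 0 n) as [|a l IH]; simpl; [lra|].
apply Rmax_lub; [apply H'; now left|]. apply IH. intros; apply H'; now right.
Qed.

(** All indices are kept and [v] becomes an isolated vertex, so sums still run over [n]; in exchange
    the coordinate at [v] becomes free. *)
Definition erase (v : nat) (k : nat -> nat -> R) (i j : nat) : R :=
  if (Nat.eqb i v || Nat.eqb j v)%bool then 0 else k i j.

(** [1 + d] is balanced on the graph without [v]. The condition [d v = 0] fixes the free coordinate,
    and the zero sum makes the difference between [d] and the full error [x - 1] sum to zero, so
    that stability applies to it. *)
Definition loo_sol (n : nat) (w : nat -> R) (v : nat) (k : nat -> nat -> R) (d : nat -> R) : Prop :=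
  d v = 0 /\ fsum n d = 0 /\
  forall j, (j < n)%nat -> Mop n w (erase v k) (fun i => 1 + d i) j = 0.

(* The leave-one-out solution is extracted by choice from the erased rates, so that
   it is by construction a function of the comparisons not involving [v]. *)
Definition loo (n : nat) (w : nat -> R) (v : nat) (k : nat -> nat -> R) : nat -> R :=
  epsilon (inhabits (fun _ => 0)) (loo_sol n w v k).

Lemma loo_spec n w v k d : loo_sol n w v k d -> loo_sol n w v k (loo n w v k).
Proof.
intros H. apply (epsilon_spec (inhabits (fun _ : nat => 0)) (loo_sol n w v k)). now exists d.
Qed.

(** This is the form in which independence is used: the choice is made from a predicate that sees
    [k] only through [erase v k]. *)
Lemma loo_erase n w v k k' : erase v k = erase v k' -> loo n w v k = loo n w v k'.
Proof. intros H. unfold loo, loo_sol. now rewrite H. Qed.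

(** [p * kbar w i j] is the mean of the rate from [i] to [j]. *)
Definition kbar (w : nat -> R) (i j : nat) : R :=
  if Nat.eqb i j then 0 else w j / (w i + w j).

(** All the randomness used by the deterministic part, with [ell] standing for log n and [sigma] for
    [/ sqrt L]. [typ_noise] is scaled by the actual variance, which keeps the factor [w v]. The
    bound in [typ_edge] vanishes off the graph, so that its sum over a row costs a degree and not
    [n]. In [typ_loo] the coefficients do not depend on the comparisons of [v], so their maximum
    sets the scale. *)
Record typical (n : nat) (p ell sigma : R) (w : nat -> R) (k : nat -> nat -> R) : Prop := {
  typ_cut : cut_bound n (fun i j => k i j + k j i) (INR n * p / 2);
  typ_deg : forall v, (v < n)%nat ->
    fsum n (fun j => k v j + k j v) <= INR n * p + 8 * sqrt (INR n * p * ell);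
  typ_out : forall v, (v < n)%nat ->
    p * fsum n (kbar w v) - 8 * sqrt (INR n * p * ell) <= fsum n (k v);
  typ_noise : forall v, (v < n)%nat ->
    (Mop n w k (fun _ => 1) v) ^ 2 <= 81 * (ell * sigma ^ 2 * (p * fsum n w) * w v);
  typ_edge : forall i j, (i < n)%nat -> (j < n)%nat ->
    (w j * k j i - w i * k i j) ^ 2 <= 324 * (ell * sigma ^ 2) * (k i j + k j i);
  typ_loo : forall v, (v < n)%nat ->
    Rabs (fsum n (fun j => (k j v - p * kbar w j v) * (w j * loo n w v k j)))
      <= 8 * sqrt (INR n * p * ell) * linf n (fun j => w j * loo n w v k j)
}.

Lemma sq_le_abs a b : 0 <= b -> a ^ 2 <= b ^ 2 -> Rabs a <= b.
Proof. intros Hb H. apply Rabs_le. split; nra. Qed.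

(** Closes the circular estimates. [M] is the largest weighted error, [Z] the l2 distance to the
    leave-one-out solution, [Q] the residual at [v], [B] the size of the leave-one-out solution.
    [M + Z] is bounded first, with a term [kap * eta]; feeding it back multiplies it by [kap * rho],
    and this is where [kap ^ 2 * rho] has to be small. *)
Lemma loo_arith (r P rho sigma kap eta m M Z Q B : R) :
  0 < r -> 0 < P -> P <= r -> r <= kap * P -> 1 <= kap -> 0 < rho -> 0 < sigma ->
  kap * rho <= / 100000 -> kap ^ 2 * rho <= / 100000 -> eta = kap * rho * sigma ->
  0 <= M -> 0 <= Z ->
  Z <= 256 * kap / r * (Q + 36 * r * rho * sigma + 2 * r * rho * B) ->
  Q <= 2313 * eta * P + r * rho * Z + 8 * r * rho * B ->
  B <= M + Z -> m * (P / 4) <= Q + 2 * r * rho * Z ->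
  m <= 15000 * eta + M / 2.
Proof.
intros Hr HP HPr HrP Hk Hrho Hsig Hkr Hkkr Heta HM HZ H1 H2 H3 H4.
set (T := M + Z) in *.
assert (HT : 0 <= T) by (unfold T; lra).
assert (HZT : Z <= T) by (unfold T; lra).
assert (Hrr : 0 < r * rho) by (apply Rmult_lt_0_compat; lra).
assert (Heta0 : 0 < eta) by (rewrite Heta; repeat apply Rmult_lt_0_compat; lra).
assert (HQ : Q <= 2313 * eta * P + 9 * (r * rho) * T) by nra.
assert (HZ2 : Z <= 256 * kap / r * (2313 * eta * P + 11 * (r * rho) * T + 36 * r * rho * sigma)).
{ eapply Rle_trans; [exact H1|]. apply Rmult_le_compat_l.
  - apply Rlt_le, Rdiv_lt_0_compat; lra.
  - nra. }
replace (256 * kap / r * (2313 * eta * P + 11 * (r * rho) * T + 36 * r * rho * sigma))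
  with (592128 * (kap * eta) * (P / r) + 2816 * (kap * rho) * T + 9216 * eta) in HZ2
  by (rewrite Heta; field; lra).
assert (HPr' : P / r <= 1) by (apply Rmult_le_reg_r with r; [lra|]; field_simplify; lra).
assert (HPr0 : 0 < P / r) by (apply Rdiv_lt_0_compat; lra).
assert (Hke : eta <= kap * eta) by nra.
assert (HZ3 : Z <= 601344 * (kap * eta) + 2816 / 100000 * T).
{ assert (kap * eta * (P / r) <= kap * eta) by nra. assert (kap * rho * T <= / 100000 * T) by nra. lra. }
assert (HT2 : T <= 2 * M + 630000 * (kap * eta)) by (unfold T in *; lra).
assert (Hm : m * P <= (9252 * eta + 44 * (kap * rho) * T) * P).
{ assert (r * rho * T <= kap * P * rho * T) by (apply Rmult_le_compat_r; [lra|]; nra). nra. }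
apply Rmult_le_reg_r in Hm; [|lra].
assert (H5 : kap * rho * T <= kap * rho * (2 * M + 630000 * (kap * eta)))
  by (apply Rmult_le_compat_l; [nra|lra]).
assert (H6 : kap * rho * M <= / 100000 * M) by (apply Rmult_le_compat_r; lra).
assert (H7 : kap ^ 2 * rho * eta <= / 100000 * eta) by (apply Rmult_le_compat_r; lra).
replace (kap * rho * (2 * M + 630000 * (kap * eta)))
  with (2 * (kap * rho * M) + 630000 * (kap ^ 2 * rho * eta)) in H5 by ring.
lra.
Qed.

(** * Deterministic analysis on the typical event *)

Section Deterministic.

(** Weights are normalised to be at most 1. [r] is the mean degree and [rho] the relative
    fluctuation of a degree, so [r * rho ^ 2] stands for [ell] and [r * rho] for
    [sqrt (n * p * ell)]. [P] is the expected weight of a neighbourhood, up to the vertex itself,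
    and [eta] the target error. *)
Variables (n : nat) (p r rho sigma kap W P eta : R) (w : nat -> R) (k : nat -> nat -> R).

Hypothesis W_def : fsum n w = W.
Hypothesis P_def : p * W = P.
Hypothesis eta_def : eta = kap * rho * sigma.
Hypothesis n_ge2 : (2 <= n)%nat.
Hypothesis r_def : INR n * p = r.
Hypothesis p_pos : 0 < p.
Hypothesis p_le1 : p <= 1.
Hypothesis kap_ge1 : 1 <= kap.
Hypothesis rho_pos : 0 < rho.
Hypothesis rho_small : kap ^ 2 * rho <= / 100000.
Hypothesis ell_ge1 : 1 <= r * rho ^ 2.
Hypothesis sigma_pos : 0 < sigma.
Hypothesis sigma_le1 : sigma <= 1.
Hypothesis w_lb : forall i, (i < n)%nat -> 1 <= kap * w i.
Hypothesis w_ub : forall i, (i < n)%nat -> w i <= 1.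
Hypothesis k_nonneg : forall i j, 0 <= k i j.
Hypothesis k_le1 : forall i j, k i j <= 1.
Hypothesis k_typ : typical n p (r * rho ^ 2) sigma w k.

Local Lemma w_pos i : (i < n)%nat -> 0 < w i.
Proof. intros Hi. specialize (w_lb i Hi). nra. Qed.

Local Lemma n_pos : 0 < INR n.
Proof. apply lt_0_INR. lia. Qed.

Local Lemma r_pos : 0 < r.
Proof. rewrite <- r_def. apply Rmult_lt_0_compat; [apply n_pos|assumption]. Qed.

Local Lemma kap_rho : kap * rho <= / 100000.
Proof. assert (kap * rho <= kap ^ 2 * rho); [|lra]. apply Rmult_le_compat_r; nra. Qed.

Local Lemma rho_le : rho <= / 100000.
Proof. assert (H := kap_rho). nra. Qed.

Local Lemma W_le_n : W <= INR n.
Proof.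
replace (INR n) with (fsum n (fun _ => 1)) by (rewrite fsum_const; lra). rewrite <- W_def. now apply fsum_le.
Qed.

Local Lemma n_le_W : INR n <= kap * W.
Proof.
replace (INR n) with (fsum n (fun _ => 1)) by (rewrite fsum_const; lra).
rewrite <- W_def, <- fsum_scal. now apply fsum_le.
Qed.

Local Lemma W_pos : 0 < W.
Proof. assert (H := n_le_W). assert (H' := n_pos). nra. Qed.

Local Lemma r_le_P : r <= kap * P.
Proof. rewrite <- P_def, <- r_def. assert (H := n_le_W). nra. Qed.

Local Lemma P_le_r : P <= r.
Proof. rewrite <- P_def, <- r_def. assert (H := W_le_n). nra. Qed.

Local Lemma P_pos : 0 < P.
Proof. rewrite <- P_def. apply Rmult_lt_0_compat; [assumption|apply W_pos]. Qed.

(** [r] is at least [/ rho ^ 2], since [ell] is at least 1, and [rho] is at most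
    [/ (100000 * kap ^ 2)]. *)
Local Lemma r_large : 10000000000 * kap ^ 4 <= r.
Proof.
assert (Hr := r_pos).
assert (kap ^ 4 * rho ^ 2 <= / 10000000000).
{ replace (kap ^ 4 * rho ^ 2) with ((kap ^ 2 * rho) ^ 2) by ring.
  replace (/ 10000000000) with ((/ 100000) ^ 2) by field.
  apply pow_incr. split; [|assumption]. apply Rmult_le_pos; [apply pow2_ge_0|lra]. }
assert (0 <= kap ^ 4) by (apply pow_le; lra).
assert (kap ^ 4 * 1 <= kap ^ 4 * (r * rho ^ 2)) by (apply Rmult_le_compat_l; assumption).
assert (r * (kap ^ 4 * rho ^ 2) <= r * / 10000000000) by (apply Rmult_le_compat_l; lra).
lra.
Qed.

Local Lemma dev_eq : sqrt (INR n * p * (r * rho ^ 2)) = r * rho.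
Proof.
rewrite r_def. replace (r * (r * rho ^ 2)) with ((r * rho) ^ 2) by ring.
apply sqrt_pow2. apply Rmult_le_pos; [apply Rlt_le, r_pos|lra].
Qed.

Local Lemma deg_le v : (v < n)%nat -> fsum n (fun j => k v j + k j v) <= 2 * r.
Proof.
intros Hv. assert (H := typ_deg _ _ _ _ _ _ k_typ v Hv). rewrite dev_eq, r_def in H.
assert (H1 := rho_le). assert (H2 := r_pos). nra.
Qed.

Local Lemma gap_k : gap n (fun i j => k i j + k j i) (r / 32).
Proof.
apply cheeger.
- lia.
- apply Rlt_le, r_pos.
- intros i j. assert (H := k_nonneg i j). assert (H' := k_nonneg j i). lra.
- intros; ring.
- apply deg_le.
- rewrite <- r_def. apply (typ_cut _ _ _ _ _ _ k_typ).
Qed.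

Local Lemma noise_le v : (v < n)%nat ->
  (Mop n w k (fun _ => 1) v) ^ 2 <= (9 * eta * P) ^ 2.
Proof.
intros Hv. eapply Rle_trans; [apply (typ_noise _ _ _ _ _ _ k_typ v Hv)|].
rewrite W_def, P_def, eta_def.
replace ((9 * (kap * rho * sigma) * P) ^ 2)
  with (81 * (rho ^ 2 * sigma ^ 2 * P * (kap ^ 2 * P))) by ring.
replace (81 * (r * rho ^ 2 * sigma ^ 2 * P * w v))
  with (81 * (rho ^ 2 * sigma ^ 2 * P * (r * w v))) by ring.
assert (H := r_le_P). assert (HP := P_pos). assert (Hr := r_pos).
assert (Hw := w_ub v Hv). assert (Hw' := w_pos v Hv).
apply Rmult_le_compat_l; [lra|]. apply Rmult_le_compat_l.
- repeat apply Rmult_le_pos; try apply pow2_ge_0; lra.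
- apply Rle_trans with r; [nra|]. apply Rle_trans with (1 * (kap * P)); [lra|].
  replace (kap ^ 2 * P) with (kap * (kap * P)) by ring. apply Rmult_le_compat_r; nra.
Qed.

(** The threshold is chosen so that the noise consumes at most half of the main term
    [r / (128 * kap)] of the quadratic form in [stability]. *)
Local Lemma noise_small v : (v < n)%nat ->
  Rabs (Mop n w k (fun _ => 1) v) <= r / (128 * kap).
Proof.
intros Hv. assert (Hr := r_pos). assert (HP := P_le_r). assert (HPp := P_pos).
apply sq_le_abs; [apply Rlt_le, Rdiv_lt_0_compat; lra|].
eapply Rle_trans; [apply (typ_noise _ _ _ _ _ _ k_typ v Hv)|].
rewrite W_def, P_def.
apply Rle_trans with (81 * (r * rho ^ 2 * 1 * r * 1)).
- apply Rmult_le_compat_l; [lra|].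
  apply Rmult_le_compat; [| apply Rlt_le, w_pos; auto | | apply w_ub; auto].
  + repeat apply Rmult_le_pos; try apply pow2_ge_0; lra.
  + apply Rmult_le_compat; [| lra | | lra].
    * repeat apply Rmult_le_pos; try apply pow2_ge_0; lra.
    * apply Rmult_le_compat_l; [lra|]. nra.
- replace (81 * (r * rho ^ 2 * 1 * r * 1)) with ((9 * r * rho) ^ 2) by ring.
  apply pow_incr. split; [repeat apply Rmult_le_pos; lra|].
  apply Rmult_le_reg_r with (128 * kap); [lra|].
  replace (r / (128 * kap) * (128 * kap)) with r by (field; lra).
  assert (H := kap_rho). replace (9 * r * rho * (128 * kap)) with (r * (1152 * (kap * rho))) by ring.
  nra.
Qed.

Local Lemma stability f : fsum n f = 0 ->
  fsum n (fun i => f i ^ 2) <= (256 * kap / r) ^ 2 * fsum n (fun i => Mop n w k f i ^ 2).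
Proof.
intros Hf. assert (Hr := r_pos).
set (F := fsum n (fun i => f i ^ 2)). set (G := fsum n (fun i => Mop n w k f i ^ 2)).
assert (HF : 0 <= F) by (apply fsum_nonneg; intros; apply pow2_ge_0).
assert (HG : 0 <= G) by (apply fsum_nonneg; intros; apply pow2_ge_0).
assert (Hcs := fsum_cauchy n f (Mop n w k f)). fold F G in Hcs.
assert (Hid := Mop_quadratic n w k f).
(* The weights break the symmetry, so they are first bounded below by [/ kap]; the remaining sum
   over [k] is half of the sum over the adjacency matrix, to which the gap applies. *)
assert (H1 : / kap * (/ 2 * (r / 32 * F)) <= dsum n (fun i j => w i * k i j * (f i - f j) ^ 2)).
{ apply Rle_trans with (/ kap * dsum n (fun i j => k i j * (f i - f j) ^ 2)).
  - apply Rmult_le_compat_l; [apply Rlt_le, Rinv_0_lt_compat; lra|].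
    assert (Hg := gap_k f Hf). fold F in Hg.
    rewrite (dsum_ext n _ (fun i j => k i j * (f i - f j) ^ 2 + k j i * (f j - f i) ^ 2)) in Hg
      by (intros; ring).
    rewrite dsum_plus in Hg.
    rewrite <- (dsum_swap n (fun i j => k i j * (f i - f j) ^ 2)) in Hg. lra.
  - rewrite <- dsum_scal. apply dsum_le. intros i j Hi Hj.
    rewrite <- Rmult_assoc. apply Rmult_le_compat_r; [apply pow2_ge_0|].
    apply Rmult_le_compat_r; [apply k_nonneg|].
    apply Rmult_le_reg_l with kap; [lra|]. rewrite Rinv_r by lra. auto. }
assert (H2 : - (r / (128 * kap)) * F <= fsum n (fun j => f j ^ 2 * Mop n w k (fun _ => 1) j)).
{ unfold F. rewrite <- fsum_scal. apply fsum_le. intros j Hj.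
  assert (H := noise_small j Hj). assert (H' := pow2_ge_0 (f j)).
  unfold Rabs in H. destruct Rcase_abs in H; nra. }
set (Q := fsum n (fun j => f j * Mop n w k f j)) in *.
assert (H3 : r / (256 * kap) * F <= Q).
{ rewrite Hid. replace (r / (256 * kap) * F) with
    (/ 2 * (/ kap * (/ 2 * (r / 32 * F))) + / 2 * (- (r / (128 * kap)) * F)) by (field; lra).
  lra. }
set (c := r / (256 * kap)) in *.
assert (Hc : 0 < c) by (apply Rdiv_lt_0_compat; lra).
replace ((256 * kap / r) ^ 2) with (/ (c ^ 2)) by (unfold c; field; lra).
(* Coercivity and Cauchy-Schwarz give [(c * F) ^ 2 <= F * G], from which one factor [F] has to be
   cancelled. *)
destruct (Req_dec F 0) as [->|HF0].
- apply Rmult_le_pos; [|assumption]. apply Rlt_le, Rinv_0_lt_compat, pow_lt, Hc.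
- apply Rmult_le_reg_l with (c ^ 2); [now apply pow_lt|].
  rewrite <- Rmult_assoc, Rinv_r, Rmult_1_l by (apply pow_nonzero; lra).
  apply Rmult_le_reg_l with F; [lra|].
  apply Rle_trans with (Q ^ 2); [|exact Hcs].
  replace (F * (c ^ 2 * F)) with ((c * F) ^ 2) by ring. apply pow_incr. split; [nra|exact H3].
Qed.

(** [stability] forces a kernel vector of sum zero to vanish, so kernel vectors can be normalised by
    their sum. *)
Lemma kernel_sum_nonzero x :
  (forall j, (j < n)%nat -> Mop n w k x j = 0) ->
  (exists i, (i < n)%nat /\ x i <> 0) -> fsum n x <> 0.
Proof.
intros HM (i & Hi & Hxi) Hs.
assert (H := stability x Hs).
rewrite (fsum_0 n (fun i => Mop n w k x i ^ 2)) in H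
  by (intros j Hj; rewrite HM by assumption; ring).
assert (H1 := fsum_term_le n (fun i => x i ^ 2) i (fun i _ => pow2_ge_0 (x i)) Hi).
simpl in H1, H. nra.
Qed.

(** The balance equations sum to zero identically, because every flow leaves one vertex and enters
    another; the constant vector is thus a left null vector. *)
Lemma kernel_exists :
  exists x, fsum n x = INR n /\ forall j, (j < n)%nat -> Mop n w k x j = 0.
Proof.
destruct (singular_kernel n
  (fun j i => (if Nat.eqb i j then w j * fsum n (k j) else 0) - w i * k i j)
  (fun _ => 1) 0%nat) as (x & Hne & Hx).
- lia.
- lra.
- intros i Hi. rewrite (fsum_ext n _ (fun j => (if Nat.eqb j i then w i * fsum n (k i) else 0)
     - w i * k i j)).
  + rewrite fsum_minus, fsum_scal, fsum_delta by assumption. lra.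
  + intros j Hj. rewrite (Nat.eqb_sym i j).
    destruct (Nat.eqb_spec j i); subst; ring.
- assert (HM : forall j, (j < n)%nat -> Mop n w k x j = 0).
  { intros j Hj. rewrite <- (Hx j Hj). unfold Mop. symmetry.
    rewrite (fsum_ext n _ (fun i => (if Nat.eqb i j then w j * fsum n (k j) * x j else 0)
      - w i * x i * k i j)).
    - rewrite !fsum_minus, fsum_delta by assumption. rewrite fsum_scal. ring.
    - intros i Hi. destruct (Nat.eqb_spec i j); subst; ring. }
  assert (Hs := kernel_sum_nonzero x HM Hne).
  exists (fun i => INR n / fsum n x * x i). split.
  + rewrite fsum_scal. field. assumption.
  + intros j Hj. rewrite <- (Rmult_0_r (INR n / fsum n x)), <- (HM j Hj).
    unfold Mop. rewrite <- fsum_scal. apply fsum_ext. intros; ring.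
Qed.

Local Lemma Mop_erase v f j : (v < n)%nat -> (j < n)%nat -> j <> v ->
  Mop n w k f j = Mop n w (erase v k) f j + (w j * f j * k j v - w v * f v * k v j).
Proof.
intros Hv Hj Hjv. unfold Mop.
rewrite (fsum_split n v (fun i => w j * f j * k j i - w i * f i * k i j) Hv).
rewrite (fsum_split n v (fun i => w j * f j * erase v k j i - w i * f i * erase v k i j) Hv).
unfold erase at 1 2. rewrite Nat.eqb_refl, Bool.orb_true_r. simpl.
rewrite (fsum_ext n (fun i => if Nat.eqb i v then 0 else w j * f j * erase v k j i - w i * f i * erase v k i j)
  (fun i => if Nat.eqb i v then 0 else w j * f j * k j i - w i * f i * k i j)).
- ring.
- intros i Hi. unfold erase. destruct (Nat.eqb_spec i v); [reflexivity|].
  destruct (Nat.eqb_spec j v); [easy|]. reflexivity.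
Qed.

(** As rates lie between 0 and 1, a squared rate is at most the adjacency entry, and the row costs
    only a degree. *)
Local Lemma row_le v f B : (v < n)%nat -> (forall j, (j < n)%nat -> (f j) ^ 2 <= B) -> 0 <= B ->
  fsum n (fun j => (f j * k j v) ^ 2) <= 2 * r * B.
Proof.
intros Hv Hf HB. apply Rle_trans with (B * fsum n (fun j => k v j + k j v)).
- rewrite <- fsum_scal. apply fsum_le. intros j Hj.
  assert (H1 := k_nonneg j v). assert (H2 := k_le1 j v). assert (H3 := k_nonneg v j).
  assert (H4 := Hf j Hj). assert (H5 := pow2_ge_0 (f j)).
  replace ((f j * k j v) ^ 2) with (f j ^ 2 * k j v ^ 2) by ring.
  apply Rmult_le_compat; try nra.
- assert (H := deg_le v Hv). nra.
Qed.

(** The erased system is singular for the same reason as the full one. That a nonzero kernel vector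
    vanishing at [v] has nonzero sum is inherited from [stability] of the full operator, without
    studying the cuts of the smaller graph. *)
Local Lemma loo_exists v : (v < n)%nat -> exists d, loo_sol n w v k d.
Proof.
intros Hv. assert (Hr := r_pos).
(* Deleting [v] perturbs the rates by an operator of norm O(sqrt r), which is negligible
   against the gap of order r / kap. *)
assert (Hinj : forall f, f v = 0 -> fsum n f = 0 ->
  (forall j, (j < n)%nat -> Mop n w (erase v k) f j = 0) ->
  fsum n (fun i => f i ^ 2) <= 0).
{ intros f Hfv Hf HM.
  set (F := fsum n (fun i => f i ^ 2)).
  assert (HF : 0 <= F) by (apply fsum_nonneg; intros; apply pow2_ge_0).
  assert (Hj : forall j, (j < n)%nat -> j <> v -> Mop n w k f j = w j * f j * k j v).
  { intros j Hj Hjv. rewrite (Mop_erase v f j Hv Hj Hjv), HM, Hfv by assumption. ring. }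
  assert (Hsq : fsum n (fun j => (w j * f j * k j v) ^ 2) <= F).
  { apply fsum_le. intros j Hj'. assert (H1 := k_nonneg j v). assert (H2 := k_le1 j v).
    assert (H3 := w_ub j Hj'). assert (H4 := w_pos j Hj'). assert (H5 := pow2_ge_0 (f j)).
    replace ((w j * f j * k j v) ^ 2) with ((w j * k j v) ^ 2 * f j ^ 2) by ring.
    assert (0 <= w j * k j v <= 1) by nra. assert ((w j * k j v) ^ 2 <= 1) by nra. nra. }
  assert (Hrow : Mop n w k f v = - fsum n (fun j => k j v * (w j * f j))).
  { unfold Mop. rewrite fsum_minus, Hfv. rewrite (fsum_0 n (fun i => w v * 0 * k v i)) by (intros; ring).
    rewrite Rminus_0_l. f_equal. apply fsum_ext; intros; ring. }
  assert (Hrow2 : (Mop n w k f v) ^ 2 <= 2 * r * F).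
  { rewrite Hrow. rewrite <- Rsqr_pow2, <- Rsqr_neg, Rsqr_pow2.
    eapply Rle_trans; [apply fsum_cauchy|]. apply Rmult_le_compat.
    - apply fsum_nonneg; intros; apply pow2_ge_0.
    - apply fsum_nonneg; intros; apply pow2_ge_0.
    - assert (H := row_le v (fun _ => 1) 1 Hv). rewrite Rmult_1_r in H.
      rewrite (fsum_ext n _ (fun j => (1 * k j v) ^ 2)) by (intros; now rewrite Rmult_1_l).
      apply H; intros; lra.
    - apply fsum_le. intros j Hj'. assert (H3 := w_ub j Hj'). assert (H4 := w_pos j Hj').
      assert (H5 := pow2_ge_0 (f j)). rewrite Rpow_mult_distr. assert (w j ^ 2 <= 1) by nra. nra. }
  assert (H := stability f Hf). fold F in H.
  assert (HT : fsum n (fun i => Mop n w k f i ^ 2) <= (2 * r + 1) * F).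
  { rewrite (fsum_split n v _ Hv).
    assert (fsum n (fun i => if Nat.eqb i v then 0 else Mop n w k f i ^ 2) <= F); [|lra].
    eapply Rle_trans; [|exact Hsq]. apply fsum_le. intros j Hj'.
    destruct (Nat.eqb_spec j v); [apply pow2_ge_0|]. rewrite Hj by assumption. lra. }
  assert (Hrl := r_large). assert (Hk2 : 1 <= kap ^ 2) by nra.
  assert (Hc : (256 * kap / r) ^ 2 * (2 * r + 1) <= / 2).
  { apply Rmult_le_reg_l with (r ^ 2); [now apply pow_lt|].
    replace (r ^ 2 * ((256 * kap / r) ^ 2 * (2 * r + 1)))
      with (65536 * (kap ^ 2 * (2 * r + 1))) by (field; lra).
    assert (10000000000 * kap ^ 2 <= r) by nra. nra. }
  assert ((256 * kap / r) ^ 2 * fsum n (fun i => Mop n w k f i ^ 2) <= / 2 * F).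
  { eapply Rle_trans; [apply Rmult_le_compat_l; [apply pow2_ge_0|exact HT]|].
    rewrite <- Rmult_assoc. now apply Rmult_le_compat_r. }
  lra. }
set (k' := erase v k).
assert (Hk'v : forall i, k' v i = 0) by (intros; unfold k', erase; now rewrite Nat.eqb_refl).
assert (Hk'v' : forall i, k' i v = 0)
  by (intros; unfold k', erase; now rewrite Nat.eqb_refl, Bool.orb_true_r).
(* The left null vector is 0 at [v] and 1 elsewhere; [u0] is some vertex at which it is nonzero,
   available because [n] is at least 2. *)
set (u0 := if Nat.eqb v 0 then 1%nat else 0%nat).
assert (Hu0 : (u0 < n)%nat /\ u0 <> v)
  by (unfold u0; destruct (Nat.eqb_spec v 0); lia).
(* The trivial row [v] of the erased system is replaced by the equation [x v = 0]. *)
destruct (singular_kernel n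
  (fun j i => if Nat.eqb j v then (if Nat.eqb i v then 1 else 0)
              else (if Nat.eqb i j then w j * fsum n (k' j) else 0) - w i * k' i j)
  (fun j => if Nat.eqb j v then 0 else 1) u0) as (x & Hne & Hx).
- tauto.
- destruct (Nat.eqb_spec u0 v); [tauto|lra].
- intros i Hi.
  rewrite (fsum_ext n _ (fun j => (if Nat.eqb j i then w i * fsum n (k' i) else 0) - w i * k' i j)).
  + rewrite fsum_minus, fsum_scal, fsum_delta by assumption. lra.
  + intros j Hj. rewrite (Nat.eqb_sym i j). destruct (Nat.eqb_spec j v) as [->|Hjv].
    * rewrite Hk'v'. destruct (Nat.eqb_spec v i) as [<-|]; [|ring].
      rewrite (fsum_0 n (k' v)) by auto. ring.
    * destruct (Nat.eqb_spec j i); subst; ring.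
- assert (Hxv : x v = 0).
  { specialize (Hx v Hv). rewrite Nat.eqb_refl in Hx.
    rewrite (fsum_ext n _ (fun i => if Nat.eqb i v then x v else 0)) in Hx.
    - now rewrite fsum_delta in Hx.
    - intros i Hi. destruct (Nat.eqb_spec i v); subst; ring. }
  assert (HM : forall j, (j < n)%nat -> Mop n w k' x j = 0).
  { intros j Hj. destruct (Nat.eq_dec j v) as [->|Hjv].
    - apply fsum_0. intros i Hi. rewrite Hk'v, Hk'v'. ring.
    - specialize (Hx j Hj). destruct (Nat.eqb_spec j v); [easy|].
      rewrite <- Hx. unfold Mop. symmetry.
      rewrite (fsum_ext n _ (fun i => (if Nat.eqb i j then w j * fsum n (k' j) * x j else 0)
        - w i * x i * k' i j)).
      + rewrite !fsum_minus, fsum_delta by assumption. rewrite fsum_scal. ring.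
      + intros i Hi. destruct (Nat.eqb_spec i j); subst; ring. }
  assert (Hs : fsum n x <> 0).
  { intros Hs. specialize (Hinj x Hxv Hs HM). destruct Hne as (i & Hi & Hxi).
    assert (H1 := fsum_term_le n (fun i => x i ^ 2) i (fun i _ => pow2_ge_0 (x i)) Hi).
    simpl in H1, Hinj. nra. }
  (* Since [x v = 0], this scaling makes the mean of [c * x] over the other [n - 1] vertices equal
     to 1, so that [d] sums to zero. *)
  set (c := (INR n - 1) / fsum n x).
  exists (fun i => if Nat.eqb i v then 0 else c * x i - 1). split; [|split].
  + now rewrite Nat.eqb_refl.
  + assert (H := fsum_split n v (fun i => c * x i - 1) Hv). simpl in H.
    rewrite fsum_minus, fsum_scal, fsum_const, Hxv in H.
    assert (c * fsum n x = INR n - 1) by (unfold c; field; assumption). lra.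
  + intros j Hj. fold k'. rewrite <- (Rmult_0_r c), <- (HM j Hj). unfold Mop.
    rewrite <- fsum_scal. apply fsum_ext. intros i Hi.
    destruct (Nat.eqb_spec i v) as [->|]; destruct (Nat.eqb_spec j v) as [->|];
      rewrite ?Hk'v, ?Hk'v'; ring.
Qed.

Local Lemma kbar_bound i j : (i < n)%nat -> (j < n)%nat -> 0 <= kbar w i j <= 1.
Proof.
intros Hi Hj. unfold kbar. destruct (Nat.eqb i j); [lra|].
assert (H1 := w_pos i Hi). assert (H2 := w_pos j Hj). split.
- apply Rlt_le, Rdiv_lt_0_compat; lra.
- apply Rmult_le_reg_r with (w i + w j); [lra|]. field_simplify; lra.
Qed.

(** Cauchy-Schwarz keeping the weights: [(kbar w j v * w j) ^ 2 <= w j] sums to [W] instead of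
    [n]. *)
Local Lemma mean_sq_le v f : (v < n)%nat ->
  (p * fsum n (fun j => kbar w j v * (w j * f j))) ^ 2 <= p * P * fsum n (fun j => f j ^ 2).
Proof.
intros Hv. rewrite Rpow_mult_distr.
rewrite (fsum_ext n _ (fun j => (kbar w j v * w j) * f j)) by (intros; ring).
apply Rle_trans with (p ^ 2 * (W * fsum n (fun j => f j ^ 2))); [|rewrite <- P_def; lra].
apply Rmult_le_compat_l; [apply pow2_ge_0|].
eapply Rle_trans; [apply fsum_cauchy|]. apply Rmult_le_compat_r.
- apply fsum_nonneg; intros; apply pow2_ge_0.
- rewrite <- W_def. apply fsum_le. intros j Hj.
  assert (H := kbar_bound j v Hj Hv). assert (H1 := w_pos j Hj). assert (H2 := w_ub j Hj).
  assert (0 <= kbar w j v * w j <= w j) by nra. nra.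
Qed.

(** As weights are at most 1, [kbar w v j] is at least [w j / 2], so the mean is about [P / 2]; the
    fluctuation [8 * r * rho] is a small fraction of [P] because [r <= kap * P]. *)
Local Lemma out_ge v : (v < n)%nat -> P / 4 <= fsum n (k v).
Proof.
intros Hv. assert (H := typ_out _ _ _ _ _ _ k_typ v Hv). rewrite dev_eq in H.
assert (H1 : (W - 1) / 2 <= fsum n (kbar w v)).
{ assert (E := fsum_split n v w Hv). rewrite W_def in E. assert (Hwv := w_ub v Hv).
  apply Rle_trans with (/ 2 * fsum n (fun i => if Nat.eqb i v then 0 else w i)); [lra|].
  rewrite <- fsum_scal. apply fsum_le. intros j Hj. unfold kbar.
  rewrite (Nat.eqb_sym v j). destruct (Nat.eqb j v); [lra|].
  assert (H1 := w_pos j Hj). assert (H2 := w_ub j Hj). assert (H3 := w_pos v Hv).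
  apply Rmult_le_reg_r with (w v + w j); [lra|].
  replace (w j / (w v + w j) * (w v + w j)) with (w j) by (field; lra). nra. }
assert (H2 := r_le_P). assert (H3 := r_large). assert (H4 := kap_rho). assert (H5 := P_pos).
assert (Hk4 : kap <= kap ^ 4).
{ replace kap with (kap ^ 1) at 1 by ring. apply Rle_pow; [lra|lia]. }
assert (H6 : 1000 <= P) by nra.
assert (H7 : r * rho <= P / 100000).
{ apply Rle_trans with (kap * P * rho); [nra|].
  replace (kap * P * rho) with (P * (kap * rho)) by ring. nra. }
assert (H8 : p * ((W - 1) / 2) <= p * fsum n (kbar w v)) by (apply Rmult_le_compat_l; lra).
replace (p * ((W - 1) / 2)) with ((P - p) / 2) in H8 by (rewrite <- P_def; field).
lra.
Qed.

Lemma kernel_bound x :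
  fsum n x = INR n -> (forall j, (j < n)%nat -> Mop n w k x j = 0) ->
  (forall v, (v < n)%nat -> w v * Rabs (x v - 1) <= 30000 * eta) /\
  Rabs (fsum n (fun j => w j * (x j - 1))) <= 2304 * eta * W.
Proof.
intros Hx HM. assert (Hr := r_pos). assert (HP := P_pos). assert (HPr := P_le_r).
assert (HW := W_pos). assert (HrP := r_le_P). assert (Hkr := kap_rho).
assert (Hrr : 0 < r * rho) by (apply Rmult_lt_0_compat; lra).
assert (Heta : 0 < eta) by (rewrite eta_def; repeat apply Rmult_lt_0_compat; lra).
set (dl := fun j => x j - 1).
assert (Hdl0 : fsum n dl = 0) by (unfold dl; rewrite fsum_minus, fsum_const, Hx; lra).
set (D := fsum n (fun j => dl j ^ 2)).
(* The l2 error: summing the noise bound over [v] turns the factors [w v] into [W]. Here 2304 = 256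
   * 9. *)
assert (HD : D <= (2304 * eta) ^ 2 * (P * W / r)).
{ eapply Rle_trans; [apply (stability dl Hdl0)|].
  apply Rle_trans with ((256 * kap / r) ^ 2 * (81 * (r * rho ^ 2 * sigma ^ 2 * P) * W)).
  - apply Rmult_le_compat_l; [apply pow2_ge_0|]. rewrite <- W_def, <- fsum_scal.
    apply fsum_le. intros v Hv. unfold dl. rewrite Mop_minus, HM by assumption.
    assert (H := typ_noise _ _ _ _ _ _ k_typ v Hv). rewrite W_def, P_def in H. nra.
  - apply Req_le. rewrite eta_def. field. lra. }
assert (HDpos : 0 <= D) by (apply fsum_nonneg; intros; apply pow2_ge_0).
split.
(* The error of the total mass, by Cauchy-Schwarz against [w] with [w j ^ 2 <= w j] and [P <= r]. *)
2:{ apply sq_le_abs; [apply Rmult_le_pos; lra|].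
  eapply Rle_trans; [apply (fsum_cauchy n w dl)|]. fold D.
  apply Rle_trans with (W * ((2304 * eta) ^ 2 * (P * W / r))).
  - apply Rmult_le_compat; auto; [apply fsum_nonneg; intros; apply pow2_ge_0|].
    rewrite <- W_def. apply fsum_le. intros j Hj.
    assert (H1 := w_pos j Hj). assert (H2 := w_ub j Hj). nra.
  - replace (W * ((2304 * eta) ^ 2 * (P * W / r))) with ((2304 * eta * W) ^ 2 * (P / r)) by (field; lra).
    rewrite <- (Rmult_1_r ((2304 * eta * W) ^ 2)) at 2. apply Rmult_le_compat_l; [apply pow2_ge_0|].
    apply Rmult_le_reg_r with r; [lra|]. field_simplify; lra. }
set (M := linf n (fun j => w j * dl j)).
assert (HM0 : 0 <= M) by apply linf_nonneg.
(* Each coordinate is at most a constant plus half of the maximum [M], so taking the maximum over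
   [v] absorbs the half. *)
assert (Hmain : forall v, (v < n)%nat -> Rabs (w v * dl v) <= 15000 * eta + M / 2).
{ intros v Hv.
  destruct (loo_exists v Hv) as (d0 & Hd0). apply loo_spec in Hd0.
  assert (Hlo := typ_loo _ _ _ _ _ _ k_typ v Hv). rewrite dev_eq in Hlo.
  revert Hd0 Hlo. generalize (loo n w v k). intros d (Hdv & Hds & HdM) Hlo.
  set (B := linf n (fun j => w j * d j)) in *.
  assert (HB : 0 <= B) by apply linf_nonneg.
  set (z := fun j => dl j - d j).
  assert (Hzs : fsum n z = 0) by (unfold z; rewrite fsum_minus; lra).
  set (Z2 := fsum n (fun j => z j ^ 2)).
  assert (HZ20 : 0 <= Z2) by (apply fsum_nonneg; intros; apply pow2_ge_0).
  set (Z := sqrt Z2).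
  assert (HZ0 : 0 <= Z) by apply sqrt_pos.
  assert (HZZ : Z ^ 2 = Z2) by (apply pow2_sqrt; assumption).
  set (y := fun j => 1 + d j).
  assert (Hzj : forall j, (j < n)%nat -> Mop n w k z j = - Mop n w k y j).
  { intros j Hj.
    replace z with (fun i => x i - y i) by (apply functional_extensionality; intros; unfold z, dl, y; ring).
    rewrite Mop_minus, HM by assumption. ring. }
  set (Q := Rabs (Mop n w k y v)).
  set (G := fsum n (fun j => k j v * (w j * d j))).
  assert (HyG : Mop n w k y v = Mop n w k (fun _ => 1) v - G).
  { unfold Mop, G. rewrite <- fsum_minus. apply fsum_ext. intros i Hi. unfold y. rewrite Hdv. ring. }
  (* [y] solves the erased system exactly, so away from [v] only edges at [v] contribute: a
     comparison error, bounded by [typ_edge], and a term in [d]. *)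
  assert (Hrest : fsum n (fun j => if Nat.eqb j v then 0 else Mop n w k y j ^ 2)
                  <= (36 * r * rho * sigma) ^ 2 + (2 * r * rho * B) ^ 2).
  { apply Rle_trans with
      (fsum n (fun j => 648 * (r * rho ^ 2 * sigma ^ 2) * (k v j + k j v)
                        + 2 * ((w j * d j) * k j v) ^ 2)).
    - apply fsum_le. intros j Hj. assert (H1 := pow2_ge_0 ((w j * d j) * k j v)).
      assert (H2 := typ_edge _ _ _ _ _ _ k_typ v j Hv Hj).
      assert (H3 := pow2_ge_0 (w j * k j v - w v * k v j)).
      destruct (Nat.eqb_spec j v) as [_|Hjv]; [lra|].
      rewrite (Mop_erase v y j Hv Hj Hjv). unfold y at 1. rewrite HdM by assumption.
      assert (H4 := pow2_ge_0 ((w j * k j v - w v * k v j) - (w j * d j) * k j v)).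
      unfold y. rewrite Hdv.
      replace (0 + (w j * (1 + d j) * k j v - w v * (1 + 0) * k v j))
        with ((w j * k j v - w v * k v j) + (w j * d j) * k j v) by ring.
      nra.
    - rewrite fsum_plus, !fsum_scal.
      assert (H1 := deg_le v Hv).
      assert (H2 : fsum n (fun j => ((w j * d j) * k j v) ^ 2) <= 2 * r * B ^ 2).
      { apply row_le; [assumption| |apply pow2_ge_0]. intros j Hj.
        rewrite <- Rsqr_pow2, <- (Rsqr_pow2 B). apply Rsqr_le_abs_1.
        rewrite (Rabs_right B) by lra. apply (linf_ub n (fun j => w j * d j) j Hj). }
      assert (H3 : 648 * (r * rho ^ 2 * sigma ^ 2) * fsum n (fun j => k v j + k j v)
                   <= 648 * (r * rho ^ 2 * sigma ^ 2) * (2 * r)).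
      { apply Rmult_le_compat_l; [|assumption].
        assert (0 <= r * rho ^ 2 * sigma ^ 2); [|lra].
        repeat apply Rmult_le_pos; try apply pow2_ge_0; lra. }
      (* The term in [d] has size [sqrt r * B]; [1 <= r * rho ^ 2] raises [sqrt r] to the common
         scale [r * rho]. *)
      assert (H4 : r * B ^ 2 <= r * (r * rho ^ 2) * B ^ 2).
      { apply Rmult_le_compat_r; [apply pow2_ge_0|]. nra. }
      replace ((36 * r * rho * sigma) ^ 2) with (648 * (r * rho ^ 2 * sigma ^ 2) * (2 * r)) by ring.
      replace ((2 * r * rho * B) ^ 2) with (4 * (r * (r * rho ^ 2) * B ^ 2)) by ring.
      lra. }
  assert (HZ : Z <= 256 * kap / r * (Q + 36 * r * rho * sigma + 2 * r * rho * B)).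
  { assert (Hc : 0 < 256 * kap / r) by (apply Rdiv_lt_0_compat; lra).
    assert (HQ0 : 0 <= Q) by apply Rabs_pos.
    assert (Ha : 0 <= 36 * r * rho * sigma) by (repeat apply Rmult_le_pos; lra).
    assert (Hb : 0 <= 2 * r * rho * B) by (repeat apply Rmult_le_pos; lra).
    rewrite <- (Rabs_right Z) by lra. apply sq_le_abs; [apply Rmult_le_pos; lra|].
    rewrite HZZ, Rpow_mult_distr.
    eapply Rle_trans; [apply (stability z Hzs)|].
    apply Rmult_le_compat_l; [apply pow2_ge_0|].
    rewrite (fsum_ext n _ (fun j => Mop n w k y j ^ 2))
      by (intros j Hj; rewrite Hzj by assumption; ring).
    rewrite (fsum_split n v _ Hv). cbv beta.
    replace (Mop n w k y v ^ 2) with (Q ^ 2) by apply pow2_abs.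
    generalize dependent (36 * r * rho * sigma). generalize dependent (2 * r * rho * B).
    intros. nra. }
  assert (HQ : Q <= 2313 * eta * P + r * rho * Z + 8 * r * rho * B).
  { unfold Q. rewrite HyG.
    assert (H1 : Rabs (Mop n w k (fun _ => 1) v) <= 9 * eta * P).
    { apply sq_le_abs; [repeat apply Rmult_le_pos; lra|]. now apply noise_le. }
    assert (H2 : Rabs (p * fsum n (fun j => kbar w j v * (w j * dl j))) <= 2304 * eta * P).
    { apply sq_le_abs; [repeat apply Rmult_le_pos; lra|].
      eapply Rle_trans; [apply mean_sq_le, Hv|]. fold D.
      apply Rle_trans with (p * P * ((2304 * eta) ^ 2 * (P * W / r))).
      - apply Rmult_le_compat_l; [nra|assumption].
      - replace (p * P * ((2304 * eta) ^ 2 * (P * W / r)))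
          with ((2304 * eta * P) ^ 2 * (p * W / r)) by (field; lra).
        rewrite P_def. rewrite <- (Rmult_1_r ((2304 * eta * P) ^ 2)) at 2.
        apply Rmult_le_compat_l; [apply pow2_ge_0|].
        apply Rmult_le_reg_r with r; [lra|]. field_simplify; lra. }
    assert (H3 : Rabs (p * fsum n (fun j => kbar w j v * (w j * z j))) <= r * rho * Z).
    { apply sq_le_abs; [apply Rmult_le_pos; lra|].
      eapply Rle_trans; [apply mean_sq_le, Hv|]. fold Z2. rewrite Rpow_mult_distr, HZZ.
      apply Rmult_le_compat_r; [assumption|].
      replace ((r * rho) ^ 2) with (r * (r * rho ^ 2)) by ring. nra. }
    (* Around the mean rates, [d] is controlled by independence; in the mean, [d] is written as
       [dl - z], both of which are small in l2. *)
    assert (HG : G = fsum n (fun j => (k j v - p * kbar w j v) * (w j * d j))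
                 + (p * fsum n (fun j => kbar w j v * (w j * dl j))
                    - p * fsum n (fun j => kbar w j v * (w j * z j)))).
    { unfold G. rewrite <- !fsum_scal, <- fsum_minus, <- fsum_plus.
      apply fsum_ext. intros j Hj. unfold z. ring. }
    rewrite HG. revert H1 H2 H3 Hlo. clear.
    unfold Rabs; repeat destruct Rcase_abs; lra. }
  assert (HBM : B <= M + Z).
  { apply linf_le; [lra|]. intros j Hj.
    replace (w j * d j) with (w j * dl j - w j * z j) by (unfold z; ring).
    assert (H1 := linf_ub n (fun j => w j * dl j) j Hj). fold M in H1. simpl in H1.
    assert (H2 : Rabs (w j * z j) <= Z).
    { apply sq_le_abs; [assumption|]. rewrite HZZ.
      assert (H2 := fsum_term_le n (fun j => z j ^ 2) j (fun i _ => pow2_ge_0 (z i)) Hj).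
      fold Z2 in H2. simpl in H2. assert (H3 := w_pos j Hj). assert (H4 := w_ub j Hj).
      assert (H5 := pow2_ge_0 (z j)). rewrite Rpow_mult_distr. assert (w j ^ 2 <= 1) by nra. nra. }
    revert H1 H2. clear. unfold Rabs; repeat destruct Rcase_abs; lra. }
  (* Row [v] of [M z]: as [d v = 0], its diagonal term is [w v * dl v] times the total out-rate, so
     the error at [v] can be read off from the residual there. *)
  assert (Hrow : Rabs (w v * dl v) * (P / 4) <= Q + 2 * r * rho * Z).
  { apply Rle_trans with (Rabs (w v * dl v * fsum n (k v))).
    - rewrite (Rabs_mult (w v * dl v)). apply Rmult_le_compat_l; [apply Rabs_pos|].
      assert (H := out_ge v Hv). rewrite Rabs_right; lra.
    - assert (E : w v * dl v * fsum n (k v) =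
        - Mop n w k y v + fsum n (fun j => (1 * k j v) * (w j * z j))).
      { rewrite <- (Hzj v Hv). unfold Mop. rewrite <- fsum_plus, <- fsum_scal.
        apply fsum_ext. intros i Hi. unfold z at 1. rewrite Hdv. ring. }
      assert (H1 : Rabs (fsum n (fun j => (1 * k j v) * (w j * z j))) <= 2 * r * rho * Z).
      { apply sq_le_abs; [repeat apply Rmult_le_pos; lra|].
        eapply Rle_trans; [apply fsum_cauchy|].
        apply Rle_trans with (2 * r * 1 * Z2).
        - apply Rmult_le_compat; try (apply fsum_nonneg; intros; apply pow2_ge_0).
          + apply (row_le v (fun _ => 1) 1 Hv); intros; lra.
          + apply fsum_le. intros j Hj. assert (H3 := w_pos j Hj). assert (H4 := w_ub j Hj).
            assert (H5 := pow2_ge_0 (z j)). rewrite Rpow_mult_distr. assert (w j ^ 2 <= 1) by nra. nra.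
        - rewrite Rpow_mult_distr, HZZ. apply Rmult_le_compat_r; [assumption|].
          replace ((2 * r * rho) ^ 2) with (4 * r * (r * rho ^ 2)) by ring. nra. }
      rewrite E. eapply Rle_trans; [apply Rabs_triang|]. rewrite Rabs_Ropp. fold Q. lra. }
  eapply (loo_arith r P rho sigma kap eta _ M Z Q B); eauto. }
assert (HM15 : M <= 15000 * eta + M / 2) by (apply linf_le; [lra|exact Hmain]).
intros v Hv. specialize (Hmain v Hv). rewrite Rabs_mult, Rabs_right in Hmain
  by (apply Rle_ge, Rlt_le, w_pos, Hv). unfold dl in Hmain. lra.
Qed.

End Deterministic.

(** * From kernel vectors to stationary distributions *)

Definition rates (n L : nat) (om : Omega) (i j : nat) : R :=
  if edge n om i j then ybar n L om i j else 0.

Lemma edge_diag n om i : edge n om i i = false.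
Proof. unfold edge. now rewrite Nat.ltb_irrefl. Qed.

Lemma rates_diag n L om i : rates n L om i i = 0.
Proof. unfold rates. now rewrite edge_diag. Qed.

(* With [pi i = u i * x i], stationarity is the balance equation [Mop x = 0]; the
   normalisation [d] drops out. *)
Lemma stationary_Mop n L d om u pi :
  0 < d -> (forall i, (i < n)%nat -> 0 < u i) ->
  stationary n (Pmat n L d om) pi <->
  fsum n pi = 1 /\
  forall j, (j < n)%nat -> Mop n u (rates n L om) (fun i => pi i / u i) j = 0.
Proof.
intros Hd Hu. unfold stationary.
assert (H : forall j, (j < n)%nat ->
  fsum n (fun i => pi i * Pmat n L d om i j) =
  pi j - / d * Mop n u (rates n L om) (fun i => pi i / u i) j).
{ intros j Hj. set (k := rates n L om).
  rewrite (fsum_ext n _ (fun i => (if Nat.eqb i j then pi j * (1 - / d * fsum n (k j)) else 0)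
    + / d * (pi i * k i j))).
  - rewrite fsum_plus, fsum_delta, fsum_scal by assumption.
    unfold Mop. rewrite (fsum_ext n (fun i => u j * (pi j / u j) * k j i - u i * (pi i / u i) * k i j)
      (fun i => pi j * k j i - pi i * k i j)).
    + rewrite fsum_minus, fsum_scal. ring.
    + intros i Hi. assert (H1 := Hu i Hi). assert (H2 := Hu j Hj). field. lra.
  - intros i Hi. unfold Pmat, k, rates. destruct (Nat.eqb_spec i j) as [->|].
    + rewrite edge_diag. ring.
    + destruct (edge n om i j); ring. }
assert (Hd' : 0 < / d) by now apply Rinv_0_lt_compat.
split; intros [H1 H2]; split; auto; intros j Hj; specialize (H2 j Hj); specialize (H j Hj).
- rewrite H in H2. assert (E : / d * Mop n u (rates n L om) (fun i => pi i / u i) j = 0) by lra.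
  apply Rmult_integral in E. destruct E; [lra|assumption].
- rewrite H, H2. ring.
Qed.

(** The kernel bounds are for vectors [x] of sum [n], whereas [pi] has sum 1. With [S] the sum of
    [u * x] one has [pi = u * x / S], and the bound on the mass error says that [S] is close to
    [U]. *)
Lemma typical_event (n L K : nat) (p d wmin wmax : R) (w : nat -> R) (om : Omega) :
  (2 <= n)%nat -> (1 <= L)%nat -> (1 <= K)%nat -> (K < n)%nat -> 0 < d ->
  0 < wmin -> wmin <= wmax ->
  (forall i, (i < n)%nat -> wmin <= w i <= wmax) ->
  (forall i j, (i <= j)%nat -> (j < n)%nat -> w j <= w i) ->
  0 < p -> p <= 1 -> 1 <= ln (INR n) ->
  10000000000 * (wmax / wmin) ^ 4 * ln (INR n) <= INR n * p ->
  (forall i j, 0 <= rates n L om i j <= 1) ->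
  typical n p (ln (INR n)) (/ sqrt (INR L)) (fun i => w i / w 0%nat) (rates n L om) ->
  (exists pi, stationary n (Pmat n L d om) pi) /\
  forall pi, stationary n (Pmat n L d om) pi ->
    linf n (fun i => pi i - pistar n w i) / linf n (pistar n w)
      <= 70000 * (wmax / wmin) * sqrt (ln (INR n) / (INR n * p * INR L)) /\
    ((0 < DeltaK w wmax K /\
      INR n ^ 2 * p * INR L / 2
        >= 4 * 70000 ^ 2 * ((wmax / wmin) ^ 2 * INR n * ln (INR n)) / (DeltaK w wmax K) ^ 2) ->
     topK_recovered n K pi).
Proof.
intros Hn HL HK1 HKn Hd Hwmin Hwm Hw Hdec Hp Hp1 Hl Hbig Hk Htyp.
set (u := fun i => w i / w 0%nat) in *. set (k := rates n L om) in *.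
set (kap := wmax / wmin) in *. set (ell := ln (INR n)) in *. set (r := INR n * p) in *.
set (rho := sqrt (ell / r)). set (sigma := / sqrt (INR L)) in *. set (eta := kap * rho * sigma).
assert (HnR : 0 < INR n) by (apply lt_0_INR; lia).
assert (HLR : 1 <= INR L) by (replace 1 with (INR 1) by reflexivity; apply le_INR; lia).
assert (Hr : 0 < r) by now apply Rmult_lt_0_compat.
assert (Hkap : 1 <= kap).
{ unfold kap. apply Rmult_le_reg_r with wmin; [lra|]. field_simplify; lra. }
assert (Hw0 := Hw 0%nat ltac:(lia)).
assert (Hlr : 0 < ell / r) by (apply Rdiv_lt_0_compat; lra).
assert (Hrho : 0 < rho) by now apply sqrt_lt_R0.
assert (Hrho2 : r * rho ^ 2 = ell) by (unfold rho; rewrite pow2_sqrt by lra; field; lra).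
assert (HsL : 1 <= sqrt (INR L)) by (rewrite <- sqrt_1; apply sqrt_le_1_alt; lra).
assert (Hsig : 0 < sigma) by (apply Rinv_0_lt_compat; lra).
assert (Hsig1 : sigma <= 1) by (unfold sigma; rewrite <- Rinv_1; apply Rinv_le_contravar; lra).
assert (Hks : kap ^ 2 * rho <= / 100000).
{ rewrite <- (Rabs_right (kap ^ 2 * rho)) by nra. apply sq_le_abs; [lra|].
  apply Rmult_le_reg_l with r; [lra|]. rewrite Rpow_mult_distr.
  replace (r * ((kap ^ 2) ^ 2 * rho ^ 2)) with (kap ^ 4 * (r * rho ^ 2)) by ring.
  rewrite Hrho2. lra. }
assert (Hu1 : forall i, (i < n)%nat -> u i <= 1).
{ intros i Hi. unfold u. specialize (Hdec 0%nat i ltac:(lia) Hi).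
  apply Rmult_le_reg_r with (w 0%nat); [lra|]. field_simplify; lra. }
assert (Huk : forall i, (i < n)%nat -> 1 <= kap * u i).
{ intros i Hi. unfold u, kap. specialize (Hw i Hi).
  apply Rmult_le_reg_r with (wmin * w 0%nat); [apply Rmult_lt_0_compat; lra|].
  replace (wmax / wmin * (w i / w 0%nat) * (wmin * w 0%nat)) with (w i * wmax) by (field; lra).
  rewrite Rmult_1_l. apply Rmult_le_compat; lra. }
assert (Hupos : forall i, (i < n)%nat -> 0 < u i).
{ intros i Hi. apply Rdiv_lt_0_compat; [specialize (Hw i Hi)|]; lra. }
assert (Hk0 : forall i j, 0 <= k i j) by (intros; apply Hk).
assert (Hk1 : forall i j, k i j <= 1) by (intros; apply Hk).
assert (Hell1 : 1 <= r * rho ^ 2) by lra.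
assert (Htyp' : typical n p (r * rho ^ 2) sigma u k) by now rewrite Hrho2.
set (U := fsum n u).
assert (HU : 0 < U).
{ apply Rlt_le_trans with (u 0%nat); [apply Hupos; lia|].
  apply (fsum_term_le n u); [|lia]. intros; now apply Rlt_le, Hupos. }
assert (HwU : forall i, pistar n w i = u i / U).
{ intros i. unfold pistar. replace (fsum n w) with (w 0%nat * U).
  - unfold u. field. lra.
  - unfold U. rewrite <- fsum_scal. apply fsum_ext. intros; unfold u; field; lra. }
assert (Heta : 0 < eta) by (unfold eta; apply Rmult_lt_0_compat; [apply Rmult_lt_0_compat|]; lra).
assert (Heta_small : eta <= / 100000).
{ unfold eta. assert (0 < kap * rho) by nra. assert (kap * rho <= kap ^ 2 * rho); [|nra].
  apply Rmult_le_compat_r; nra. }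
assert (Hsum_nz : forall x, (forall j, (j < n)%nat -> Mop n u k x j = 0) ->
  (exists i, (i < n)%nat /\ x i <> 0) -> fsum n x <> 0).
{ eapply (kernel_sum_nonzero n p r rho sigma kap U (p * U) u k); eauto. }
assert (Hbound : forall x, fsum n x = INR n -> (forall j, (j < n)%nat -> Mop n u k x j = 0) ->
  (forall v, (v < n)%nat -> u v * Rabs (x v - 1) <= 30000 * eta) /\
  Rabs (fsum n (fun j => u j * (x j - 1))) <= 2304 * eta * U).
{ eapply (kernel_bound n p r rho sigma kap U (p * U) eta u k); eauto. }
assert (Hmass : forall x, fsum n x = INR n -> (forall j, (j < n)%nat -> Mop n u k x j = 0) ->
  Rabs (fsum n (fun j => u j * x j) - U) <= 2304 * eta * U /\
  U / 2 <= fsum n (fun j => u j * x j)).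
{ intros x Hx HM. destruct (Hbound x Hx HM) as [_ H].
  rewrite (fsum_ext n _ (fun j => u j * x j - u j)) in H by (intros; ring).
  rewrite fsum_minus in H. fold U in H. split; [assumption|].
  revert H. unfold Rabs; destruct Rcase_abs; nra. }
split.
{ destruct (kernel_exists n p r rho sigma kap U (p * U) u k) as (x & Hx & HM); auto.
  destruct (Hmass x Hx HM) as [_ HS].
  set (S := fsum n (fun j => u j * x j)) in *.
  exists (fun i => u i * x i / S). apply (stationary_Mop n L d om u); auto. split.
  - unfold Rdiv. rewrite fsum_scal_r. fold S. field. lra.
  - intros j Hj. fold k. rewrite <- (Rmult_0_r (/ S)), <- (HM j Hj). unfold Mop.
    rewrite <- fsum_scal. apply fsum_ext. intros i Hi.
    assert (H1 := Hupos i Hi). assert (H2 := Hupos j Hj). field. lra. }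
intros pi Hpi. apply (stationary_Mop n L d om u) in Hpi; auto. destruct Hpi as [Hpi1 HpiM].
fold k in HpiM. set (y := fun i => pi i / u i) in *.
assert (Hpiy : forall i, (i < n)%nat -> pi i = u i * y i).
{ intros i Hi. unfold y. assert (H := Hupos i Hi). field. lra. }
(* [pi] may have entries of any sign, so the sum of [y] is nonzero only because a kernel vector of
   sum zero would vanish, contradicting that [pi] sums to 1. *)
assert (Hy : fsum n y <> 0).
{ apply Hsum_nz; [assumption|]. apply NNPP. intros Hno.
  assert (fsum n pi = 0); [|lra]. apply fsum_0. intros i Hi. rewrite Hpiy by assumption.
  destruct (Req_dec (y i) 0) as [->|E]; [ring|]. exfalso. apply Hno. eauto. }
set (c := INR n / fsum n y). set (x := fun i => c * y i).
assert (Hx : fsum n x = INR n) by (unfold x, c; rewrite fsum_scal; field; assumption).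
assert (HM : forall j, (j < n)%nat -> Mop n u k x j = 0).
{ intros j Hj. rewrite <- (Rmult_0_r c), <- (HpiM j Hj). unfold Mop.
  rewrite <- fsum_scal. apply fsum_ext. intros i Hi. unfold x. ring. }
destruct (Hbound x Hx HM) as [Hb _]. destruct (Hmass x Hx HM) as [Hm HS].
set (S := fsum n (fun j => u j * x j)) in *.
assert (HSc : S = c).
{ unfold S, x. rewrite (fsum_ext n _ (fun j => c * pi j)).
  - rewrite fsum_scal, Hpi1. ring.
  - intros j Hj. rewrite Hpiy by assumption. ring. }
assert (Hpix : forall i, (i < n)%nat -> pi i = u i * x i / S).
{ intros i Hi. rewrite Hpiy by assumption. unfold x. rewrite HSc. field. lra. }
(* The numerator is at most [(30000 + 2304) * eta * U], and [S >= U / 2] doubles this to less than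
   70000. *)
assert (Herr : forall i, (i < n)%nat -> Rabs (pi i - u i / U) <= 70000 * eta / U).
{ intros i Hi. rewrite Hpix by assumption.
  replace (u i * x i / S - u i / U) with ((u i * (x i - 1) * U - u i * (S - U)) / (U * S)) by (field; lra).
  unfold Rdiv at 1. rewrite Rabs_mult, (Rabs_right (/ (U * S)))
    by (apply Rle_ge, Rlt_le, Rinv_0_lt_compat, Rmult_lt_0_compat; lra).
  apply Rmult_le_reg_r with (U * S); [apply Rmult_lt_0_compat; lra|].
  rewrite Rmult_assoc, Rinv_l, Rmult_1_r by (apply Rmult_integral_contrapositive; lra).
  replace (70000 * eta / U * (U * S)) with (70000 * eta * S) by (field; lra).
  apply Rle_trans with (30000 * eta * U + 2304 * eta * U).
  - unfold Rminus at 1. eapply Rle_trans; [apply Rabs_triang|]. rewrite Rabs_Ropp.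
    apply Rplus_le_compat.
    + rewrite Rabs_mult, (Rabs_right U), Rabs_mult, (Rabs_right (u i))
        by (try specialize (Hupos i Hi); lra).
      apply Rmult_le_compat_r; [lra|auto].
    + rewrite Rabs_mult, (Rabs_right (u i)) by (specialize (Hupos i Hi); lra).
      assert (H1 := Hupos i Hi). assert (H2 := Hu1 i Hi). assert (H3 := Rabs_pos (S - U)). nra.
  - assert (70000 * eta * (U / 2) <= 70000 * eta * S) by (apply Rmult_le_compat_l; lra). nra. }
split.
- assert (Hinf : 1 / U <= linf n (pistar n w)).
  { apply Rle_trans with (Rabs (pistar n w 0%nat)); [|apply (linf_ub n (pistar n w)); lia].
    rewrite HwU. replace (u 0%nat) with 1 by (unfold u; field; lra). apply Rle_abs. }
  assert (H1U : 0 < 1 / U) by (apply Rdiv_lt_0_compat; lra).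
  assert (Hrs : sqrt (ell / (r * INR L)) = rho * sigma).
  { unfold rho, sigma. replace (ell / (r * INR L)) with ((ell / r) * / INR L) by (field; lra).
    rewrite sqrt_mult by (try apply Rlt_le, Rinv_0_lt_compat; lra).
    now rewrite sqrt_inv. }
  rewrite Hrs. replace (70000 * kap * (rho * sigma)) with (70000 * eta) by (unfold eta; ring).
  apply Rmult_le_reg_r with (linf n (pistar n w)); [lra|].
  unfold Rdiv. rewrite Rmult_assoc, Rinv_l, Rmult_1_r by lra.
  apply Rle_trans with (70000 * eta * (1 / U)).
  + apply linf_le; [apply Rmult_le_pos; lra|]. intros i Hi. rewrite HwU.
    eapply Rle_trans; [now apply Herr|]. right. field. lra.
  + apply Rmult_le_compat_l; lra.
- intros [HD Hcond] i j Hi Hj Hjn.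
  (* Normalising by [w 0] in place of the larger [wmax] can only increase the separation. *)
  assert (HDu : DeltaK w wmax K <= u (K - 1)%nat - u K).
  { unfold DeltaK, u. rewrite <- Rdiv_minus_distr. unfold Rdiv. apply Rmult_le_compat_l.
    - specialize (Hdec (K - 1)%nat K ltac:(lia) ltac:(lia)). lra.
    - apply Rinv_le_contravar; lra. }
  set (De := DeltaK w wmax K) in *.
  (* Two entries of [pi] can each be off by [70000 * eta / U]. The constant [4 * 70000 ^ 2] gives
     [8 * (70000 * eta) ^ 2 <= De ^ 2], while 4 in place of 8 would be the borderline. *)
  assert (HDe : 140000 * eta < De).
  { apply Rge_le in Hcond.
    apply Rmult_le_compat_r with (r := De ^ 2 * 2 * sigma ^ 2 / (INR n * r)) in Hcond.
    2:{ assert (0 < De ^ 2) by now apply pow_lt. assert (0 < sigma ^ 2) by now apply pow_lt.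
      apply Rlt_le, Rdiv_lt_0_compat; [nra|]. apply Rmult_lt_0_compat; assumption. }
    assert (Hs2 : sigma ^ 2 * INR L = 1).
    { unfold sigma. rewrite pow_inv, pow2_sqrt by lra. field. lra. }
    replace (INR n ^ 2 * p * INR L / 2 * (De ^ 2 * 2 * sigma ^ 2 / (INR n * r)))
      with (De ^ 2 * (sigma ^ 2 * INR L)) in Hcond by (unfold r; field; lra).
    replace (4 * 70000 ^ 2 * (kap ^ 2 * INR n * ell) / De ^ 2 * (De ^ 2 * 2 * sigma ^ 2 / (INR n * r)))
      with (8 * (70000 * eta) ^ 2) in Hcond by (rewrite <- Hrho2; unfold eta; field; lra).
    rewrite Hs2 in Hcond. nra. }
  assert (Hi' := Herr i ltac:(lia)). assert (Hj' := Herr j Hjn).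
  assert (Hui : u (K - 1)%nat <= u i).
  { unfold u, Rdiv. apply Rmult_le_compat_r; [apply Rlt_le, Rinv_0_lt_compat; lra|]. apply Hdec; lia. }
  assert (Huj : u j <= u K).
  { unfold u, Rdiv. apply Rmult_le_compat_r; [apply Rlt_le, Rinv_0_lt_compat; lra|]. apply Hdec; lia. }
  assert (Hgap : 140000 * eta / U < u i / U - u j / U).
  { rewrite <- Rdiv_minus_distr. unfold Rdiv. apply Rmult_lt_compat_r; [now apply Rinv_0_lt_compat|]. lra. }
  replace (140000 * eta / U) with (2 * (70000 * eta / U)) in Hgap by (field; lra).
  revert Hi' Hj' Hgap. unfold Rabs; repeat destruct Rcase_abs; lra.
Qed.

(** * Expectations over the product space *)

Definition site := (nat * nat)%type.
Definition entry := (bool * list bool)%type.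
(** Outcomes become functions on sites, so that changing or fixing a single coordinate needs no list
    positions. *)
Definition config := site -> entry.

Definition site_eq_dec (a b : site) : {a = b} + {a <> b}.
Proof. decide equality; apply Nat.eq_dec. Defined.

Definition upd (om : config) (q : site) (x : entry) : config :=
  fun q' => if site_eq_dec q' q then x else om q'.

Lemma upd_same om q x : upd om q x q = x.
Proof. unfold upd. now destruct (site_eq_dec q q). Qed.

Lemma upd_other om q x q' : q' <> q -> upd om q x q' = om q'.
Proof. unfold upd. now destruct (site_eq_dec q' q). Qed.

Lemma upd_comm om q q' x x' : q <> q' -> upd (upd om q x) q' x' = upd (upd om q' x') q x.
Proof.
intros H. apply functional_extensionality. intros a. unfold upd.
destruct (site_eq_dec a q'), (site_eq_dec a q); congruence.
Qed.

Definition agree_off (qs : list site) (om om' : config) : Prop :=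
  forall q, ~ In q qs -> om' q = om q.

Definition indic (P : Prop) : R := if excluded_middle_informative P then 1 else 0.

Section Expectation.

Variables (mu : site -> entry -> R) (sup : list entry).

(** Only the listed coordinates are integrated and the others keep their values in [om]; the same
    function thus serves as expectation and as conditional expectation. *)
Fixpoint Ex (qs : list site) (F : config -> R) (om : config) : R :=
  match qs with
  | [] => F om
  | q :: qs => lsum sup (fun x => mu q x * Ex qs F (upd om q x))
  end.

(** Bounds such as [frac_true L ys <= 1] hold only for bit lists of length [L], hence the
    restriction to the support. *)
Definition supported (om : config) : Prop := forall q, In (om q) sup.

Definition law_on (qs : list site) : Prop :=
  forall q, In q qs -> (forall x, In x sup -> 0 <= mu q x) /\ lsum sup (mu q) = 1.

Lemma supported_upd om q x : supported om -> In x sup -> supported (upd om q x).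
Proof. intros H Hx q'. unfold upd. destruct (site_eq_dec q' q); auto. Qed.

Lemma agree_off_cons q qs om x om' :
  agree_off qs (upd om q x) om' -> agree_off (q :: qs) om om'.
Proof.
intros H a Ha. rewrite H by (simpl in Ha; tauto). apply upd_other.
intros ->. apply Ha. now left.
Qed.

Lemma Ex_le qs F G om :
  law_on qs -> supported om ->
  (forall om', agree_off qs om om' -> supported om' -> F om' <= G om') ->
  Ex qs F om <= Ex qs G om.
Proof.
revert om. induction qs as [|q qs IH]; intros om Hmu Hom H; simpl.
- apply H; auto. now intros q _.
- apply lsum_le. intros x Hx. apply Rmult_le_compat_l; [apply Hmu; simpl; auto|].
  apply IH.
  + intros a Ha. apply Hmu. now right.
  + now apply supported_upd.
  + intros om' Ha Hs. apply H; auto. eapply agree_off_cons; eauto.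
Qed.

Lemma Ex_ext qs F G om :
  supported om ->
  (forall om', agree_off qs om om' -> supported om' -> F om' = G om') ->
  Ex qs F om = Ex qs G om.
Proof.
revert om. induction qs as [|q qs IH]; intros om Hom H; simpl.
- apply H; auto. now intros q _.
- apply lsum_ext. intros x Hx. f_equal. apply IH.
  + now apply supported_upd.
  + intros om' Ha Hs. apply H; auto. eapply agree_off_cons; eauto.
Qed.

Lemma Ex_plus qs F G om : Ex qs (fun o => F o + G o) om = Ex qs F om + Ex qs G om.
Proof.
revert om. induction qs as [|q qs IH]; intros om; simpl; [reflexivity|].
rewrite <- lsum_plus. apply lsum_ext. intros x _. rewrite IH. ring.
Qed.

Lemma Ex_scal qs c F om : Ex qs (fun o => c * F o) om = c * Ex qs F om.
Proof.
revert om. induction qs as [|q qs IH]; intros om; simpl; [reflexivity|].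
rewrite <- lsum_scal. apply lsum_ext. intros x _. rewrite IH. ring.
Qed.

Lemma Ex_const qs c om : law_on qs -> Ex qs (fun _ => c) om = c.
Proof.
revert om. induction qs as [|q qs IH]; intros om Hmu; simpl; [reflexivity|].
rewrite (lsum_ext _ _ (fun x => mu q x * c)).
- rewrite lsum_scal_r. destruct (Hmu q) as [_ ->]; [now left|ring].
- intros x _. rewrite IH; [reflexivity|]. intros a Ha. apply Hmu. now right.
Qed.

Lemma Ex_app qs qs' F om : Ex (qs ++ qs') F om = Ex qs (Ex qs' F) om.
Proof.
revert om. induction qs as [|q qs IH]; intros om; simpl; [reflexivity|].
apply lsum_ext. intros x _. now rewrite IH.
Qed.

(** Exchange of finite sums; distinctness of the sites is what lets the updates commute. *)
Lemma Ex_perm qs qs' F om : Permutation qs qs' -> NoDup qs -> Ex qs F om = Ex qs' F om.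
Proof.
intros HP. revert om. induction HP as [|q l l' HP IH|q q' l|l l' l'' H1 IH1 H2 IH2];
  intros om Hnd; simpl.
- reflexivity.
- apply lsum_ext. intros x _. rewrite IH; [reflexivity|]. now inversion Hnd.
- rewrite (lsum_ext sup _ (fun x => lsum sup (fun x' => mu q' x * (mu q x' * Ex l F (upd (upd om q' x) q x')))))
    by (intros; now rewrite lsum_scal).
  rewrite lsum_swap. apply lsum_ext. intros x _. rewrite <- lsum_scal.
  apply lsum_ext. intros x' _. rewrite (upd_comm om q q').
  + ring.
  + intros ->. inversion Hnd as [|? ? Hni _]. apply Hni. now left.
- rewrite IH1 by assumption. apply IH2. eapply Permutation_NoDup; eauto.
Qed.

Lemma Ex_prod qs f om : NoDup qs -> supported om ->
  Ex qs (fun o => lprod qs (fun q => f q (o q))) om =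
  lprod qs (fun q => lsum sup (fun x => mu q x * f q x)).
Proof.
revert om. induction qs as [|q qs IH]; intros om Hnd Hom; simpl; [reflexivity|].
inversion Hnd as [|? ? Hni Hnd']; subst.
rewrite lprod_cons, <- lsum_scal_r. apply lsum_ext. intros x Hx.
rewrite (Ex_ext _ _ (fun o => f q x * lprod qs (fun a => f a (o a)))).
- rewrite Ex_scal, IH by (auto using supported_upd). ring.
- now apply supported_upd.
- intros o Ho _. rewrite lprod_cons, (Ho q Hni), upd_same. reflexivity.
Qed.

(* Fubini: the coordinates [qs2] are integrated first, conditionally on the others. *)
Lemma Ex_cond_prod_le qs qs1 qs2 (phi : config -> site -> entry -> R) c om :
  Permutation qs (qs1 ++ qs2) -> NoDup qs -> law_on qs -> supported om ->
  (forall o o', agree_off qs2 o o' -> phi o' = phi o) ->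
  (forall o, supported o ->
     lprod qs2 (fun q => lsum sup (fun x => mu q x * phi o q x)) <= c) ->
  Ex qs (fun o => lprod qs2 (fun q => phi o q (o q))) om <= c.
Proof.
intros HP Hnd Hmu Hom Hdep Hc.
assert (Hmu1 : law_on qs1).
{ intros q Hq. apply Hmu. eapply Permutation_in; [apply Permutation_sym; eauto|].
  apply in_or_app. now left. }
assert (Hnd2 : NoDup qs2).
{ apply (Permutation_NoDup HP) in Hnd. now apply NoDup_app_remove_l in Hnd. }
rewrite (Ex_perm _ _ _ _ HP Hnd), Ex_app.
rewrite <- (Ex_const qs1 c om Hmu1). apply Ex_le; auto.
intros o _ Ho.
rewrite (Ex_ext _ _ (fun o' => lprod qs2 (fun q => phi o q (o' q)))); auto.
- rewrite Ex_prod by assumption. now apply Hc.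
- intros o' Ho' _. now rewrite (Hdep o o' Ho').
Qed.

Definition Pr (qs : list site) (E : config -> Prop) (om : config) : R :=
  Ex qs (fun o => indic (E o)) om.

Lemma Pr_le_Ex qs E F om :
  law_on qs -> supported om ->
  (forall o, supported o -> 0 <= F o) ->
  (forall o, supported o -> E o -> 1 <= F o) -> Pr qs E om <= Ex qs F om.
Proof.
intros Hmu Hom H0 H1. apply Ex_le; auto. intros o _ Ho. unfold indic.
destruct (excluded_middle_informative (E o)); auto.
Qed.

Lemma Pr_mono qs E E' om :
  law_on qs -> supported om -> (forall o, supported o -> E o -> E' o) ->
  Pr qs E om <= Pr qs E' om.
Proof.
intros Hmu Hom H. apply Ex_le; auto. intros o _ Ho. unfold indic.
specialize (H o Ho).
destruct (excluded_middle_informative (E o)), (excluded_middle_informative (E' o)); try lra.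
tauto.
Qed.

Lemma Pr_or qs E E' om :
  law_on qs -> supported om -> Pr qs (fun o => E o \/ E' o) om <= Pr qs E om + Pr qs E' om.
Proof.
intros Hmu Hom. unfold Pr. rewrite <- Ex_plus. apply Ex_le; auto. intros o _ _. unfold indic.
repeat destruct excluded_middle_informative; try lra. tauto.
Qed.

Lemma Pr_false qs E om : law_on qs -> supported om ->
  (forall o, supported o -> ~ E o) -> Pr qs E om <= 0.
Proof.
intros Hmu Hom H. rewrite <- (Ex_const qs 0 om Hmu). apply Pr_le_Ex; auto.
- intros; lra.
- intros o Ho HE. now destruct (H o Ho).
Qed.

Lemma Pr_union {I} qs (l : list I) (E : I -> config -> Prop) om :
  law_on qs -> supported om ->
  Pr qs (fun o => exists i, In i l /\ E i o) om <= lsum l (fun i => Pr qs (E i) om).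
Proof.
intros Hmu Hom. induction l as [|i l IH].
- apply Pr_false; auto. intros o _ (i & [] & _).
- rewrite lsum_cons. eapply Rle_trans; [|apply Rplus_le_compat_l, IH].
  eapply Rle_trans; [|now apply Pr_or]. apply Pr_mono; auto.
  intros o _ (a & [->|Ha] & HE); eauto.
Qed.

Lemma Pr_compl qs E om : law_on qs -> supported om ->
  Pr qs E om >= 1 - Pr qs (fun o => ~ E o) om.
Proof.
intros Hmu Hom.
assert (H : 1 <= Pr qs E om + Pr qs (fun o => ~ E o) om); [|lra].
unfold Pr. rewrite <- Ex_plus, <- (Ex_const qs 1 om Hmu) at 1. apply Ex_le; auto.
intros o _ _. unfold indic. repeat destruct excluded_middle_informative; try lra. tauto.
Qed.

End Expectation.

(** * Transfer from lists of outcomes to the product space *)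

Definition pair_law (p : R) (w : nat -> R) (q : site) (x : entry) : R :=
  entry_weight p w (fst q) (snd q) x.

Lemma outcomes_Ex L p w qs (G : Omega -> R) om :
  NoDup qs -> supported (entries L) om ->
  lsum (outcomes (length qs) L)
    (fun l => lprod (combine qs l) (fun q => pair_law p w (fst q) (snd q)) * G l) =
  Ex (pair_law p w) (entries L) qs (fun o => G (map o qs)) om.
Proof.
revert G om. induction qs as [|q qs IH]; intros G om Hnd Hom.
- simpl. unfold lsum, lprod. simpl. rewrite Rmult_1_l, Rplus_0_r. reflexivity.
- inversion Hnd as [|? ? Hni Hnd']; subst. cbn [length outcomes Ex].
  rewrite lsum_flat_map. apply lsum_ext. intros x Hx. rewrite lsum_map.
  rewrite (Ex_ext _ _ qs _ (fun o => G (x :: map o qs))).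
  + rewrite <- (IH (fun l => G (x :: l))) by (auto using supported_upd).
    rewrite <- lsum_scal. apply lsum_ext. intros l Hl.
    cbn [combine]. rewrite lprod_cons. cbn [fst snd]. ring.
  + now apply supported_upd.
  + intros o Ho _. cbn [map]. now rewrite (Ho q Hni), upd_same.
Qed.

Lemma in_pairs n i j : In (i, j) (pairs n) <-> (i < j < n)%nat.
Proof.
unfold pairs. rewrite in_flat_map. split.
- intros (a & Ha & H). apply in_map_iff in H. destruct H as (b & E & Hb).
  injection E as -> ->. apply in_seq in Hb. lia.
- intros H. exists i. split; [apply in_seq; lia|]. apply in_map_iff. exists j.
  split; [reflexivity|]. apply in_seq. lia.
Qed.

Lemma NoDup_pairs n : NoDup (pairs n).
Proof.
unfold pairs. assert (H := seq_NoDup n 0). induction H as [|i l Hi H IH]; [constructor|].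
simpl. apply NoDup_app; auto.
- apply FinFun.Injective_map_NoDup; [intros a b E; now injection E|apply seq_NoDup].
- intros [a b] Ha Hb. apply in_map_iff in Ha. destruct Ha as (c & E & _). injection E as -> ->.
  apply in_flat_map in Hb. destruct Hb as (d & Hd & Hb). apply in_map_iff in Hb.
  destruct Hb as (e & E & _). injection E as -> ->. easy.
Qed.

Lemma prob_Pr n L p w E om :
  supported (entries L) om ->
  prob n L p w E =
  Pr (pair_law p w) (entries L) (pairs n) (fun o => E (map o (pairs n))) om.
Proof.
intros Hom. unfold Pr. rewrite <- (outcomes_Ex L p w (pairs n) (fun l => indic (E l)))
  by (auto using NoDup_pairs).
unfold prob. fold (lsum (outcomes (length (pairs n)) L)
  (fun l => if excluded_middle_informative (E l) then weight n p w l else 0)).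
apply lsum_ext. intros l _. unfold indic.
destruct (excluded_middle_informative (E l)); [|ring]. rewrite Rmult_1_r. reflexivity.
Qed.

Lemma lookup_pair_map i j qs (o : config) :
  In (i, j) qs -> lookup_pair i j (combine qs (map o qs)) = Some (o (i, j)).
Proof.
induction qs as [|[a b] qs IH]; [easy|]. intros H. cbn [map combine lookup_pair].
destruct (Nat.eqb_spec a i) as [->|Ha]; destruct (Nat.eqb_spec b j) as [->|Hb];
  [reflexivity| | |]; apply IH; destruct H as [E|E]; congruence.
Qed.

Lemma lookup_pair_map_notin i j qs (o : config) :
  ~ In (i, j) qs -> lookup_pair i j (combine qs (map o qs)) = None.
Proof.
induction qs as [|[a b] qs IH]; [easy|]. intros H. cbn [map combine lookup_pair].
destruct (Nat.eqb_spec a i) as [->|Ha]; destruct (Nat.eqb_spec b j) as [->|Hb];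
  [exfalso; apply H; now left| | |]; apply IH; intros E; apply H; now right.
Qed.

(** * Concentration *)

Lemma exp_INR_mult k a : exp (INR k * a) = exp a ^ k.
Proof.
induction k as [|k IH]; [simpl; rewrite Rmult_0_l; apply exp_0|].
rewrite S_INR. simpl pow. rewrite <- IH, <- exp_plus. f_equal. ring.
Qed.

(** From [1 - x / 2 <= exp (- (x / 2))], squaring gives [exp x <= / (1 - x / 2) ^ 2], which is
    compared with the polynomial. *)
Lemma exp_le_quad x : Rabs x <= / 4 -> exp x <= 1 + x + x ^ 2.
Proof.
intros H. assert (Hx : - / 4 <= x <= / 4) by (revert H; unfold Rabs; destruct Rcase_abs; lra).
assert (H1 : 1 - x / 2 <= exp (- (x / 2))).
{ assert (E := exp_ineq1_le (- (x / 2))). lra. }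
assert (H2 : exp x * (exp (- (x / 2))) ^ 2 = 1).
{ simpl. rewrite Rmult_1_r, <- !exp_plus. replace (x + (- (x / 2) + - (x / 2))) with 0 by field. apply exp_0. }
assert (H3 : (1 - x / 2) ^ 2 <= (exp (- (x / 2))) ^ 2) by (apply pow_incr; lra).
assert (H4 := exp_pos x).
assert (H5 : exp x * (1 - x / 2) ^ 2 <= 1) by (eapply Rle_trans; [apply Rmult_le_compat_l; [lra|exact H3]|lra]).
assert (H6 : 1 <= (1 + x + x ^ 2) * (1 - x / 2) ^ 2).
{ replace ((1 + x + x ^ 2) * (1 - x / 2) ^ 2)
    with (1 + x ^ 2 * (/ 4 - 3 / 4 * x + x ^ 2 / 4)) by field.
  assert (0 <= x ^ 2) by apply pow2_ge_0. nra. }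
apply Rmult_le_reg_r with ((1 - x / 2) ^ 2); [apply pow_lt; lra|]. lra.
Qed.

(** * Moments of an average of independent bits *)

Lemma bitlists_length k ys : In ys (bitlists k) -> length ys = k.
Proof.
revert ys. induction k as [|k IH]; intros ys H; simpl in H.
- destruct H as [<-|[]]. reflexivity.
- rewrite app_nil_r in H. apply in_app_or in H.
  destruct H as [H|H]; apply in_map_iff in H; destruct H as (l & <- & Hl);
    simpl; now rewrite IH.
Qed.

Lemma in_bitlists ys : In ys (bitlists (length ys)).
Proof.
induction ys as [|b ys IH]; [now left|]. cbn [length bitlists]. apply in_flat_map.
exists b. split; [destruct b; simpl; auto|]. now apply in_map.
Qed.

Lemma lsum_bitlists_S k (f : list bool -> R) :
  lsum (bitlists (S k)) f =
  lsum (bitlists k) (fun ys => f (true :: ys)) + lsum (bitlists k) (fun ys => f (false :: ys)).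
Proof.
cbn [bitlists]. rewrite lsum_flat_map. unfold lsum at 1. cbn [map fold_right].
rewrite !lsum_map. ring.
Qed.

Lemma lsum_bitlists_prod k (f : bool -> R) :
  lsum (bitlists k) (fun ys => lprod ys f) = (f true + f false) ^ k.
Proof.
induction k as [|k IH]; [unfold lsum, lprod; simpl; ring|].
rewrite lsum_bitlists_S. simpl pow. rewrite <- IH, Rmult_plus_distr_r, <- !lsum_scal.
reflexivity.
Qed.

Definition bit_weight (q : R) (b : bool) : R := if b then q else 1 - q.

Definition bit_ex (L : nat) (q : R) (g : list bool -> R) : R :=
  lsum (bitlists L) (fun ys => lprod ys (bit_weight q) * g ys).

Lemma bit_ex_prod L q f :
  bit_ex L q (fun ys => lprod ys f) = (q * f true + (1 - q) * f false) ^ L.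
Proof.
unfold bit_ex.
rewrite (lsum_ext _ _ (fun ys => lprod ys (fun b => bit_weight q b * f b))).
- apply lsum_bitlists_prod.
- intros ys _. induction ys as [|b ys IH]; [unfold lprod; simpl; ring|].
  rewrite !lprod_cons, <- IH. ring.
Qed.

Lemma bit_ex_const L q c : bit_ex L q (fun _ => c) = c.
Proof.
unfold bit_ex. rewrite lsum_scal_r.
assert (H := bit_ex_prod L q (fun _ => 1)). unfold bit_ex in H.
rewrite (lsum_ext _ _ (fun ys => lprod ys (bit_weight q))) in H.
- rewrite H. replace (q * 1 + (1 - q) * 1) with 1 by ring. rewrite pow1. ring.
- intros ys _. replace (lprod ys (fun _ => 1)) with 1; [ring|].
  induction ys as [|b ys IH]; [reflexivity|]. rewrite lprod_cons, <- IH. ring.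
Qed.

Lemma bit_ex_ext L q g g' :
  (forall ys, length ys = L -> g ys = g' ys) -> bit_ex L q g = bit_ex L q g'.
Proof.
intros H. apply lsum_ext. intros ys Hys. rewrite H; [reflexivity|]. now apply bitlists_length.
Qed.

Lemma bit_ex_scal L q c g : bit_ex L q (fun ys => c * g ys) = c * bit_ex L q g.
Proof. unfold bit_ex. rewrite <- lsum_scal. apply lsum_ext; intros; ring. Qed.

Lemma bit_ex_minus L q g g' :
  bit_ex L q (fun ys => g ys - g' ys) = bit_ex L q g - bit_ex L q g'.
Proof. unfold bit_ex. rewrite <- lsum_minus. apply lsum_ext; intros; ring. Qed.

Definition ntrue (ys : list bool) : nat := length (filter (fun b : bool => b) ys).

Lemma ntrue_lsum ys : INR (ntrue ys) = lsum ys b2r.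
Proof.
unfold ntrue. induction ys as [|b ys IH]; [reflexivity|]. rewrite lsum_cons, <- IH.
destruct b; simpl filter; cbn [length b2r]; rewrite ?S_INR; lra.
Qed.

Lemma bit_ex_ntrue L q : bit_ex L q (fun ys => INR (ntrue ys)) = INR L * q.
Proof.
induction L as [|L IH]; [unfold bit_ex, lsum, lprod; simpl; ring|].
unfold bit_ex. rewrite lsum_bitlists_S.
rewrite (lsum_ext _ (fun ys => lprod (true :: ys) (bit_weight q) * INR (ntrue (true :: ys)))
  (fun ys => q * (lprod ys (bit_weight q) * 1) + q * (lprod ys (bit_weight q) * INR (ntrue ys)))).
2:{ intros ys _. rewrite lprod_cons, !ntrue_lsum, lsum_cons. simpl. ring. }
rewrite (lsum_ext _ (fun ys => lprod (false :: ys) (bit_weight q) * INR (ntrue (false :: ys)))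
  (fun ys => (1 - q) * (lprod ys (bit_weight q) * INR (ntrue ys)))).
2:{ intros ys _. rewrite lprod_cons, !ntrue_lsum, lsum_cons. simpl. ring. }
rewrite lsum_plus, !lsum_scal.
fold (bit_ex L q (fun _ => 1)). fold (bit_ex L q (fun ys => INR (ntrue ys))).
rewrite bit_ex_const, IH, S_INR. ring.
Qed.

Lemma frac_true_ntrue L ys : frac_true L ys = INR (ntrue ys) / INR L.
Proof. reflexivity. Qed.

Lemma bit_ex_frac L q : (1 <= L)%nat -> bit_ex L q (frac_true L) = q.
Proof.
intros HL. assert (0 < INR L) by (apply lt_0_INR; lia).
rewrite (bit_ex_ext _ _ _ (fun ys => / INR L * INR (ntrue ys)))
  by (intros; rewrite frac_true_ntrue; field; lra).
rewrite bit_ex_scal, bit_ex_ntrue. field. lra.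
Qed.

Lemma frac_true_bound L ys : (1 <= L)%nat -> length ys = L -> 0 <= frac_true L ys <= 1.
Proof.
intros HL Hys. assert (0 < INR L) by (apply lt_0_INR; lia). rewrite frac_true_ntrue.
assert (INR (ntrue ys) <= INR L).
{ apply le_INR. rewrite <- Hys. apply filter_length_le. }
assert (Hp := pos_INR (ntrue ys)). split.
- apply Rmult_le_pos; [assumption|]. now apply Rlt_le, Rinv_0_lt_compat.
- apply Rmult_le_reg_r with (INR L); [assumption|]. field_simplify; lra.
Qed.

(** The bits factorise, and the quadratic bound on [exp] leaves each centred bit a factor at most
    [1 + s ^ 2 * q * (1 - q)]. Keeping the variance [q * (1 - q)] is essential for [noise_mgf]. *)
Lemma bit_ex_mgf L q t : (1 <= L)%nat -> 0 <= q <= 1 -> Rabs t <= INR L / 4 ->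
  bit_ex L q (fun ys => exp (t * (frac_true L ys - q))) <= exp (t ^ 2 * (q * (1 - q)) / INR L).
Proof.
intros HL Hq Ht. assert (HLR : 0 < INR L) by (apply lt_0_INR; lia).
set (s := t / INR L).
assert (Hs : Rabs s <= / 4).
{ unfold s, Rdiv. rewrite Rabs_mult, (Rabs_right (/ INR L)) by (apply Rle_ge, Rlt_le, Rinv_0_lt_compat; lra).
  apply Rmult_le_reg_r with (INR L); [lra|]. rewrite Rmult_assoc, Rinv_l by lra. lra. }
rewrite (bit_ex_ext _ _ _ (fun ys => lprod ys (fun b => exp (s * (b2r b - q))))).
2:{ intros ys Hys. rewrite <- exp_lsum. f_equal. rewrite lsum_scal, lsum_minus, lsum_const, Hys.
    rewrite <- ntrue_lsum, frac_true_ntrue. unfold s. field. lra. }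
rewrite bit_ex_prod.
replace (t ^ 2 * (q * (1 - q)) / INR L) with (INR L * (s ^ 2 * (q * (1 - q))))
  by (unfold s; field; lra).
rewrite exp_INR_mult. apply pow_incr. cbn [b2r]. split.
- assert (H1 := exp_pos (s * (1 - q))). assert (H2 := exp_pos (s * (0 - q))). nra.
- assert (H1 : Rabs (s * (1 - q)) <= / 4).
  { rewrite Rabs_mult, (Rabs_right (1 - q)) by lra. assert (H := Rabs_pos s). nra. }
  assert (H2 : Rabs (s * (0 - q)) <= / 4).
  { rewrite Rabs_mult, Rminus_0_l, Rabs_Ropp, (Rabs_right q) by lra. assert (H := Rabs_pos s). nra. }
  apply exp_le_quad in H1. apply exp_le_quad in H2.
  apply Rle_trans with (1 + s ^ 2 * (q * (1 - q))); [nra|].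
  apply exp_ineq1_le.
Qed.

Lemma entries_length L x : In x (entries L) -> length (snd x) = L.
Proof.
unfold entries. intros H. apply in_flat_map in H. destruct H as (e & _ & H).
apply in_map_iff in H. destruct H as (ys & <- & H). now apply bitlists_length.
Qed.

Lemma supported_default L : supported (entries L) (fun _ => (false, repeat true L)).
Proof.
intros q. unfold entries. apply in_flat_map. exists false. split; [simpl; auto|].
apply in_map. assert (H := in_bitlists (repeat true L)). now rewrite repeat_length in H.
Qed.

(** * Rates as functions of single coordinates, and the row of a vertex *)

Definition pr (i j : nat) : site := if Nat.ltb i j then (i, j) else (j, i).

Lemma pr_sym i j : pr i j = pr j i.
Proof.
unfold pr. destruct (Nat.ltb_spec i j), (Nat.ltb_spec j i); auto; try lia.
replace j with i by lia. reflexivity.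
Qed.

Definition entry_rate (L i j : nat) (x : entry) : R :=
  if fst x then (if Nat.ltb i j then frac_true L (snd x) else 1 - frac_true L (snd x)) else 0.

Lemma entry_rate_bound L i j x : (1 <= L)%nat -> In x (entries L) ->
  0 <= entry_rate L i j x <= b2r (fst x).
Proof.
intros HL Hx. apply entries_length in Hx.
assert (H := frac_true_bound L (snd x) HL Hx). unfold entry_rate.
destruct (fst x), (Nat.ltb i j); simpl; lra.
Qed.

Lemma entry_rate_sum L i j x : i <> j ->
  entry_rate L i j x + entry_rate L j i x = b2r (fst x).
Proof.
intros Hij. unfold entry_rate. destruct (fst x); simpl; [|lra].
destruct (Nat.ltb_spec i j), (Nat.ltb_spec j i); try lia; lra.
Qed.

Lemma rates_map n L (o : config) i j :
  rates n L (map o (pairs n)) i j =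
  if (Nat.ltb i n && Nat.ltb j n && negb (Nat.eqb i j))%bool
  then entry_rate L i j (o (pr i j)) else 0.
Proof.
unfold rates, edge, ybar, obs, entry_rate, pr.
destruct (Nat.ltb_spec i n) as [Hi|Hi], (Nat.ltb_spec j n) as [Hj|Hj],
  (Nat.ltb_spec i j) as [Hij|Hij], (Nat.ltb_spec j i) as [Hji|Hji],
  (Nat.eqb_spec i j) as [Heq|Heq]; cbn [andb negb]; try lia; try reflexivity;
  try (rewrite lookup_pair_map by (apply in_pairs; lia); reflexivity);
  rewrite lookup_pair_map_notin by (rewrite in_pairs; lia); reflexivity.
Qed.

Lemma rates_bound n L o : (1 <= L)%nat -> supported (entries L) o ->
  forall i j, 0 <= rates n L (map o (pairs n)) i j <= 1.
Proof.
intros HL Ho i j. rewrite rates_map. destruct (_ && _ && _)%bool; [|lra].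
assert (H := entry_rate_bound L i j (o (pr i j)) HL (Ho _)).
destruct (fst (o (pr i j))); simpl in H; lra.
Qed.

Lemma rates_row n L o v j : (v < n)%nat -> (j < n)%nat ->
  rates n L (map o (pairs n)) v j = if Nat.eqb j v then 0 else entry_rate L v j (o (pr v j)).
Proof.
intros Hv Hj. rewrite rates_map, (Nat.eqb_sym j v).
apply Nat.ltb_lt in Hv, Hj. rewrite Hv, Hj. cbn [andb]. destruct (Nat.eqb v j); reflexivity.
Qed.

Lemma rates_col n L o v j : (v < n)%nat -> (j < n)%nat ->
  rates n L (map o (pairs n)) j v = if Nat.eqb j v then 0 else entry_rate L j v (o (pr v j)).
Proof.
intros Hv Hj. rewrite rates_map, (pr_sym v j).
apply Nat.ltb_lt in Hv, Hj. rewrite Hv, Hj. cbn [andb]. destruct (Nat.eqb j v); reflexivity.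
Qed.

(** [row] collects the coordinates that involve [v] and [off_row] the rest: the split used to
    condition on everything except the comparisons of [v]. *)
Definition row (n v : nat) : list site :=
  map (pr v) (filter (fun j => negb (Nat.eqb j v)) (seq 0 n)).

Definition off_row (n v : nat) : list site :=
  filter (fun q => negb (Nat.eqb (fst q) v || Nat.eqb (snd q) v)) (pairs n).

Definition other (v : nat) (q : site) : nat := if Nat.eqb (fst q) v then snd q else fst q.

Lemma other_pr v j : other v (pr v j) = j.
Proof.
unfold other, pr. destruct (Nat.ltb_spec v j); cbn [fst snd].
- now rewrite Nat.eqb_refl.
- destruct (Nat.eqb_spec j v); congruence.
Qed.

Lemma in_row n v q : In q (row n v) <-> exists j, (j < n)%nat /\ j <> v /\ q = pr v j.
Proof.
unfold row. rewrite in_map_iff. split.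
- intros (j & <- & H). apply filter_In in H. destruct H as [H1 H2]. exists j.
  split; [now apply in_seq0|]. split; [|reflexivity].
  destruct (Nat.eqb_spec j v); [discriminate|assumption].
- intros (j & H1 & H2 & ->). exists j. split; [reflexivity|]. apply filter_In.
  split; [now apply in_seq0|]. destruct (Nat.eqb_spec j v); [easy|reflexivity].
Qed.

Lemma NoDup_row n v : NoDup (row n v).
Proof.
apply (NoDup_map_inv (other v)). unfold row. rewrite map_map.
rewrite (map_ext _ (fun j => j)) by (intros; apply other_pr). rewrite map_id.
apply NoDup_filter, seq_NoDup.
Qed.

Lemma pairs_row_perm n v : (v < n)%nat -> Permutation (pairs n) (off_row n v ++ row n v).
Proof.
intros Hv. apply NoDup_Permutation.
- apply NoDup_pairs.
- apply NoDup_app.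
  + apply NoDup_filter, NoDup_pairs.
  + apply NoDup_row.
  + intros q Hq Hr. apply filter_In in Hq. destruct Hq as [_ Hq].
    apply in_row in Hr. destruct Hr as (j & _ & _ & ->). unfold pr in Hq.
    destruct (Nat.ltb v j); cbn [fst snd] in Hq;
      rewrite Nat.eqb_refl, ?Bool.orb_true_r in Hq; discriminate.
- intros [a b]. rewrite in_app_iff, in_row. unfold off_row. rewrite filter_In. cbn [fst snd].
  rewrite in_pairs. split.
  + intros H. destruct (Nat.eqb_spec a v) as [->|Ha]; [|destruct (Nat.eqb_spec b v) as [->|Hb]].
    * right. exists b. split; [lia|]. split; [lia|]. unfold pr.
      destruct (Nat.ltb_spec v b); [reflexivity|lia].
    * right. exists a. split; [lia|]. split; [lia|]. unfold pr.
      destruct (Nat.ltb_spec v a); [lia|reflexivity].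
    * left. now split.
  + intros [[H _]|(j & H1 & H2 & E)]; [assumption|]. unfold pr in E.
    destruct (Nat.ltb_spec v j); injection E as -> ->; lia.
Qed.

Lemma lsum_row n v f :
  lsum (row n v) f = fsum n (fun j => if Nat.eqb j v then 0 else f (pr v j)).
Proof.
unfold row. rewrite lsum_map, fsum_lsum. induction (seq 0 n) as [|a l IH]; [reflexivity|].
rewrite lsum_cons, <- IH. simpl filter. destruct (Nat.eqb a v); simpl negb; cbv iota.
- lra.
- now rewrite lsum_cons.
Qed.

Lemma entry_ex L p w q F :
  lsum (entries L) (fun x => pair_law p w q x * F x) =
  p * bit_ex L (ystar w (fst q) (snd q)) (fun ys => F (true, ys))
  + (1 - p) * bit_ex L (ystar w (fst q) (snd q)) (fun ys => F (false, ys)).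
Proof.
unfold entries. rewrite lsum_flat_map. unfold lsum at 1. cbn [map fold_right].
rewrite !lsum_map. unfold bit_ex. rewrite Rplus_0_r, <- !lsum_scal.
f_equal; apply lsum_ext; intros ys _; unfold pair_law, entry_weight; cbn [fst snd].
- fold (lprod ys (bit_weight (ystar w (fst q) (snd q)))). unfold bit_weight, lprod. ring.
- unfold bit_weight, lprod. ring.
Qed.

Lemma dsum_pairs m g :
  (forall i j, (i < m)%nat -> (j < m)%nat -> g i j = g j i) ->
  (forall i, (i < m)%nat -> g i i = 0) ->
  dsum m g = 2 * lsum (pairs m) (fun q => g (fst q) (snd q)).
Proof.
intros Hsym Hdiag.
assert (HP : lsum (pairs m) (fun q => g (fst q) (snd q)) =
             dsum m (fun i j => if Nat.ltb i j then g i j else 0)).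
{ unfold pairs. rewrite lsum_flat_map. apply lsum_ext. intros i Hi. apply in_seq0 in Hi.
  rewrite lsum_map. cbn [fst snd]. rewrite fsum_lsum.
  replace (seq 0 m) with (seq 0 (S i) ++ seq (S i) (m - S i))
    by (rewrite <- seq_app; f_equal; lia).
  rewrite lsum_app, (lsum_0 (seq 0 (S i))).
  - rewrite Rplus_0_l. apply lsum_ext. intros j Hj. apply in_seq in Hj.
    destruct (Nat.ltb_spec i j); [reflexivity|lia].
  - intros j Hj. apply in_seq in Hj. destruct (Nat.ltb_spec i j); [lia|reflexivity]. }
rewrite HP.
rewrite (dsum_ext m g (fun i j => (if Nat.ltb i j then g i j else 0) + (if Nat.ltb j i then g j i else 0))).
- rewrite dsum_plus, (dsum_swap m (fun i j => if Nat.ltb j i then g j i else 0)). ring.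
- intros i j Hi Hj. destruct (Nat.ltb_spec i j), (Nat.ltb_spec j i); try lia; try lra.
  + rewrite Hsym by assumption. ring.
  + replace j with i by lia. rewrite Hdiag by assumption. ring.
Qed.

(** Vertex subsets are coded by bit lists, so that the union bound ranges over the finite list
    [bitlists n]. *)
Definition list_chi (l : list bool) (i : nat) : bool := nth i l false.

Lemma card_list_chi l : card (length l) (list_chi l) = ntrue l.
Proof.
apply INR_eq. rewrite card_fsum, ntrue_lsum, fsum_lsum. unfold list_chi.
rewrite <- (lsum_map (fun i => nth i l false) (seq 0 (length l)) b2r). f_equal.
apply nth_ext with (d := false) (d' := false).
- now rewrite length_map, length_seq.
- intros i Hi. rewrite length_map, length_seq in Hi.
  rewrite (nth_indep _ _ (nth 0 l false)) by (now rewrite length_map, length_seq).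
  rewrite (map_nth (fun i => nth i l false)). now rewrite seq_nth.
Qed.

Lemma pr_in_pairs n i j : (i < n)%nat -> (j < n)%nat -> i <> j -> In (pr i j) (pairs n).
Proof.
intros Hi Hj Hij. unfold pr. destruct (Nat.ltb_spec i j); apply in_pairs; lia.
Qed.

(** * Tail bounds for rows, edges and cuts *)

Section Concentration.

Variables (n L : nat) (p : R) (w : nat -> R).
Hypothesis L_ge1 : (1 <= L)%nat.
Hypothesis p_pos : 0 < p.
Hypothesis p_le1 : p <= 1.
Hypothesis w_pos : forall i, (i < n)%nat -> 0 < w i.

Let law := pair_law p w.
Let sup := entries L.

Lemma ystar_bound i j : (i < n)%nat -> (j < n)%nat -> 0 <= ystar w i j <= 1.
Proof.
intros Hi Hj. unfold ystar. assert (H1 := w_pos i Hi). assert (H2 := w_pos j Hj). split.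
- apply Rlt_le, Rdiv_lt_0_compat; lra.
- apply Rmult_le_reg_r with (w i + w j); [lra|]. field_simplify; lra.
Qed.

Lemma law_on_pairs : law_on law sup (pairs n).
Proof.
intros [i j] Hq. apply in_pairs in Hq.
assert (Hy := ystar_bound i j ltac:(lia) ltac:(lia)). split.
- intros x _. unfold law, pair_law, entry_weight. cbn [fst snd]. apply Rmult_le_pos.
  + destruct (fst x); lra.
  + fold (lprod (snd x) (fun y : bool => if y then ystar w i j else 1 - ystar w i j)).
    apply lprod_nonneg. intros [|] _; lra.
- rewrite (lsum_ext _ _ (fun x => pair_law p w (i, j) x * 1)) by (intros; unfold law; ring).
  unfold sup. rewrite entry_ex, !bit_ex_const. ring.
Qed.

Lemma entry_ex_edge q : lsum sup (fun x => law q x * b2r (fst x)) = p.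
Proof. unfold sup, law. rewrite entry_ex. cbn [fst b2r]. rewrite !bit_ex_const. ring. Qed.

Lemma entry_ex_rate i j : (i < n)%nat -> (j < n)%nat -> i <> j ->
  lsum sup (fun x => law (pr i j) x * entry_rate L i j x) = p * kbar w i j.
Proof.
intros Hi Hj Hij. unfold sup, law. rewrite entry_ex. unfold entry_rate. cbn [fst snd].
rewrite bit_ex_const. unfold kbar. destruct (Nat.eqb_spec i j); [easy|].
assert (H1 := w_pos i Hi). assert (H2 := w_pos j Hj).
unfold pr. destruct (Nat.ltb i j); cbn [fst snd].
- rewrite bit_ex_frac by assumption. unfold ystar. ring.
- rewrite bit_ex_minus, bit_ex_const, bit_ex_frac by assumption. unfold ystar. field. lra.
Qed.

(** Exponential Markov inequality for a sum over the edges at [v]. The summands may depend on the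
    rest of the configuration: conditionally on it they are independent, and the bound on each
    factor is uniform. *)
Lemma row_chernoff v (g : config -> nat -> entry -> R) (V : nat -> R) (a t : R) om :
  (v < n)%nat -> supported sup om ->
  (forall o o', agree_off (row n v) o o' -> g o' = g o) ->
  (forall o j, supported sup o -> (j < n)%nat -> j <> v ->
     lsum sup (fun x => law (pr v j) x * exp (g o j x)) <= exp (V j)) ->
  fsum n (fun j => if Nat.eqb j v then 0 else V j) <= a ->
  Pr law sup (pairs n)
    (fun o => t < fsum n (fun j => if Nat.eqb j v then 0 else g o j (o (pr v j)))) om
  <= exp (a - t).
Proof.
intros Hv Hom Hdep Hmgf Ha.
set (phi := fun (o : config) (q : site) (x : entry) => exp (g o (other v q) x)).
apply Rle_trans with
  (Ex law sup (pairs n) (fun o => exp (- t) * lprod (row n v) (fun q => phi o q (o q))) om).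
- assert (HE : forall o, exp (- t) * lprod (row n v) (fun q => phi o q (o q)) =
    exp (fsum n (fun j => if Nat.eqb j v then 0 else g o j (o (pr v j))) - t)).
  { intros o. unfold phi. rewrite <- exp_lsum, lsum_row, <- exp_plus. f_equal.
    rewrite (fsum_ext n _ (fun j => if Nat.eqb j v then 0 else g o j (o (pr v j))))
      by (intros; now rewrite other_pr). ring. }
  apply Pr_le_Ex; auto using law_on_pairs; intros o _; rewrite HE.
  + apply Rlt_le, exp_pos.
  + intros H. assert (H' := exp_ineq1_le (fsum n (fun j => if Nat.eqb j v then 0 else g o j (o (pr v j))) - t)).
    lra.
- rewrite Ex_scal. replace (a - t) with (- t + a) by ring. rewrite exp_plus.
  apply Rmult_le_compat_l; [apply Rlt_le, exp_pos|].
  apply (Ex_cond_prod_le law sup (pairs n) (off_row n v)); auto using pairs_row_perm, NoDup_pairs, law_on_pairs.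
  + intros o o' H. unfold phi. now rewrite (Hdep o o' H).
  + intros o Ho. apply Rle_trans with (lprod (row n v) (fun q => exp (V (other v q)))).
    * apply lprod_le. intros q Hq. apply in_row in Hq. destruct Hq as (j & Hj & Hjv & ->).
      unfold phi. rewrite other_pr. split; [|now apply Hmgf].
      apply lsum_nonneg. intros x Hx. apply Rmult_le_pos; [|apply Rlt_le, exp_pos].
      apply law_on_pairs; auto. apply pr_in_pairs; auto.
    * rewrite <- exp_lsum, lsum_row.
      rewrite (fsum_ext n _ (fun j => if Nat.eqb j v then 0 else V j))
        by (intros; now rewrite other_pr).
      destruct Ha as [Ha|Ha]; [left; now apply exp_increasing|right; now rewrite Ha].
Qed.

Variable ell : R.
Hypothesis ell_ge1 : 1 <= ell.
Hypothesis ell_small : 16 * ell <= INR n * p.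

(** A summand dominated by the edge indicator has second moment at most [p]. The parameter
    [s = sqrt (ell / r)] makes the total exponent [s ^ 2 * r = ell], against a threshold of
    [8 * ell]. *)
Lemma row_deviation v (h : config -> nat -> entry -> R) (m : config -> nat -> R) om :
  (v < n)%nat -> supported sup om ->
  (forall o o', agree_off (row n v) o o' -> h o' = h o /\ m o' = m o) ->
  (forall o j x, supported sup o -> (j < n)%nat -> In x sup -> Rabs (h o j x) <= b2r (fst x)) ->
  (forall o j, supported sup o -> (j < n)%nat -> j <> v ->
     lsum sup (fun x => law (pr v j) x * h o j x) = m o j) ->
  Pr law sup (pairs n)
    (fun o => 8 * sqrt (INR n * p * ell) <
       fsum n (fun j => if Nat.eqb j v then 0 else h o j (o (pr v j)) - m o j)) om
  <= exp (- (7 * ell)).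
Proof.
intros Hv Hom Hdep Hh Hm.
set (r := INR n * p) in *. assert (Hr : 0 < r) by lra.
set (s := sqrt (ell / r)).
assert (Hlr : 0 < ell / r) by (apply Rdiv_lt_0_compat; lra).
assert (Hs : 0 < s) by now apply sqrt_lt_R0.
assert (Hs2 : s ^ 2 * r = ell) by (unfold s; rewrite pow2_sqrt by lra; field; lra).
assert (Hs16 : s ^ 2 <= / 16) by (apply Rmult_le_reg_r with r; lra).
assert (Hs4 : s <= / 4) by nra.
assert (Hsr : sqrt (r * ell) = s * r).
{ rewrite <- Hs2. replace (r * (s ^ 2 * r)) with ((s * r) ^ 2) by ring. apply sqrt_pow2. nra. }
replace (- (7 * ell)) with (ell - 8 * ell) by ring.
eapply Rle_trans; [|apply (row_chernoff v (fun o j x => s * (h o j x - m o j))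
  (fun _ => s ^ 2 * p) ell (8 * ell) om)]; auto.
- apply Pr_mono; auto using law_on_pairs. intros o _ H. rewrite Hsr in H.
  rewrite (fsum_ext n _ (fun j => s * (if Nat.eqb j v then 0 else h o j (o (pr v j)) - m o j)))
    by (intros j _; destruct (Nat.eqb j v); ring).
  rewrite fsum_scal. rewrite <- Hs2. nra.
- intros o o' H. destruct (Hdep o o' H) as [-> ->]. reflexivity.
- intros o j Ho Hj Hjv.
  assert (Hpr := pr_in_pairs n v j Hv Hj ltac:(auto)).
  assert (Hmu := law_on_pairs _ Hpr).
  assert (H1 : lsum sup (fun x => law (pr v j) x * exp (s * h o j x)) <= exp (s * m o j + s ^ 2 * p)).
  { apply Rle_trans with
      (lsum sup (fun x => law (pr v j) x * 1 + s * (law (pr v j) x * h o j x)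
                          + s ^ 2 * (law (pr v j) x * b2r (fst x)))).
    - apply lsum_le. intros x Hx.
      apply Rle_trans with (law (pr v j) x * (1 + s * h o j x + s ^ 2 * b2r (fst x))); [|lra].
      apply Rmult_le_compat_l; [now apply Hmu|].
      assert (Hb := Hh o j x Ho Hj Hx).
      assert (Hb1 : 0 <= b2r (fst x) <= 1) by (destruct (fst x); simpl; lra).
      eapply Rle_trans; [apply exp_le_quad|].
      + rewrite Rabs_mult, (Rabs_right s) by lra. assert (Ha := Rabs_pos (h o j x)). nra.
      + rewrite Rpow_mult_distr. assert (h o j x ^ 2 <= b2r (fst x)).
        { rewrite <- pow2_abs. assert (Ha := Rabs_pos (h o j x)). nra. }
        assert (0 <= s ^ 2) by apply pow2_ge_0. nra.
    - rewrite !lsum_plus, !lsum_scal, Hm, entry_ex_edge by assumption.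
      rewrite (lsum_ext _ (fun x => law (pr v j) x * 1) (law (pr v j))) by (intros; ring).
      destruct Hmu as [_ ->]. assert (H := exp_ineq1_le (s * m o j + s ^ 2 * p)). lra. }
  rewrite (lsum_ext _ _ (fun x => exp (- (s * m o j)) * (law (pr v j) x * exp (s * h o j x)))).
  + rewrite lsum_scal. replace (s ^ 2 * p) with (- (s * m o j) + (s * m o j + s ^ 2 * p)) by ring.
    rewrite exp_plus. apply Rmult_le_compat_l; [apply Rlt_le, exp_pos|exact H1].
  + intros x _. replace (s * (h o j x - m o j)) with (- (s * m o j) + s * h o j x) by ring.
    rewrite exp_plus. ring.
- apply Rle_trans with (fsum n (fun _ => s ^ 2 * p)).
  + apply fsum_le. intros j _. assert (0 <= s ^ 2 * p) by nra. destruct (Nat.eqb j v); lra.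
  + rewrite fsum_const. rewrite <- Hs2. unfold r. right. ring.
Qed.

(** The noise on an edge is [w i + w j] times a centred average with success probability
    [w j / (w i + w j)], so in its variance the square of the sum cancels and [w i * w j / L]
    remains. *)
Lemma noise_mgf i j s : (i < n)%nat -> (j < n)%nat -> i <> j ->
  w i <= 1 -> w j <= 1 -> Rabs s <= INR L / 8 ->
  lsum sup (fun x => law (pr i j) x * exp (s * (w i * entry_rate L i j x - w j * entry_rate L j i x)))
  <= p * exp (s ^ 2 * (w i * w j) / INR L) + (1 - p).
Proof.
intros Hi Hj Hij Hwi Hwj Hs. unfold sup, law. rewrite entry_ex.
assert (HLR : 0 < INR L) by (apply lt_0_INR; lia).
assert (H1 := w_pos i Hi). assert (H2 := w_pos j Hj).
apply Rplus_le_compat.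
2:{ unfold entry_rate. cbn [fst]. rewrite (bit_ex_ext _ _ _ (fun _ => 1)), bit_ex_const; [lra|].
    intros. rewrite !Rmult_0_r, Rminus_0_r, Rmult_0_r. apply exp_0. }
apply Rmult_le_compat_l; [lra|].
assert (Hc : forall t, (t = s \/ t = - s) -> Rabs (t * (w i + w j)) <= INR L / 4).
{ intros t Ht. rewrite Rabs_mult, (Rabs_right (w i + w j)) by lra.
  replace (Rabs t) with (Rabs s) by (destruct Ht as [->| ->]; now rewrite ?Rabs_Ropp).
  assert (H := Rabs_pos s). nra. }
unfold entry_rate, pr. cbn [fst snd].
destruct (Nat.ltb_spec i j) as [Hlt|Hlt], (Nat.ltb_spec j i) as [Hlt'|Hlt']; try lia; cbn [fst snd].
- set (y := ystar w i j). assert (Hy : 0 <= y <= 1) by now apply ystar_bound.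
  rewrite (bit_ex_ext _ _ _ (fun ys => exp (s * (w i + w j) * (frac_true L ys - y)))).
  + eapply Rle_trans; [apply bit_ex_mgf; auto|]. right. f_equal. unfold y, ystar. field. lra.
  + intros ys _. f_equal. unfold y, ystar. field. lra.
- set (y := ystar w j i). assert (Hy : 0 <= y <= 1) by now apply ystar_bound.
  rewrite (bit_ex_ext _ _ _ (fun ys => exp (- s * (w i + w j) * (frac_true L ys - y)))).
  + eapply Rle_trans; [apply bit_ex_mgf; auto|]. right. f_equal. unfold y, ystar. field. lra.
  + intros ys _. f_equal. unfold y, ystar. field. lra.
Qed.


Variable kap : R.
Hypothesis kap_ge1 : 1 <= kap.
Hypothesis w_le1 : forall i, (i < n)%nat -> w i <= 1.
Hypothesis w_lb : forall i, (i < n)%nat -> 1 <= kap * w i.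
Hypothesis ell_kap : 64 * kap ^ 2 * ell <= INR n * p.

(** This keeps the optimal exponent of [row_noise] in the range where the quadratic bound on [exp]
    is valid. One factor [kap] is paid for the total weight and one for [w v]. *)
Lemma fsum_kap v : (v < n)%nat ->
  64 * ell <= p * fsum n w * w v /\ 64 * ell <= p * fsum n w.
Proof.
intros Hv. assert (H1 := w_lb v Hv). assert (H2 := w_pos v Hv).
assert (HU : INR n <= kap * fsum n w).
{ replace (INR n) with (fsum n (fun _ => 1)) by (rewrite fsum_const; lra).
  rewrite <- fsum_scal. now apply fsum_le. }
assert (Hk2 : 0 < kap ^ 2) by (apply pow_lt; lra).
assert (HU0 : 0 <= fsum n w) by (apply fsum_nonneg; intros; now apply Rlt_le, w_pos).
assert (H3 : 64 * ell <= p * fsum n w * w v).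
{ apply Rmult_le_reg_l with (kap ^ 2); [assumption|].
  apply Rle_trans with (INR n * p); [lra|].
  replace (kap ^ 2 * (p * fsum n w * w v)) with (p * (kap * fsum n w) * (kap * w v)) by ring.
  assert (0 <= INR n) by apply pos_INR.
  apply Rle_trans with (p * (kap * fsum n w) * 1); [nra|].
  apply Rmult_le_compat_l; [|assumption]. apply Rmult_le_pos; nra. }
split; [assumption|]. assert (H4 := w_le1 v Hv).
assert (0 <= p * fsum n w) by (apply Rmult_le_pos; lra). nra.
Qed.

(** Bernstein bound at the true variance [V = P * w v / L]: with [s = sqrt (ell / V)] the exponent
    is at most [2 * ell] and the threshold [9 * ell]. The sign [sg] gives both tails. *)
Lemma row_noise v sg om : (v < n)%nat -> supported sup om -> sg = 1 \/ sg = -1 ->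
  Pr law sup (pairs n)
    (fun o => 9 * sqrt (ell * (/ sqrt (INR L)) ^ 2 * (p * fsum n w) * w v) <
       fsum n (fun j => if Nat.eqb j v then 0 else
         sg * (w v * entry_rate L v j (o (pr v j)) - w j * entry_rate L j v (o (pr v j))))) om
  <= exp (- (7 * ell)).
Proof.
intros Hv Hom Hsg. assert (HLR : 1 <= INR L).
{ replace 1 with (INR 1) by reflexivity. now apply le_INR. }
destruct (fsum_kap v Hv) as [HP1 HP2]. set (P := p * fsum n w) in *.
assert (Hwv := w_pos v Hv). assert (Hwv1 := w_le1 v Hv).
replace ((/ sqrt (INR L)) ^ 2) with (/ INR L) by (rewrite pow_inv, pow2_sqrt; lra).
assert (HPw : 0 < P * w v) by lra.
assert (Hq : 0 < ell * INR L / (P * w v)) by (apply Rdiv_lt_0_compat; [nra|lra]).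
set (s := sqrt (ell * INR L / (P * w v))).
assert (Hs : 0 < s) by now apply sqrt_lt_R0.
assert (Hs2 : s ^ 2 * (P * w v) / INR L = ell) by (unfold s; rewrite pow2_sqrt by lra; field; lra).
assert (Hs2' : s ^ 2 * (P * w v) = ell * INR L) by (rewrite <- Hs2 at 1; field; lra).
assert (HsL : s <= INR L / 8).
{ assert (s ^ 2 <= INR L / 64).
  { apply Rmult_le_reg_r with (P * w v); [lra|]. rewrite Hs2'. nra. }
  assert (s ^ 2 <= (INR L / 8) ^ 2) by nra.
  rewrite <- (Rabs_right s) by lra. apply sq_le_abs; lra. }
assert (Hdev : sqrt (ell * / INR L * P * w v) = ell / s).
{ replace (ell * / INR L * P * w v) with ((ell / s) ^ 2).
  - apply sqrt_pow2. apply Rlt_le, Rdiv_lt_0_compat; lra.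
  - replace ((ell / s) ^ 2) with (ell * (ell / s ^ 2)) by (field; lra).
    rewrite <- Hs2 at 2. field. lra. }
rewrite Hdev.
replace (- (7 * ell)) with (2 * ell - 9 * ell) by ring.
eapply Rle_trans; [|apply (row_chernoff v
  (fun o j x => (sg * s) * (w v * entry_rate L v j x - w j * entry_rate L j v x))
  (fun j => 2 * p * (s ^ 2 * (w v * w j) / INR L)) (2 * ell) (9 * ell) om)]; auto.
- apply Pr_mono; auto using law_on_pairs. intros o _ H.
  rewrite (fsum_ext n _ (fun j => s * (if Nat.eqb j v then 0 else
    sg * (w v * entry_rate L v j (o (pr v j)) - w j * entry_rate L j v (o (pr v j))))))
    by (intros j _; destruct (Nat.eqb j v); ring).
  rewrite fsum_scal. apply Rmult_lt_compat_l with (r := s) in H; [|assumption].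
  replace (s * (9 * (ell / s))) with (9 * ell) in H by (field; lra). exact H.
- intros o j Ho Hj Hjv. assert (Hwj := w_pos j Hj). assert (Hwj1 := w_le1 j Hj).
  eapply Rle_trans; [apply noise_mgf; auto|].
  + rewrite Rabs_mult, (Rabs_right s) by lra.
    replace (Rabs sg) with 1 by (destruct Hsg as [->| ->]; unfold Rabs; destruct Rcase_abs; lra). lra.
  + replace ((sg * s) ^ 2) with (s ^ 2) by (destruct Hsg as [->| ->]; ring).
    set (x := s ^ 2 * (w v * w j) / INR L).
    assert (Hx0 : 0 <= x).
    { unfold x. apply Rlt_le, Rdiv_lt_0_compat; [|lra].
      apply Rmult_lt_0_compat; [now apply pow_lt|]. now apply Rmult_lt_0_compat. }
    assert (Hx1 : x <= / 4).
    { apply Rmult_le_reg_r with P; [lra|].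
      replace (x * P) with (s ^ 2 * (P * w v) / INR L * w j) by (unfold x; field; lra).
      rewrite Hs2. nra. }
    (* For [x] at most 1/4, [exp x - 1 <= 2 * x], which passes the edge probability [p] into the
       exponent at the price of a factor 2. *)
    assert (He : exp x <= 1 + x + x ^ 2) by (apply exp_le_quad; rewrite Rabs_right; lra).
    assert (He' := exp_ineq1_le (2 * p * x)). assert (He2 : exp x - 1 <= 2 * x) by nra.
    assert (He3 : p * (exp x - 1) <= p * (2 * x)) by (apply Rmult_le_compat_l; lra).
    apply Rle_trans with (1 + 2 * p * x); lra.
- apply Rle_trans with (fsum n (fun j => 2 * p * (s ^ 2 * w v) / INR L * w j)).
  + apply fsum_le. intros j Hj. assert (Hwj := w_pos j Hj). destruct (Nat.eqb j v).
    * apply Rmult_le_pos; [|lra]. apply Rlt_le, Rdiv_lt_0_compat; [|lra].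
      assert (0 < s ^ 2) by now apply pow_lt. assert (0 < s ^ 2 * w v) by nra. nra.
    * right. field. lra.
  + rewrite fsum_scal. right. rewrite <- Hs2. unfold P. field. lra.
Qed.

(** If [L >= 64 * ell], this is a Chernoff bound with all other summands of the row set to 0.
    Otherwise the threshold is at least 18/8, above any value the noise can take. *)
Lemma edge_noise v j0 om : (v < n)%nat -> (j0 < n)%nat -> supported sup om ->
  Pr law sup (pairs n)
    (fun o => j0 <> v /\ 18 * sqrt (ell * (/ sqrt (INR L)) ^ 2) <
       w v * entry_rate L v j0 (o (pr v j0)) - w j0 * entry_rate L j0 v (o (pr v j0))) om
  <= exp (- (17 * ell)).
Proof.
intros Hv Hj0 Hom. assert (HLR : 1 <= INR L).
{ replace 1 with (INR 1) by reflexivity. now apply le_INR. }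
replace ((/ sqrt (INR L)) ^ 2) with (/ INR L) by (rewrite pow_inv, pow2_sqrt; lra).
assert (Hwv := w_pos v Hv). assert (Hwv1 := w_le1 v Hv).
assert (Hwj := w_pos j0 Hj0). assert (Hwj1 := w_le1 j0 Hj0).
destruct (Rle_dec (64 * ell) (INR L)) as [HlL|HlL].
- assert (HLl : 0 < INR L * ell) by (apply Rmult_lt_0_compat; lra).
  set (s := sqrt (INR L * ell)).
  assert (Hs : 0 < s) by now apply sqrt_lt_R0.
  assert (Hs2 : s ^ 2 = INR L * ell) by (unfold s; rewrite pow2_sqrt by lra; ring).
  assert (HsL : s <= INR L / 8).
  { rewrite <- (Rabs_right s) by lra. apply sq_le_abs; [lra|]. rewrite Hs2. nra. }
  assert (Hdev : sqrt (ell * / INR L) = ell / s).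
  { replace (ell * / INR L) with ((ell / s) ^ 2).
    - apply sqrt_pow2. apply Rlt_le, Rdiv_lt_0_compat; lra.
    - replace ((ell / s) ^ 2) with (ell * ell / s ^ 2) by (field; lra). rewrite Hs2. field. lra. }
  rewrite Hdev. replace (- (17 * ell)) with (ell - 18 * ell) by ring.
  eapply Rle_trans; [|apply (row_chernoff v
    (fun o j x => if Nat.eqb j j0 then s * (w v * entry_rate L v j x - w j * entry_rate L j v x) else 0)
    (fun j => if Nat.eqb j j0 then ell else 0) ell (18 * ell) om)]; auto.
  + apply Pr_mono; auto using law_on_pairs. intros o _ [Hne H].
    rewrite (fsum_ext n _ (fun j => if Nat.eqb j j0 then
      s * (w v * entry_rate L v j0 (o (pr v j0)) - w j0 * entry_rate L j0 v (o (pr v j0))) else 0)).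
    * rewrite fsum_delta by assumption.
      apply Rmult_lt_compat_l with (r := s) in H; [|assumption].
      replace (s * (18 * (ell / s))) with (18 * ell) in H by (field; lra). exact H.
    * intros j _. destruct (Nat.eqb_spec j j0) as [->|]; destruct (Nat.eqb_spec j0 v); try easy;
        destruct (Nat.eqb j v); reflexivity.
  + intros o j Ho Hj Hjv. destruct (Nat.eqb_spec j j0) as [->|_].
    * eapply Rle_trans; [apply noise_mgf; auto; rewrite Rabs_right; lra|].
      replace (s ^ 2 * (w v * w j0) / INR L) with (ell * (w v * w j0)) by (rewrite Hs2; field; lra).
      assert (H1 : exp (ell * (w v * w j0)) <= exp ell).
      { assert (H : ell * (w v * w j0) <= ell) by (assert (w v * w j0 <= 1) by nra; nra).
        destruct H as [H|H]; [left; now apply exp_increasing|right; now rewrite H]. }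
      assert (H2 : 1 <= exp ell) by (assert (H := exp_ineq1_le ell); lra). nra.
    * rewrite (lsum_ext _ _ (law (pr v j))) by (intros; rewrite exp_0; ring).
      rewrite exp_0. right. apply law_on_pairs. apply pr_in_pairs; auto.
  + rewrite <- (fsum_delta n j0 ell Hj0) at 1. apply fsum_le. intros j _.
    destruct (Nat.eqb j v), (Nat.eqb j j0); lra.
- apply Rle_trans with 0; [|apply Rlt_le, exp_pos].
  apply Pr_false; auto using law_on_pairs. intros o Ho [Hne H].
  assert (H1 := entry_rate_bound L v j0 (o (pr v j0)) L_ge1 (Ho _)).
  assert (H2 := entry_rate_bound L j0 v (o (pr v j0)) L_ge1 (Ho _)).
  assert (Hb : b2r (fst (o (pr v j0))) <= 1) by (destruct (fst (o (pr v j0))); simpl; lra).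
  assert (H3 : / 64 <= ell * / INR L).
  { apply Rmult_le_reg_r with (INR L); [lra|]. rewrite Rmult_assoc, Rinv_l by lra. lra. }
  assert (H4 : / 8 <= sqrt (ell * / INR L)).
  { rewrite <- (sqrt_pow2 (/ 8)) by lra. apply sqrt_le_1_alt. lra. }
  nra.
Qed.

(** A set of m vertices, at most half of all, is separated from the rest by
    [N = m * (n - m) >= n * m / 2] pairs. With exponent parameter 1/4 each such pair contributes a
    factor at most [exp (- p / 16)]. *)
Lemma cut_chernoff (chi : nat -> bool) om :
  (2 * card n chi <= n)%nat -> supported sup om ->
  Pr law sup (pairs n)
    (fun o => dsum n (fun i j =>
        (rates n L (map o (pairs n)) i j + rates n L (map o (pairs n)) j i)
        * Rabs (b2r (chi i) - b2r (chi j))) < INR n * p / 2 * INR (card n chi)) om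
  <= exp (- (INR n * p / 32)) ^ card n chi.
Proof.
intros Hchi Hom. set (m := card n chi) in *.
set (c := fun i j => Rabs (b2r (chi i) - b2r (chi j))).
assert (Hc01 : forall i j, c i j = 0 \/ c i j = 1).
{ intros i j. unfold c. destruct (chi i), (chi j); simpl; unfold Rabs; destruct Rcase_abs; lra. }
assert (Hcsym : forall i j, c i j = c j i) by (intros; unfold c; apply Rabs_minus_sym).
assert (Hcdiag : forall i, c i i = 0) by (intros; unfold c; rewrite Rminus_diag, Rabs_R0; reflexivity).
set (N := lsum (pairs n) (fun q => c (fst q) (snd q))).
assert (HN : INR n / 2 * INR m <= N).
{ assert (H := dsum_pairs n c (fun i j _ _ => Hcsym i j) (fun i _ => Hcdiag i)). fold N in H.
  assert (E : dsum n c = 2 * INR n * INR m - 2 * INR m * INR m).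
  { rewrite (dsum_ext n c (fun i j => b2r (chi i) + b2r (chi j) - 2 * (b2r (chi i) * b2r (chi j)))).
    - rewrite dsum_minus, dsum_plus, dsum_scal. unfold m. rewrite card_fsum. unfold dsum.
      rewrite (fsum_ext n (fun i => fsum n (fun _ => b2r (chi i))) (fun i => INR n * b2r (chi i)))
        by (intros; apply fsum_const).
      rewrite (fsum_ext n (fun i => fsum n (fun j => b2r (chi i) * b2r (chi j)))
        (fun i => b2r (chi i) * fsum n (fun j => b2r (chi j)))) by (intros; apply fsum_scal).
      rewrite fsum_scal, fsum_const, fsum_scal_r. ring.
    - intros i j _ _. unfold c. destruct (chi i), (chi j); simpl; unfold Rabs; destruct Rcase_abs; lra. }
  assert (H2 : 2 * INR m <= INR n).
  { apply le_INR in Hchi. rewrite mult_INR in Hchi. simpl in Hchi. lra. }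
  assert (H3 := pos_INR m). nra. }
set (phi := fun (q : site) (x : entry) => exp (c (fst q) (snd q) * ((p / 2 - b2r (fst x)) / 4))).
apply Rle_trans with (Ex law sup (pairs n) (fun o => lprod (pairs n) (fun q => phi q (o q))) om).
- assert (HE : forall o, lprod (pairs n) (fun q => phi q (o q)) =
    exp ((p / 2 * N - lsum (pairs n) (fun q => c (fst q) (snd q) * b2r (fst (o q)))) / 4)).
  { intros o. unfold phi. rewrite <- exp_lsum. f_equal. unfold N, Rdiv.
    rewrite <- !lsum_scal, <- lsum_minus, <- lsum_scal_r. apply lsum_ext. intros; field. }
  apply Pr_le_Ex; auto using law_on_pairs; intros o Ho; rewrite HE.
  + apply Rlt_le, exp_pos.
  + intros H.
    rewrite (dsum_pairs n (fun i j => (rates n L (map o (pairs n)) i j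
      + rates n L (map o (pairs n)) j i) * Rabs (b2r (chi i) - b2r (chi j)))) in H.
    * rewrite (lsum_ext _ _ (fun q => c (fst q) (snd q) * b2r (fst (o q)))) in H.
      -- match goal with |- 1 <= exp ?a => assert (H' := exp_ineq1_le a) end. nra.
      -- intros [i j] Hq. apply in_pairs in Hq. cbn [fst snd].
         rewrite rates_row, rates_col by lia. destruct (Nat.eqb_spec j i); [lia|].
         rewrite entry_rate_sum by lia. unfold pr. destruct (Nat.ltb_spec i j); [|lia].
         unfold c. ring.
    * intros i j _ _. rewrite Rabs_minus_sym. ring.
    * intros i _. rewrite Rminus_diag, Rabs_R0. ring.
- rewrite Ex_prod by auto using NoDup_pairs.
  apply Rle_trans with (lprod (pairs n) (fun q => exp (- (p / 16) * c (fst q) (snd q)))).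
  + apply lprod_le. intros q Hq. split.
    * apply lsum_nonneg. intros x Hx. apply Rmult_le_pos; [|apply Rlt_le, exp_pos].
      now apply law_on_pairs.
    * unfold phi. destruct (Hc01 (fst q) (snd q)) as [-> | ->].
      -- rewrite Rmult_0_r, exp_0. right. rewrite (lsum_ext _ _ (law q)).
         ++ now apply law_on_pairs.
         ++ intros. rewrite Rmult_0_l, exp_0. ring.
      -- unfold sup, law. rewrite entry_ex. cbn [fst b2r]. rewrite !bit_ex_const.
         replace (1 * ((p / 2 - 1) / 4)) with (p / 8 + - / 4) by field.
         replace (1 * ((p / 2 - 0) / 4)) with (p / 8) by field.
         replace (- (p / 16) * 1) with (p / 8 + - (3 * p / 16)) by field.
         rewrite !exp_plus.
         assert (H1 : exp (- / 4) <= 1 + - / 4 + (- / 4) ^ 2)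
           by (apply exp_le_quad; rewrite Rabs_Ropp, Rabs_right; lra).
         assert (H2 := exp_ineq1_le (- (3 * p / 16))). assert (H3 := exp_pos (p / 8)).
         apply Rle_trans with (exp (p / 8) * (p * exp (- / 4) + (1 - p))); [right; ring|].
         apply Rmult_le_compat_l; nra.
  + rewrite <- exp_lsum, lsum_scal. fold N.
    rewrite <- exp_INR_mult.
    assert (H : - (p / 16) * N <= INR m * - (INR n * p / 32)) by nra.
    destruct H as [H|H]; [left; now apply exp_increasing|right; now rewrite H].
Qed.

(** Because the failure probability is [q ^ m] for sets of size m, summing over nonempty sets gives
    at most [(1 + q) ^ n - 1 <= exp (n * q) - 1 <= 2 * n * q], and [n * q] is at most
    [exp (- (5 * ell))]. *)
Lemma cut_bound_whp om :
  supported sup om -> exp ell = INR n -> 192 * ell <= INR n * p ->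
  Pr law sup (pairs n) (fun o => ~ cut_bound n (fun i j =>
       rates n L (map o (pairs n)) i j + rates n L (map o (pairs n)) j i) (INR n * p / 2)) om
  <= 2 * exp (- (5 * ell)).
Proof.
intros Hom Hn Hr.
set (q := exp (- (INR n * p / 32))).
assert (Hq0 : 0 < q) by apply exp_pos.
assert (Hq : q <= exp (- (6 * ell))).
{ unfold q. assert (H : - (INR n * p / 32) <= - (6 * ell)) by lra.
  destruct H as [H|H]; [left; now apply exp_increasing|right; now rewrite H]. }
set (bad := fun (l : list bool) (o : config) =>
  (2 * card n (list_chi l) <= n)%nat /\
  dsum n (fun i j =>
        (rates n L (map o (pairs n)) i j + rates n L (map o (pairs n)) j i)
        * Rabs (b2r (list_chi l i) - b2r (list_chi l j))) < INR n * p / 2 * INR (card n (list_chi l))).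
apply Rle_trans with (Pr law sup (pairs n) (fun o => exists l, In l (bitlists n) /\ bad l o) om).
{ apply Pr_mono; auto using law_on_pairs. intros o Ho H. apply NNPP. intros Hno. apply H.
  intros chi Hchi. set (l := map chi (seq 0 n)).
  assert (Hl : length l = n) by (unfold l; now rewrite length_map, length_seq).
  assert (Hlc : forall i, (i < n)%nat -> list_chi l i = chi i).
  { intros i Hi. unfold list_chi, l. rewrite (nth_indep _ _ (chi 0%nat)) by now rewrite length_map, length_seq.
    rewrite map_nth, seq_nth by assumption. reflexivity. }
  assert (Hcard : card n (list_chi l) = card n chi).
  { apply INR_eq. rewrite !card_fsum. apply fsum_ext. intros i Hi. now rewrite Hlc. }
  apply Rnot_lt_le. intros Hlt. apply Hno. exists l. split.
  - rewrite <- Hl. apply in_bitlists.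
  - unfold bad. rewrite Hcard. split; [assumption|].
    rewrite (dsum_ext n _ (fun i j =>
        (rates n L (map o (pairs n)) i j + rates n L (map o (pairs n)) j i)
        * Rabs (b2r (chi i) - b2r (chi j)))); [assumption|].
    intros i j Hi Hj. now rewrite !Hlc. }
eapply Rle_trans; [now apply Pr_union; auto using law_on_pairs|].
apply Rle_trans with (lsum (bitlists n) (fun l => if Nat.eqb (ntrue l) 0 then 0 else q ^ ntrue l)).
{ apply lsum_le. intros l Hl. apply bitlists_length in Hl.
  assert (Hc : card n (list_chi l) = ntrue l) by (rewrite <- Hl; apply card_list_chi).
  destruct (le_lt_dec (2 * card n (list_chi l)) n) as [Hle|Hgt].
  - apply Rle_trans with (Pr law sup (pairs n) (fun o => dsum n (fun i j =>
        (rates n L (map o (pairs n)) i j + rates n L (map o (pairs n)) j i)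
        * Rabs (b2r (list_chi l i) - b2r (list_chi l j))) < INR n * p / 2 * INR (card n (list_chi l))) om).
    + apply Pr_mono; auto using law_on_pairs. now intros o _ [_ H].
    + destruct (Nat.eqb_spec (ntrue l) 0) as [E|E].
      * apply Pr_false; auto using law_on_pairs. intros o Ho. rewrite Hc, E, Rmult_0_r.
        apply Rle_not_lt. unfold dsum. apply fsum_nonneg. intros i _. apply fsum_nonneg. intros j _.
        apply Rmult_le_pos; [|apply Rabs_pos].
        assert (H1 := rates_bound n L o L_ge1 Ho i j). assert (H2 := rates_bound n L o L_ge1 Ho j i). lra.
      * rewrite <- Hc. now apply cut_chernoff.
  - apply Rle_trans with 0; [|destruct (Nat.eqb (ntrue l) 0); [lra|apply pow_le; lra]].
    apply Pr_false; auto using law_on_pairs. intros o _ [H _]. lia. }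
assert (Htot : lsum (bitlists n) (fun l => q ^ ntrue l) = (1 + q) ^ n).
{ rewrite (lsum_ext _ _ (fun l => lprod l (fun b : bool => if b then q else 1))).
  - rewrite lsum_bitlists_prod. f_equal. ring.
  - intros l _. unfold ntrue. induction l as [|b l IH]; [reflexivity|]. rewrite lprod_cons, <- IH.
    destruct b; simpl; ring. }
(* The empty set accounts for the 1 to be subtracted from [(1 + q) ^ n]. *)
assert (Hempty : 1 <= lsum (bitlists n) (fun l => q ^ ntrue l - if Nat.eqb (ntrue l) 0 then 0 else q ^ ntrue l)).
{ set (l0 := repeat false n).
  assert (E : ntrue l0 = 0%nat).
  { unfold l0. clear. induction n as [|k IH]; [reflexivity|]. exact IH. }
  eapply Rle_trans; [|apply (lsum_term_le _ _ l0)].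
  - cbv beta. rewrite E. simpl. lra.
  - intros l _. destruct (Nat.eqb (ntrue l) 0); [|lra].
    assert (0 <= q ^ ntrue l) by (apply pow_le; lra). lra.
  - assert (H := in_bitlists l0). unfold l0 in H at 2. rewrite repeat_length in H. exact H. }
rewrite lsum_minus, Htot in Hempty.
set (x := INR n * q).
assert (Hx5 : x <= exp (- (5 * ell))).
{ unfold x. rewrite <- Hn. replace (- (5 * ell)) with (ell + - (6 * ell)) by ring.
  rewrite exp_plus. apply Rmult_le_compat_l; [apply Rlt_le, exp_pos|]. exact Hq. }
assert (Hx0 : 0 <= x) by (apply Rmult_le_pos; [apply pos_INR|lra]).
assert (He5 : exp (- (5 * ell)) <= / 4).
{ rewrite exp_Ropp. apply Rinv_le_contravar; [lra|]. assert (H := exp_ineq1_le (5 * ell)). lra. }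
assert (Hpow : (1 + q) ^ n <= exp x).
{ unfold x. clearbody q. clear - Hq0. induction n as [|k IH]; [simpl; rewrite Rmult_0_l, exp_0; lra|].
  rewrite S_INR. replace ((INR k + 1) * q) with (q + INR k * q) by ring. rewrite exp_plus. simpl pow.
  apply Rmult_le_compat; [lra|apply pow_le; lra| |assumption]. apply exp_ineq1_le. }
assert (Hexp : exp x <= 1 + x + x ^ 2) by (apply exp_le_quad; rewrite Rabs_right; lra).
nra.
Qed.

Lemma erase_rates_agree v o o' : agree_off (row n v) o o' ->
  erase v (rates n L (map o' (pairs n))) = erase v (rates n L (map o (pairs n))).
Proof.
intros H. apply functional_extensionality; intros i. apply functional_extensionality; intros j.
unfold erase. destruct (Nat.eqb_spec i v) as [Hi|Hi], (Nat.eqb_spec j v) as [Hj|Hj];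
  try reflexivity. cbn [orb]. rewrite !rates_map.
destruct (_ && _ && _)%bool; [|reflexivity]. rewrite H; [reflexivity|].
rewrite in_row. intros (k & Hk & Hkv & E). unfold pr in E.
destruct (Nat.ltb i j), (Nat.ltb v k); injection E as E1 E2; congruence.
Qed.

(** Union bound: 2 from the cuts, 6 from six row events at each of n vertices, and 1 from the edge
    events over n^2 ordered pairs. *)
Lemma typical_whp om :
  supported sup om -> exp ell = INR n -> 192 * ell <= INR n * p ->
  Pr law sup (pairs n)
    (fun o => ~ typical n p ell (/ sqrt (INR L)) w (rates n L (map o (pairs n)))) om
  <= 9 * exp (- (5 * ell)).
Proof.
intros Hom Hn Hr.
set (K := fun o => rates n L (map o (pairs n))).
set (dev := 8 * sqrt (INR n * p * ell)).
assert (Hdev : 0 <= dev) by (unfold dev; assert (H := sqrt_pos (INR n * p * ell)); lra).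
(* Leave-one-out coefficients rescaled to absolute value at most 1, as [row_deviation] requires. If
   the maximum is 0, all of them vanish and the quotient is 0 as well. *)
set (cf := fun v (o : config) j =>
  w j * loo n w v (K o) j / linf n (fun j => w j * loo n w v (K o) j)).
assert (Hcf : forall v o j, (j < n)%nat -> Rabs (cf v o j) <= 1 /\
  w j * loo n w v (K o) j = linf n (fun j => w j * loo n w v (K o) j) * cf v o j).
{ intros v o j Hj. unfold cf. set (B := linf n (fun j => w j * loo n w v (K o) j)).
  assert (HB0 : 0 <= B) by apply linf_nonneg.
  assert (HB := linf_ub n (fun j => w j * loo n w v (K o) j) j Hj). cbv beta in HB. fold B in HB.
  destruct (Req_dec B 0) as [E|E].
  - assert (Hz : w j * loo n w v (K o) j = 0).
    { apply NNPP. intros Hnz. apply Rabs_pos_lt in Hnz. lra. }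
    rewrite Hz, E. unfold Rdiv. rewrite !Rmult_0_l, Rabs_R0. lra.
  - split; [|field; assumption].
    unfold Rdiv. rewrite Rabs_mult, (Rabs_right (/ B)) by (apply Rle_ge, Rlt_le, Rinv_0_lt_compat; lra).
    apply Rmult_le_reg_r with B; [lra|]. rewrite Rmult_assoc, Rinv_l by assumption. lra. }
assert (Hcf_dep : forall v o o', agree_off (row n v) o o' -> cf v o' = cf v o).
{ intros v o o' H. unfold cf.
  assert (E : loo n w v (K o') = loo n w v (K o)) by (apply loo_erase, erase_rates_agree, H).
  now rewrite E. }
set (bad_deg := fun v (o : config) =>
  dev < fsum n (fun j => if Nat.eqb j v then 0 else b2r (fst (o (pr v j))) - p)).
set (bad_out := fun v (o : config) =>
  dev < fsum n (fun j => if Nat.eqb j v then 0 else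
    - entry_rate L v j (o (pr v j)) - - (p * kbar w v j))).
set (bad_loo := fun sg v (o : config) =>
  dev < fsum n (fun j => if Nat.eqb j v then 0 else
    sg * cf v o j * entry_rate L j v (o (pr v j)) - sg * cf v o j * (p * kbar w j v))).
set (bad_noise := fun sg v (o : config) =>
  9 * sqrt (ell * (/ sqrt (INR L)) ^ 2 * (p * fsum n w) * w v) <
       fsum n (fun j => if Nat.eqb j v then 0 else
         sg * (w v * entry_rate L v j (o (pr v j)) - w j * entry_rate L j v (o (pr v j))))).
(* One tail suffices here: exchanging [v] and [j0] reverses the sign. *)
set (bad_edge := fun v j0 (o : config) =>
  j0 <> v /\ 18 * sqrt (ell * (/ sqrt (INR L)) ^ 2) <
       w v * entry_rate L v j0 (o (pr v j0)) - w j0 * entry_rate L j0 v (o (pr v j0))).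
set (bad_cut := fun o => ~ cut_bound n (fun i j => K o i j + K o j i) (INR n * p / 2)).
set (bad_row := fun v o => bad_deg v o \/ bad_out v o \/ bad_loo 1 v o \/ bad_loo (-1) v o \/
  bad_noise 1 v o \/ bad_noise (-1) v o).
assert (Hlaw := law_on_pairs).
apply Rle_trans with (Pr law sup (pairs n) (fun o => bad_cut o \/
  ((exists v, In v (seq 0 n) /\ bad_row v o) \/
   (exists v, In v (seq 0 n) /\ exists j0, In j0 (seq 0 n) /\ bad_edge v j0 o))) om).
{ apply Pr_mono; auto. intros o Ho H. apply NNPP. intros Hno. apply H.
  apply not_or_and in Hno. destruct Hno as [Hcut Hno].
  apply not_or_and in Hno. destruct Hno as [Hrow Hedge].
  assert (Hrow' : forall v, (v < n)%nat -> ~ bad_row v o)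
    by (intros v Hv Hb; apply Hrow; exists v; split; [now apply in_seq0|assumption]).
  assert (Hedge' : forall v j, (v < n)%nat -> (j < n)%nat -> ~ bad_edge v j o)
    by (intros v j Hv Hj Hb; apply Hedge; exists v; split; [now apply in_seq0|];
        exists j; split; [now apply in_seq0|assumption]).
  clear Hrow Hedge. unfold bad_row in Hrow'. change (rates n L (map o (pairs n))) with (K o).
  assert (HL1 : 0 < / sqrt (INR L)) by (apply Rinv_0_lt_compat, sqrt_lt_R0, lt_0_INR; lia).
  split.
  - apply NNPP. exact Hcut.
  - intros v Hv. assert (Hb : ~ bad_deg v o) by (intros Hb; apply (Hrow' v Hv); tauto).
    unfold bad_deg in Hb. apply Rnot_lt_le in Hb. fold dev.
    apply Rle_trans with (fsum n (fun j => p + (if Nat.eqb j v then 0 else b2r (fst (o (pr v j))) - p))).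
    + apply fsum_le. intros j Hj. unfold K. rewrite rates_row, rates_col by assumption.
      destruct (Nat.eqb_spec j v); [lra|]. rewrite entry_rate_sum by auto. lra.
    + rewrite fsum_plus, fsum_const. lra.
  - intros v Hv. assert (Hb : ~ bad_out v o) by (intros Hb; apply (Hrow' v Hv); tauto).
    unfold bad_out in Hb. apply Rnot_lt_le in Hb. fold dev.
    rewrite (fsum_ext n _ (fun j => p * kbar w v j - K o v j)) in Hb.
    + rewrite fsum_minus, fsum_scal in Hb. change (fun j => kbar w v j) with (kbar w v) in Hb.
      change (fun j => K o v j) with (K o v) in Hb. lra.
    + intros j Hj. unfold K. rewrite rates_row by assumption. unfold kbar. rewrite (Nat.eqb_sym v j).
      destruct (Nat.eqb j v); ring.
  - intros v Hv. set (V := ell * (/ sqrt (INR L)) ^ 2 * (p * fsum n w) * w v) in *.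
    assert (HV : 0 <= V).
    { unfold V. destruct (fsum_kap v Hv) as [_ HP]. assert (Hw := w_pos v Hv).
      repeat apply Rmult_le_pos; try lra; try apply pow2_ge_0. apply fsum_nonneg.
      intros; now apply Rlt_le, w_pos. }
    assert (Hb1 : ~ bad_noise 1 v o) by (intros Hb; apply (Hrow' v Hv); tauto).
    assert (Hb2 : ~ bad_noise (-1) v o) by (intros Hb; apply (Hrow' v Hv); tauto).
    unfold bad_noise in Hb1, Hb2. apply Rnot_lt_le in Hb1, Hb2. fold V in Hb1, Hb2.
    assert (HM : Mop n w (K o) (fun _ => 1) v = fsum n (fun j => if Nat.eqb j v then 0 else
       (w v * entry_rate L v j (o (pr v j)) - w j * entry_rate L j v (o (pr v j))))).
    { unfold Mop. apply fsum_ext. intros j Hj. unfold K. rewrite rates_row, rates_col by assumption.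
      destruct (Nat.eqb j v); ring. }
    set (S := fsum n (fun j => if Nat.eqb j v then 0 else
       (w v * entry_rate L v j (o (pr v j)) - w j * entry_rate L j v (o (pr v j))))) in *.
    assert (HSg : forall sg, fsum n (fun j => if Nat.eqb j v then 0 else
       sg * (w v * entry_rate L v j (o (pr v j)) - w j * entry_rate L j v (o (pr v j)))) = sg * S).
    { intros sg. unfold S. rewrite <- fsum_scal. apply fsum_ext. intros j _. destruct (Nat.eqb j v); ring. }
    rewrite HSg in Hb1, Hb2. rewrite HM.
    assert (Hsq : sqrt V ^ 2 = V) by now apply pow2_sqrt.
    assert (Hs0 := sqrt_pos V). nra.
  - intros i j Hi Hj. set (V := ell * (/ sqrt (INR L)) ^ 2) in *.
    assert (HV : 0 <= V) by (apply Rmult_le_pos; [lra|apply pow2_ge_0]).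
    destruct (Nat.eq_dec j i) as [->|Hji].
    + unfold K. rewrite rates_diag. lra.
    + assert (Hb1 : ~ bad_edge i j o) by auto. assert (Hb2 : ~ bad_edge j i o) by auto.
      unfold bad_edge in Hb1, Hb2. rewrite (pr_sym j i) in Hb2. fold V in Hb1, Hb2.
      assert (H1 := entry_rate_bound L i j (o (pr i j)) L_ge1 (Ho _)).
      assert (H2 := entry_rate_bound L j i (o (pr i j)) L_ge1 (Ho _)).
      assert (H3 := entry_rate_sum L i j (o (pr i j)) ltac:(auto)).
      unfold K. rewrite (rates_row n L o i j), (rates_col n L o i j) by assumption.
      destruct (Nat.eqb_spec j i); [easy|]. rewrite H3.
      set (a := entry_rate L i j (o (pr i j))) in *. set (b := entry_rate L j i (o (pr i j))) in *.
      assert (Hc1 : w i * a - w j * b <= 18 * sqrt V) by (apply Rnot_lt_le; intros Hc; apply Hb1; auto).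
      assert (Hc2 : w j * b - w i * a <= 18 * sqrt V) by (apply Rnot_lt_le; intros Hc; apply Hb2; auto).
      assert (Hsq : sqrt V ^ 2 = V) by now apply pow2_sqrt.
      assert (Hs0 := sqrt_pos V).
      destruct (fst (o (pr i j))); cbn [b2r] in *.
      * nra.
      * replace a with 0 by lra. replace b with 0 by lra. lra.
  - intros v Hv. fold dev.
    assert (Hb1 : ~ bad_loo 1 v o) by (intros Hb; apply (Hrow' v Hv); tauto).
    assert (Hb2 : ~ bad_loo (-1) v o) by (intros Hb; apply (Hrow' v Hv); tauto).
    unfold bad_loo in Hb1, Hb2. apply Rnot_lt_le in Hb1, Hb2.
    set (B := linf n (fun j => w j * loo n w v (K o) j)) in *.
    assert (HB0 : 0 <= B) by apply linf_nonneg.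
    set (S := fsum n (fun j => (K o j v - p * kbar w j v) * cf v o j)).
    assert (HSg : forall sg, fsum n (fun j => if Nat.eqb j v then 0 else
       sg * cf v o j * entry_rate L j v (o (pr v j)) - sg * cf v o j * (p * kbar w j v)) = sg * S).
    { intros sg. unfold S. rewrite <- fsum_scal. apply fsum_ext. intros j Hj.
      unfold K. rewrite rates_col by assumption. unfold kbar.
      destruct (Nat.eqb j v); ring. }
    rewrite HSg in Hb1, Hb2.
    rewrite (fsum_ext n _ (fun j => B * ((K o j v - p * kbar w j v) * cf v o j))).
    + rewrite fsum_scal. fold S. rewrite Rabs_mult, (Rabs_right B) by lra. rewrite Rmult_comm.
      apply Rmult_le_compat_r; [assumption|]. unfold Rabs; destruct Rcase_abs; lra.
    + intros j Hj. destruct (Hcf v o j Hj) as [_ E]. fold B in E. rewrite E. ring. }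
assert (Hrowpr : forall v, (v < n)%nat -> Pr law sup (pairs n) (bad_row v) om <= 6 * exp (- (7 * ell))).
{ intros v Hv.
  assert (Hdegp : Pr law sup (pairs n) (bad_deg v) om <= exp (- (7 * ell))).
  { apply (row_deviation v (fun _ _ x => b2r (fst x)) (fun _ _ => p)); auto.
    - intros o j x _ _ _. destruct (fst x); simpl; rewrite ?Rabs_R0, ?Rabs_R1; lra.
    - intros. apply entry_ex_edge. }
  assert (Houtp : Pr law sup (pairs n) (bad_out v) om <= exp (- (7 * ell))).
  { apply (row_deviation v (fun _ j x => - entry_rate L v j x) (fun _ j => - (p * kbar w v j))); auto.
    - intros o j x _ _ Hx. assert (H := entry_rate_bound L v j x L_ge1 Hx).
      rewrite Rabs_Ropp, Rabs_right; lra.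
    - intros o j _ Hj Hjv.
      rewrite (lsum_ext _ _ (fun x => -1 * (law (pr v j) x * entry_rate L v j x))) by (intros; ring).
      rewrite lsum_scal, entry_ex_rate by auto. ring. }
  assert (Hloop : forall sg, sg = 1 \/ sg = -1 ->
    Pr law sup (pairs n) (bad_loo sg v) om <= exp (- (7 * ell))).
  { intros sg Hsg.
    apply (row_deviation v (fun o j x => sg * cf v o j * entry_rate L j v x)
      (fun o j => sg * cf v o j * (p * kbar w j v))); auto.
    - intros o o' H. now rewrite (Hcf_dep v o o' H).
    - intros o j x Ho Hj Hx. assert (H := entry_rate_bound L j v x L_ge1 Hx).
      destruct (Hcf v o j Hj) as [H1 _]. rewrite !Rabs_mult, (Rabs_right (entry_rate L j v x)) by lra.
      replace (Rabs sg) with 1 by (destruct Hsg as [->| ->]; unfold Rabs; destruct Rcase_abs; lra).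
      assert (H2 := Rabs_pos (cf v o j)). nra.
    - intros o j _ Hj Hjv. rewrite <- (entry_ex_rate j v) by auto. rewrite (pr_sym j v), <- lsum_scal.
      apply lsum_ext. intros; ring. }
  assert (Hnoisep : forall sg, sg = 1 \/ sg = -1 ->
    Pr law sup (pairs n) (bad_noise sg v) om <= exp (- (7 * ell)))
    by (intros sg Hsg; apply row_noise; auto).
  assert (Hl1 := Hloop 1 ltac:(auto)). assert (Hl2 := Hloop (-1) ltac:(auto)).
  assert (Hn1 := Hnoisep 1 ltac:(auto)). assert (Hn2 := Hnoisep (-1) ltac:(auto)).
  unfold bad_row.
  eapply Rle_trans; [apply Pr_or; auto|].
  eapply Rle_trans; [apply Rplus_le_compat_l, Pr_or; auto|].
  eapply Rle_trans; [apply Rplus_le_compat_l, Rplus_le_compat_l, Pr_or; auto|].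
  eapply Rle_trans; [apply Rplus_le_compat_l, Rplus_le_compat_l, Rplus_le_compat_l, Pr_or; auto|].
  eapply Rle_trans; [apply Rplus_le_compat_l, Rplus_le_compat_l, Rplus_le_compat_l,
    Rplus_le_compat_l, Pr_or; auto|].
  change (fun o => bad_deg v o) with (bad_deg v) in *.
  change (fun o => bad_out v o) with (bad_out v) in *.
  lra. }
eapply Rle_trans; [apply Pr_or; auto|].
eapply Rle_trans; [apply Rplus_le_compat; [now apply cut_bound_whp|apply Pr_or; auto]|].
assert (H1 : Pr law sup (pairs n) (fun o => exists v, In v (seq 0 n) /\ bad_row v o) om
  <= 6 * exp (- (6 * ell))).
{ eapply Rle_trans; [apply Pr_union; auto|].
  apply Rle_trans with (lsum (seq 0 n) (fun _ => 6 * exp (- (7 * ell)))).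
  - apply lsum_le. intros v Hv. apply Hrowpr. now apply in_seq0.
  - rewrite lsum_const, length_seq, <- Hn.
    replace (- (6 * ell)) with (ell + - (7 * ell)) by ring. rewrite exp_plus. right. ring. }
assert (H2 : Pr law sup (pairs n) (fun o => exists v, In v (seq 0 n) /\
    exists j0, In j0 (seq 0 n) /\ bad_edge v j0 o) om <= exp (- (15 * ell))).
{ eapply Rle_trans; [apply Pr_union; auto|].
  apply Rle_trans with (lsum (seq 0 n) (fun _ => exp (- (16 * ell)))).
  - apply lsum_le. intros v Hv. apply in_seq0 in Hv.
    eapply Rle_trans; [apply Pr_union; auto|].
    apply Rle_trans with (lsum (seq 0 n) (fun _ => exp (- (17 * ell)))).
    + apply lsum_le. intros j Hj. apply in_seq0 in Hj. apply edge_noise; auto.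
    + rewrite lsum_const, length_seq, <- Hn.
      replace (- (16 * ell)) with (ell + - (17 * ell)) by ring. rewrite exp_plus. lra.
  - rewrite lsum_const, length_seq, <- Hn.
    replace (- (15 * ell)) with (ell + - (16 * ell)) by ring. rewrite exp_plus. lra. }
assert (H3 : exp (- (6 * ell)) <= exp (- (5 * ell))) by (left; apply exp_increasing; lra).
assert (H4 : exp (- (15 * ell)) <= exp (- (5 * ell))) by (left; apply exp_increasing; lra).
lra.
Qed.

End Concentration.

(** * Scale invariance and conclusion *)

(** The law sees the scores only through their ratios, which permits the normalisation [w 0 = 1]. *)
Lemma prob_ystar_ext n L p w u E :
  (forall i j, (i < n)%nat -> (j < n)%nat -> ystar w i j = ystar u i j) ->
  prob n L p w E = prob n L p u E.
Proof.
intros H. unfold prob. f_equal. apply map_ext. intros om.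
destruct (excluded_middle_informative (E om)); [|reflexivity].
unfold weight. f_equal. apply map_ext_in. intros [[i j] x] Hq.
apply in_combine_l, in_pairs in Hq. cbn [fst snd]. unfold entry_weight.
now rewrite H by lia.
Qed.

Theorem theorem5 :
  forall cd : R, 2 <= cd ->
  exists c0 c1 C C' : R, 0 < c0 /\ 0 < c1 /\ 0 < C /\ 0 < C' /\
  forall (n L K : nat) (p wmin wmax : R) (w : nat -> R),
    (1 <= n)%nat -> (1 <= L)%nat -> (1 <= K)%nat -> (K < n)%nat ->
    0 < wmin -> wmin <= wmax ->
    (forall i, (i < n)%nat -> wmin <= w i <= wmax) ->
    (forall i j, (i <= j)%nat -> (j < n)%nat -> w j <= w i) ->
    p <= 1 ->
    p > c0 * (wmax / wmin) ^ 5 * ln (INR n) / INR n ->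
    let kappa := wmax / wmin in
    let d := cd * INR n * p in
    prob n L p w (fun om =>
      (exists pi, stationary n (Pmat n L d om) pi) /\
      forall pi, stationary n (Pmat n L d om) pi ->
        linf n (fun i => pi i - pistar n w i) / linf n (pistar n w)
          <= C * kappa * sqrt (ln (INR n) / (INR n * p * INR L)) /\
        ((0 < DeltaK w wmax K /\
          INR n ^ 2 * p * INR L / 2
            >= c1 * (kappa ^ 2 * INR n * ln (INR n)) / (DeltaK w wmax K) ^ 2) ->
         topK_recovered n K pi))
    >= 1 - C' / INR n ^ 5.
Proof.
intros cd Hcd. exists 10000000000, (4 * 70000 ^ 2), 70000, 9.
split; [lra|]. split; [lra|]. split; [lra|]. split; [lra|].
intros n L K p wmin wmax w _ HL HK1 HKn Hwmin Hwm Hw Hdec Hp1 Hp kappa d.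
assert (Hn2 : (2 <= n)%nat) by lia.
assert (HnR : 2 <= INR n) by (replace 2 with (INR 2) by (simpl; lra); now apply le_INR).
assert (Hkap : 1 <= kappa).
{ unfold kappa. apply Rmult_le_reg_r with wmin; [lra|]. field_simplify; lra. }
assert (Hln2 : / 2 < ln (INR n)).
{ apply Rlt_le_trans with (ln 2); [apply ln_lt_2|].
  destruct HnR as [H|H]; [left; apply ln_increasing; lra|right; now rewrite H]. }
assert (Hk5 : kappa ^ 4 <= kappa ^ 5) by (apply Rle_pow; [assumption|lia]).
assert (Hk4 : kappa ^ 2 <= kappa ^ 4) by (apply Rle_pow; [assumption|lia]).
assert (Hk2 : 1 <= kappa ^ 2) by nra.
set (ell := ln (INR n)) in *. fold kappa in Hp.
assert (Hr5 : 10000000000 * kappa ^ 5 * ell < INR n * p).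
{ apply Rgt_lt in Hp. apply Rmult_lt_compat_l with (r := INR n) in Hp; [|lra].
  replace (INR n * (10000000000 * kappa ^ 5 * ell / INR n)) with (10000000000 * kappa ^ 5 * ell)
    in Hp by (field; lra). exact Hp. }
(* The fourth power makes [kap ^ 2 * rho] small in [typical_event]; the lower ones serve the tail
   bounds. *)
assert (Hr4 : 10000000000 * kappa ^ 4 * ell <= INR n * p) by nra.
assert (Hr2 : 10000000000 * kappa ^ 2 * ell <= INR n * p) by nra.
assert (Hr1 : 10000000000 * ell <= INR n * p) by nra.
assert (Hp0 : 0 < p) by nra.
assert (Hexp : exp ell = INR n) by (apply exp_ln; lra).
(* As [p] is at most 1, the lower bound on [n * p] already forces [n] to exceed [exp 1]. *)
assert (Hell1 : 1 <= ell).
{ rewrite <- (ln_exp 1). assert (H3 : exp 1 < INR n) by (assert (H := exp_le_3); nra).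
  left. apply ln_increasing; [apply exp_pos|assumption]. }
set (u := fun i => w i / w 0%nat).
assert (Hw0 := Hw 0%nat ltac:(lia)).
assert (Hu0 : forall i, (i < n)%nat -> 0 < u i).
{ intros i Hi. apply Rdiv_lt_0_compat; [specialize (Hw i Hi)|]; lra. }
assert (Hu1 : forall i, (i < n)%nat -> u i <= 1).
{ intros i Hi. unfold u. specialize (Hdec 0%nat i ltac:(lia) Hi).
  apply Rmult_le_reg_r with (w 0%nat); [lra|]. field_simplify; lra. }
assert (Huk : forall i, (i < n)%nat -> 1 <= kappa * u i).
{ intros i Hi. unfold u, kappa. specialize (Hw i Hi).
  apply Rmult_le_reg_r with (wmin * w 0%nat); [apply Rmult_lt_0_compat; lra|].
  replace (wmax / wmin * (w i / w 0%nat) * (wmin * w 0%nat)) with (w i * wmax) by (field; lra).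
  rewrite Rmult_1_l. apply Rmult_le_compat; lra. }
rewrite (prob_ystar_ext n L p w u).
2:{ intros i j Hi Hj. assert (H1 := Hw i Hi). assert (H2 := Hw j Hj). unfold ystar, u. field. lra. }
rewrite (prob_Pr n L p u _ _ (supported_default L)).
assert (Hsup := supported_default L).
assert (Hlaw := law_on_pairs n L p u HL Hp0 Hp1 Hu0).
replace (9 / INR n ^ 5) with (9 * exp (- (5 * ell))).
2:{ rewrite exp_Ropp. replace (5 * ell) with (ell + ell + ell + ell + ell) by ring.
    rewrite !exp_plus, Hexp. field. lra. }
eapply Rge_trans; [apply Pr_compl; [exact Hlaw|exact Hsup]|].
apply Rplus_ge_compat_l, Ropp_le_ge_contravar.
eapply Rle_trans; [|apply (typical_whp n L p u HL Hp0 Hp1 Hu0 ell Hell1 ltac:(lra) kappa Hkap Hu1 Huk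
  ltac:(lra) _ Hsup Hexp ltac:(lra))].
apply Pr_mono; auto. intros o Ho H Htyp. apply H.
apply (typical_event n L K p d wmin wmax w); auto.
- unfold d. apply Rmult_lt_0_compat; [apply Rmult_lt_0_compat|]; lra.
- now apply rates_bound.
Qed.
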